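(* Let $n\geq 2$. A continuous, translation invariant Minkowski valuation $\Phi:\mathcal{K}^n\to\mathcal{K}^n$ with origin-symmetric images satisfies (VC) and $\dim(\Phi(\{0\}))=n-1$ if and only if there exist an origin-symmetric $L\in\mathcal{K}^n$ with $\dim L=n-1$ and a segment $S$ centered at the origin with $\dim(L+S)=n$ such that $\Phi(K)=L+V_n(K)S$ for all $K\in\mathcal{K}^n$.
   Context: $\mathcal{K}^n$ is the space of convex bodies in $\mathbb{R}^n$ with Hausdorff metric and Minkowski addition. A Minkowski valuation satisfies $\Phi(K)+\Phi(L)=\Phi(K\cup L)+\Phi(K\cap L)$ whenever $K,L,K\cup L\in\mathcal{K}^n$; translation invariant means $\Phi(K+t)=\Phi(K)$; origin-symmetric means $M=-M$. (VC): there are $c,C>0$ with $cV_n(K)\le V_n(\Phi(K))\le CV_n(K)$ for all $K$. $\dim$ is the dimension of the affine hull. *)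

(* Defs.v *)
From HB Require Import structures.
From mathcomp Require Import all_boot all_order all_algebra.
From mathcomp Require Import all_classical all_reals all_analysis.
Set Implicit Arguments. Unset Strict Implicit. Unset Printing Implicit Defensive.
Import Order.TTheory GRing.Theory Num.Theory.
Import numFieldNormedType.Exports.
Local Open Scope classical_set_scope.
Local Open Scope ring_scope.

Section ConvexGeometry.
Variables (R : realType) (n : nat).
Notation V := 'rV[R]_n.

Definition convexK (K : set V) : Prop :=
  forall x y t, K x -> K y -> 0 <= t <= 1 -> K ((1 - t) *: x + t *: y).

Definition convex_body (K : set V) : Prop :=
  K !=set0 /\ compact K /\ convexK K.

Definition minksum (A B : set V) : set V :=
  [set z | exists x y, A x /\ B y /\ z = x + y].
Definition sdil (c : R) (A : set V) : set V := [set c *: x | x in A].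
Definition stransl (A : set V) (t : V) : set V := [set x + t | x in A].
Definition origin_symmetric (M : set V) : Prop := forall x, M x -> M (- x).

Definition enorm (x : V) : R := Num.sqrt (\sum_(i < n) x ord0 i ^+ 2).
Definition hdist (A B : set V) : R :=
  inf [set e : R | 0 <= e /\
        (forall x, A x -> exists2 y, B y & enorm (x - y) <= e) /\
        (forall y, B y -> exists2 x, A x & enorm (x - y) <= e)].

(* n-dimensional volume: Lebesgue outer measure via countable covers by boxes *)
Definition rbox (a b : V) : set V := [set x | forall i, a ord0 i <= x ord0 i <= b ord0 i].
Definition volume_n (A : set V) : \bar R :=
  ereal_inf [set s : \bar R | exists (a b : nat -> V),
     [/\ (forall k i, a k ord0 i <= b k ord0 i),
         A `<=` \bigcup_k rbox (a k) (b k) &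
         s = (\sum_(0 <= k <oo) (\prod_(i < n) (b k ord0 i - a k ord0 i))%:E)%E]].

(* dimension of the affine hull: the largest d such that K contains
   d+1 affinely independent points x0, x0 + row 0 M, ..., x0 + row (d-1) M *)
Definition has_affindep (K : set V) (d : nat) : Prop :=
  exists (x0 : V) (M : 'M[R]_(d, n)),
    [/\ K x0, (forall i, K (x0 + row i M)) & \rank M = d].
Definition affdim (K : set V) : nat :=
  \max_(d < n.+1 | `[< has_affindep K d >]) (d : nat).

Definition maps_bodies (Phi : set V -> set V) : Prop :=
  forall K, convex_body K -> convex_body (Phi K).
Definition minkowski_valuation (Phi : set V -> set V) : Prop :=
  forall K L, convex_body K -> convex_body L -> convex_body (K `|` L) ->
    minksum (Phi K) (Phi L) = minksum (Phi (K `|` L)) (Phi (K `&` L)).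
Definition hcontinuous (Phi : set V -> set V) : Prop :=
  forall K, convex_body K -> forall eps : R, 0 < eps -> exists2 delta : R, 0 < delta &
    forall L, convex_body L -> hdist K L < delta -> hdist (Phi K) (Phi L) < eps.
Definition transl_invariant (Phi : set V -> set V) : Prop :=
  forall K t, convex_body K -> Phi (stransl K t) = Phi K.
Definition symmetric_images (Phi : set V -> set V) : Prop :=
  forall K, convex_body K -> origin_symmetric (Phi K).
Definition VC (Phi : set V -> set V) : Prop :=
  exists c C : R, [/\ 0 < c, 0 < C & forall K, convex_body K ->
    (c%:E * volume_n K <= volume_n (Phi K) <= C%:E * volume_n K)%E].

Definition centered_segment (S : set V) : Prop :=
  exists v : V, S = [set t *: v | t in [set t : R | -1 <= t <= 1]].

End ConvexGeometry.

(* Main.v *)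
(* Write L = Phi {0}, h for support functions, and w for a normal of the hyperplane
   spanned by L.

   On boxes h (Phi (box t), u) is affine in every edge length.  In direction w it
   vanishes when an edge does, so it equals beta * prod t.  If a symmetric convex body
   contains a basis of the hyperplane and points x, y, its volume is at least
   c |(x . w) (y . u) - (y . w) (x . u)|.  Since V (Phi (box t)) <= C' prod t, this first
   shows Phi = L on flat boxes, hence h (Phi (box t), u) = h (L, u) + sigma u * prod t,
   and then, stretching one edge to infinity, that sigma u = |v . u| for some v.

   To pass from boxes to polytopes, a translation invariant function additive under
   hyperplane cuts and bounded in terms of the number of constraints is zero, by
   induction on the dimension via prisms and wedges.  This shows that Phi = L on
   low-dimensional polytopes, so that h (Phi P, u) - h (L, u) is a simple valuation, and
   that it vanishes for u orthogonal to v.  In direction w it is nonnegative, continuous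
   and equal to beta V on boxes, hence on all polytopes.  The defect of additivity of
   h (Phi P, .) between these two directions is nonnegative, simple and zero on boxes,
   hence zero.  Continuity extends the formula to all bodies.

   Conversely the volume of L + t S is squeezed between multiples of t by linear images
   that stretch a single coordinate. *)
Require Import Defs.
From HB Require Import structures.
From mathcomp Require Import all_boot all_order all_algebra.
From mathcomp Require Import all_classical all_reals all_analysis.
From mathcomp Require Import measurable_realfun ring lra.
Set Implicit Arguments. Unset Strict Implicit. Unset Printing Implicit Defensive.
Import Order.TTheory GRing.Theory Num.Theory.
Import numFieldNormedType.Exports.
Local Open Scope classical_set_scope.
Local Open Scope ring_scope.

(** * Support functions *)

(** In the forward direction the upper bound in (VC) acts only through 2 by 2 determinants: since
    [Phi K] contains the basis taken from [L], one point off the hyperplane and one point far out in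
    another direction already force volume. The lower bound serves to make beta positive.

    Volume is an infimum over countable box covers, so estimates rest on monotonicity, subadditivity
    and images of boxes; additivity of the volume is never established. Where points of [Phi K]
    enter a volume estimate, the constant must not depend on them. This is why shears and coordinate
    scalings get exact constants, while a fixed matrix may have a crude one.

    For a general direction u the sign of h (Phi P, u) - h (L, u) is not known beforehand; only the
    bound from below by - h (L, u) is. This is what calls for a vanishing theorem for bounded
    functions. A sign is at hand in two places: in direction w, where h (L, w) = 0, and for the
    defect in h (., u1 + a w) <= h (., u1) + h (., a w). The decomposition u = u1 + a w, with u1
    orthogonal to v, is chosen to use exactly these. *)

Section SupportFunction.
Context {R : realType} {n : nat}.
Implicit Types (K A B : set 'rV[R]_n) (x y u v : 'rV[R]_n).

Definition dot x u : R := (x *m u^T) 0 0.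

Lemma dotE x u : dot x u = \sum_i x 0 i * u 0 i.
Proof. by rewrite /dot mxE; apply: eq_bigr => i _; rewrite mxE. Qed.

Lemma dot_suml (I : finType) (F : I -> 'rV[R]_n) u :
  dot (\sum_i F i) u = \sum_i dot (F i) u.
Proof. by rewrite /dot mulmx_suml summxE. Qed.

Lemma dotC x u : dot x u = dot u x.
Proof. by rewrite !dotE; apply: eq_bigr => i _; rewrite mulrC. Qed.

Lemma dotDl x y u : dot (x + y) u = dot x u + dot y u.
Proof. by rewrite /dot mulmxDl mxE. Qed.

Lemma dotZl c x u : dot (c *: x) u = c * dot x u.
Proof. by rewrite /dot -scalemxAl mxE. Qed.

Lemma dotNl x u : dot (- x) u = - dot x u.
Proof. by rewrite -scaleN1r dotZl mulN1r. Qed.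

Lemma dotBl x y u : dot (x - y) u = dot x u - dot y u.
Proof. by rewrite dotDl dotNl. Qed.

Lemma dot0l u : dot 0 u = 0.
Proof. by rewrite /dot mul0mx mxE. Qed.

Lemma dotDr x y u : dot u (x + y) = dot u x + dot u y.
Proof. by rewrite !(dotC u) dotDl. Qed.

Lemma dotZr c x u : dot u (c *: x) = c * dot u x.
Proof. by rewrite !(dotC u) dotZl. Qed.

Lemma dotNr x u : dot u (- x) = - dot u x.
Proof. by rewrite !(dotC u) dotNl. Qed.

Lemma dotBr x y u : dot u (x - y) = dot u x - dot u y.
Proof. by rewrite !(dotC u) dotBl. Qed.

Lemma dot0r u : dot u 0 = 0.
Proof. by rewrite dotC dot0l. Qed.

Lemma dot_ge0 x : 0 <= dot x x.
Proof. by rewrite dotE; apply: sumr_ge0 => i _; rewrite -expr2 sqr_ge0. Qed.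

Lemma dot_eq0 x : (dot x x == 0) = (x == 0).
Proof.
apply/eqP/eqP => [|->]; last by rewrite dot0l.
rewrite dotE => /eqP; rewrite psumr_eq0; last first.
  by move=> i _; rewrite -expr2 sqr_ge0.
move=> /allP x0; apply/rowP => i; rewrite mxE; apply/eqP.
by have := x0 i (mem_index_enum _); rewrite /= mulf_eq0 orbb.
Qed.

Lemma dot_gt0 x : x != 0 -> 0 < dot x x.
Proof. by move=> x0; rewrite lt_def dot_ge0 dot_eq0 x0. Qed.

Lemma dot_delta x i : dot x (delta_mx 0 i) = x 0 i.
Proof.
rewrite dotE (bigD1 i)//= mxE !eqxx mulr1 big1 ?addr0// => j /negPf ji.
by rewrite mxE ji andbF mulr0.
Qed.

Lemma continuous_coord_sum (f : 'I_n -> 'rV[R]_n -> R) :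
  (forall i, continuous (f i)) -> continuous (fun x => \sum_i f i x).
Proof. by move=> cf; apply: (continuous_big (@add_continuous _)) => i _. Qed.

Lemma continuous_dot u : continuous (dot ^~ u).
Proof.
rewrite (_ : dot ^~ u = fun x => \sum_i x 0 i * u 0 i); last first.
  by apply/funext => x; rewrite dotE.
apply: continuous_coord_sum => i x.
apply: (@continuousM _ _ (fun x : 'rV[R]_n => x 0 i) (fun=> u 0 i)).
  exact: coord_continuous.
exact: cst_continuous.
Qed.

Lemma continuous_dot2 v : continuous (fun x => dot (x - v) (x - v)).
Proof.
rewrite (_ : (fun x => _) = fun x => \sum_i (x 0 i - v 0 i) * (x 0 i - v 0 i)).
  apply: continuous_coord_sum => i x.
  have cx : {for x, continuous (fun x : 'rV[R]_n => x 0 i - v 0 i)}.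
    apply: (@continuousB _ _ _ (fun x : 'rV[R]_n => x 0 i) (fun=> v 0 i)).
      exact: coord_continuous.
    exact: cst_continuous.
  exact: (@continuousM _ _ (fun x : 'rV[R]_n => x 0 i - v 0 i) _ x cx cx).
by apply/funext => x; rewrite dotE; apply: eq_bigr => i _; rewrite !mxE.
Qed.

Definition hs K u : R := sup [set dot x u | x in K].

Lemma hs_max K u : convex_body K -> exists2 x, K x & dot x u = hs K u.
Proof.
move=> [K0 [cK _]].
have [|c /set_mem Kc cmax] := compact_EVT_max K0 cK (f := dot ^~ u).
  exact/continuous_subspaceT/continuous_dot.
exists c => //; apply/eqP; rewrite eq_le; apply/andP; split.
  apply: ub_le_sup; last by exists c.
  by exists (dot c u) => _ [x Kx <-]; apply: cmax; rewrite inE.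
apply: ge_sup; first by exists (dot c u); exists c.
by move=> _ [x Kx <-]; apply: cmax; rewrite inE.
Qed.

Lemma hs_ge K u x : convex_body K -> K x -> dot x u <= hs K u.
Proof.
move=> [K0 [cK _]] Kx.
have [|c /set_mem Kc cmax] := compact_EVT_max K0 cK (f := dot ^~ u).
  exact/continuous_subspaceT/continuous_dot.
apply: ub_le_sup; last by exists x.
by exists (dot c u) => _ [y Ky <-]; apply: cmax; rewrite inE.
Qed.

Lemma hs_le K u c :
  convex_body K -> (forall x, K x -> dot x u <= c) -> hs K u <= c.
Proof. by move=> bK cK; have [x Kx <-] := hs_max u bK; exact: cK. Qed.

Lemma hs_eq K u c : convex_body K -> (forall x, K x -> dot x u <= c) ->
  (exists2 x, K x & dot x u = c) -> hs K u = c.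
Proof.
move=> bK cK [x Kx xc]; apply/eqP; rewrite eq_le hs_le//=.
by rewrite -xc hs_ge.
Qed.

Lemma hsZ K c u : convex_body K -> 0 <= c -> hs K (c *: u) = c * hs K u.
Proof.
move=> bK c0; apply: hs_eq => // [x Kx|].
  by rewrite dotZr ler_wpM2l// hs_ge.
by have [x Kx <-] := hs_max u bK; exists x; rewrite ?dotZr.
Qed.

Lemma hsD K u v : convex_body K -> hs K (u + v) <= hs K u + hs K v.
Proof. by move=> bK; apply: hs_le => // x Kx; rewrite dotDr lerD ?hs_ge. Qed.

Lemma hsN K u : convex_body K -> origin_symmetric K -> hs K (- u) = hs K u.
Proof.
move=> bK sK; apply: hs_eq => // [x Kx|].
  by rewrite dotNr -dotNl hs_ge//; exact: sK.
have [x Kx <-] := hs_max u bK; exists (- x); first exact: sK.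
by rewrite dotNr dotNl opprK.
Qed.

Lemma hs_sym_ge K u x :
  convex_body K -> origin_symmetric K -> K x -> `|dot x u| <= hs K u.
Proof.
move=> bK sK Kx; rewrite ler_norml hs_ge// andbT.
by rewrite lerNl -dotNl hs_ge//; exact: sK.
Qed.

Lemma hs_sym_ge0 K u : convex_body K -> origin_symmetric K -> 0 <= hs K u.
Proof.
move=> bK sK; have [[x Kx] _] := bK.
exact: le_trans (normr_ge0 _) (hs_sym_ge u bK sK Kx).
Qed.

Lemma hsZ_sym K c u :
  convex_body K -> origin_symmetric K -> hs K (c *: u) = `|c| * hs K u.
Proof.
move=> bK sK; have [c0|c0] := leP 0 c; first by rewrite hsZ// ger0_norm.
rewrite -[c]opprK scaleNr hsN// hsZ ?oppr_ge0 ?ltW// normrN gtr0_norm//.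
by rewrite oppr_gt0.
Qed.

Lemma sym_body0 K : convex_body K -> origin_symmetric K -> K 0.
Proof.
move=> [[x Kx] [_ cK]] sK.
have := cK _ _ (2^-1) Kx (sK _ Kx); rewrite scalerN -scalerBl.
by rewrite (_ : 1 - 2^-1 - 2^-1 = 0) ?scale0r; [apply; lra|lra].
Qed.

Lemma hs_minksum A B u : convex_body A -> convex_body B ->
  hs (minksum A B) u = hs A u + hs B u.
Proof.
move=> bA bB.
have [x Ax xm] := hs_max u bA; have [y By ym] := hs_max u bB.
apply/eqP; rewrite eq_le; apply/andP; split.
  apply: ge_sup => [|_ [_ [a [b [Aa [Bb ->]]]] <-]].
    by exists (dot (x + y) u); exists (x + y) => //; exists x, y.
  by rewrite dotDl lerD ?hs_ge.
rewrite -xm -ym -dotDl; apply: ub_le_sup; last first.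
  by exists (x + y) => //; exists x, y.
exists (hs A u + hs B u) => _ [_ [a [b [Aa [Bb ->]]]] <-].
by rewrite dotDl lerD ?hs_ge.
Qed.

(* The separating functional is x - p, with p the point of B nearest to x. *)
Lemma body_separation B x :
  convex_body B -> ~ B x -> exists u, hs B u < dot x u.
Proof.
move=> bB nBx; have [B0 [cB xB]] := bB.
have [|p /set_mem Bp pmin] :=
    compact_EVT_min B0 cB (f := fun y => dot (y - x) (y - x)).
  exact/continuous_subspaceT/continuous_dot2.
exists (x - p); have u0 : 0 < dot (x - p) (x - p).
  apply: dot_gt0; rewrite subr_eq0; apply: contra_notN nBx => /eqP ->.
  exact: Bp.
suff /(hs_le bB)/le_lt_trans : forall y, B y -> dot y (x - p) <= dot p (x - p).
  by apply; rewrite -subr_gt0 -dotBl.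
move=> y By; rewrite -subr_le0 -dotBl leNgt; apply/negP => d0.
set d := dot (y - p) (x - p) in d0; set q := dot (y - p) (y - p).
have q0 : 0 <= q by exact: dot_ge0.
(* Moving from [p] towards [y] by [t] changes the squared distance to [x] by
   [t * (t * q) - 2 * t * d], which is negative once [t * q < 2 * d]. This [t] achieves that and
   lies in [0, 1] without taking a minimum. *)
pose t := d / (d + q).
have dq : 0 < d + q by lra.
have t01 : 0 <= t <= 1.
  by rewrite divr_ge0 ?(ltW d0) ?(ltW dq)//= ler_pdivrMr// mul1r; lra.
have := pmin ((1 - t) *: p + t *: y); rewrite inE => /(_ (xB _ _ _ Bp By t01)).
have -> : (1 - t) *: p + t *: y - x = t *: (y - p) - (x - p).
  by apply/rowP => i; rewrite !mxE; ring.
have -> : dot (t *: (y - p) - (x - p)) (t *: (y - p) - (x - p)) =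
    t * (t * q) - 2 * t * d + dot (x - p) (x - p).
  rewrite /d /q; move: (y - p) (x - p) => a b.
  by rewrite dotBl !dotBr !dotZl !dotZr (dotC b a); ring.
have -> : dot (p - x) (p - x) = dot (x - p) (x - p).
  by rewrite -[p - x]opprB dotNl dotNr opprK.
have t0 : 0 < t by rewrite divr_gt0.
have tq : t * q < 2 * d by rewrite /t mulrAC ltr_pdivrMr//; nra.
have : t * (t * q) < t * (2 * d) by rewrite ltr_pM2l.
by lra.
Qed.

Lemma hs_subset A B : convex_body A -> convex_body B ->
  (forall u, hs A u <= hs B u) -> A `<=` B.
Proof.
move=> bA bB AB x Ax; apply: contrapT => /(body_separation bB)[u].
by apply/negP; rewrite -leNgt (le_trans (hs_ge u bA Ax)).
Qed.

Lemma hs_inj A B : convex_body A -> convex_body B -> hs A =1 hs B -> A = B.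
Proof.
move=> bA bB AB; rewrite eqEsubset.
by split; apply: hs_subset => // u; rewrite AB.
Qed.

End SupportFunction.

(** * The outer volume *)

Section Volume.
Context {R : realType} {n : nat}.
Implicit Types (A B X : set 'rV[R]_n) (a b s t : 'rV[R]_n).
Local Notation V := (@volume_n R n).

Definition vol s : R := \prod_(i < n) s 0 i.

Lemma vol_ge0 s : (forall i, 0 <= s 0 i) -> 0 <= vol s.
Proof. by move=> s0; apply: prodr_ge0. Qed.

Lemma vol_subE a b : \prod_(i < n) (b 0 i - a 0 i) = vol (b - a).
Proof. by apply: eq_bigr => i _; rewrite !mxE. Qed.

Lemma volume_le_cover A (a b : nat -> 'rV[R]_n) :
  (forall k i, a k 0 i <= b k 0 i) -> A `<=` \bigcup_k rbox (a k) (b k) ->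
  (V A <= \sum_(0 <= k <oo) (vol (b k - a k))%:E)%E.
Proof.
move=> ab AB; apply: ereal_inf_lbound; exists a, b; split=> //.
by apply: eq_eseriesr => k _; rewrite vol_subE.
Qed.

Lemma le_volume A (c : \bar R) :
  (forall a b : nat -> 'rV[R]_n, (forall k i, a k 0 i <= b k 0 i) ->
    A `<=` \bigcup_k rbox (a k) (b k) ->
    (c <= \sum_(0 <= k <oo) (vol (b k - a k))%:E)%E) ->
  (c <= V A)%E.
Proof.
move=> H; apply: le_ereal_inf_tmp => _ [a [b [ab AB ->]]].
rewrite (eq_eseriesr (g := fun k => (vol (b k - a k))%:E)); first exact: H.
by move=> k _; rewrite vol_subE.
Qed.

Lemma vol_sub_ge0 a b : (forall i, a 0 i <= b 0 i) -> 0 <= vol (b - a).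
Proof. by move=> ab; apply: vol_ge0 => i; rewrite !mxE subr_ge0. Qed.

Lemma volume_ge0 A : (0 <= V A)%E.
Proof.
apply: le_volume => a b ab _; apply: nneseries_ge0 => k _ _.
by rewrite lee_fin vol_sub_ge0.
Qed.

Lemma volume_mono A B : A `<=` B -> (V A <= V B)%E.
Proof.
move=> AB; apply: le_volume => a b ab Bab.
by apply: volume_le_cover => // x /AB /Bab.
Qed.

Lemma volume_cover A (e : R) : 0 < e -> (V A < +oo)%E ->
  exists a b : nat -> 'rV[R]_n, [/\ forall k i, a k 0 i <= b k 0 i,
    A `<=` \bigcup_k rbox (a k) (b k) &
    (\sum_(0 <= k <oo) (vol (b k - a k))%:E <= V A + e%:E)%E].
Proof.
move=> e0 VA; have VAfin : V A \is a fin_num by rewrite ge0_fin_numE// volume_ge0.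
have [_ [a [b [ab AB ->]]] lt] := lb_ereal_inf_adherent e0 VAfin.
exists a, b; split => //; apply/ltW.
rewrite (eq_eseriesr (g := fun k => (vol (b k - a k))%:E)) in lt => //.
by move=> k _; rewrite vol_subE.
Qed.

Lemma volume_bigcup (F : nat -> set 'rV[R]_n) :
  (V (\bigcup_k F k) <= \sum_(0 <= k <oo) V (F k))%E.
Proof.
have [[i ioo]|] := pselect (exists i, V (F i) = +oo%E).
  rewrite (eseries_pinfty _ _ ioo) ?leey// => k _.
  by rewrite -ltNye (lt_le_trans _ (volume_ge0 _)).
rewrite -forallNE => Foo; apply/lee_addgt0Pr => e e0.
apply: le_trans (epsilon_trick _ _ (ltW e0)); last by move=> k; exact: volume_ge0.
have /choice[G] k : exists g : (nat -> 'rV[R]_n) * (nat -> 'rV[R]_n),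
    [/\ forall j i, g.1 j 0 i <= g.2 j 0 i,
    F k `<=` \bigcup_j rbox (g.1 j) (g.2 j) &
    (\sum_(0 <= j <oo) (vol (g.2 j - g.1 j))%:E <=
      V (F k) + (e / (2 ^ k.+1)%:R)%:E)%E].
  have ek : 0 < e / (2 ^ k.+1)%:R by rewrite divr_gt0// ltr0n expn_gt0.
  have Fk : (V (F k) < +oo)%E by rewrite ltey; apply/eqP/Foo.
  by have [a [b ?]] := volume_cover ek Fk; exists (a, b).
move=> /all_and3[G1 G2 G3].
(* Covers are indexed by [nat], so the doubly indexed family of boxes is flattened by a
   bijection. *)
have /card_esym/ppcard_eqP[f] := card_nat2.
pose w (p : nat * nat) : \bar R := (vol ((G p.1).2 p.2 - (G p.1).1 p.2))%:E.
have w0 p : (0 <= w p)%E by rewrite lee_fin vol_sub_ge0.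
apply: (@le_trans _ _ (\sum_(0 <= i <oo) w (f i))%E).
  apply: (volume_le_cover (a := fun i => (G (f i).1).1 (f i).2)
                          (b := fun i => (G (f i).1).2 (f i).2)) => //.
  move=> x [k _ /G2[j _ xkj]].
  by exists (f^-1%FUN (k, j)) => //=; rewrite invK ?inE.
rewrite nneseries_esumT//.
rewrite -(@reindex_esum _ _ _ [set: nat] [set: nat * nat] f w); last first.
  exact: bij.
have -> : [set: nat * nat] = [set: nat] `*`` (fun=> [set: nat]).
  by apply/seteqP; split => -[].
rewrite -(@esum_esum _ _ _ [set: nat] (fun=> [set: nat])
   (fun k j => w (k, j))) => [|*]; last exact: w0.
rewrite -nneseries_esumT => [|k]; last by apply: esum_ge0 => j _; exact: w0.
apply: lee_nneseries => [k _ _|k _]; first by apply: esum_ge0 => j _; exact: w0.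
by rewrite -nneseries_esumT//; exact: G3.
Qed.

Hypothesis n_gt0 : (0 < n)%N.

(** Finite covers are padded to sequences with degenerate boxes, which must cost nothing; in
    dimension zero the empty product would charge 1 for each. *)
Lemma vol0 : vol 0 = 0.
Proof. by rewrite /vol (bigD1 (Ordinal n_gt0))//= mxE mul0r. Qed.

Lemma volume_set0 : V set0 = 0%E.
Proof.
apply/eqP; rewrite eq_le volume_ge0 andbT.
apply: le_trans (volume_le_cover (a := fun=> 0) (b := fun=> 0) _ _) _ => //.
by rewrite eseries0// => k _ _; rewrite subrr vol0.
Qed.

Lemma volume_setU A B : (V (A `|` B) <= V A + V B)%E.
Proof.
rewrite -bigcup2E; apply: le_trans (volume_bigcup _) _.
rewrite (nneseries_split 0 2) => [|k _]; last exact: volume_ge0.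
rewrite add0n big_mkord !big_ord_recl big_ord0/= adde0.
by rewrite eseries0 ?adde0// => -[|[|k]]//= _ _; rewrite volume_set0.
Qed.

Lemma volume_rbox_le a b : (forall i, a 0 i <= b 0 i) ->
  (V (rbox a b) <= (vol (b - a))%:E)%E.
Proof.
move=> ab.
apply: le_trans (volume_le_cover (a := fun k => if k is 0%N then a else 0)
  (b := fun k => if k is 0%N then b else 0) _ _) _ => //.
- by move=> [|k] i//; rewrite mxE.
- by move=> x abx; exists 0%N.
rewrite nneseries_recl// => [|[|k] _]; last 2 first.
- by rewrite lee_fin vol_sub_ge0.
- by rewrite subrr vol0.
rewrite eseries_cond eseries0 ?adde0// => -[|k]//= _ _.
by rewrite subrr vol0.
Qed.

End Volume.

Section BoxVolume.
Context {R : realType}.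

(* Slicing along the first coordinate and integrating the induction hypothesis
   against one-dimensional Lebesgue measure. *)
Lemma box_cover_vol n (a b : 'rV[R]_n) (A B : nat -> 'rV[R]_n) (P : pred nat) :
  (forall i, a 0 i <= b 0 i) -> (forall k i, A k 0 i <= B k 0 i) ->
  rbox a b `<=` \bigcup_(k in [set k | P k]) rbox (A k) (B k) ->
  ((vol (b - a))%:E <= \sum_(0 <= k <oo | P k) (vol (B k - A k))%:E)%E.
Proof.
elim: n a b A B P => [|n IH] a b A B P ab AB cov.
  (* In dimension zero every volume is the empty product 1, and covering the only point takes at
     least one index satisfying [P]. *)
  have [|k /= Pk _] := cov a; first by move=> [].
  rewrite (nneseriesD1 (n := k))// => [|j _]; last by rewrite lee_fin vol_sub_ge0.
  rewrite /vol !big_ord0 leeDl// nneseries_ge0// => j _ _.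
  by rewrite lee_fin big_ord0.
pose tl (x : 'rV[R]_n.+1) : 'rV[R]_n := \row_j x 0 (lift ord0 j).
have volS (s t : 'rV[R]_n.+1) :
    vol (s - t) = (s 0 ord0 - t 0 ord0) * vol (tl s - tl t).
  rewrite /vol big_ord_recl !mxE; congr (_ * _).
  by apply: eq_bigr => j _; rewrite !mxE.
have tlge k : 0 <= vol (tl (B k) - tl (A k)).
  by rewrite vol_sub_ge0// => j; rewrite !mxE.
pose I k : set (R) := `[A k 0 ord0, B k 0 ord0]%classic.
pose f k (x : measurableTypeR R) : \bar R :=
  if P k then (vol (tl (B k) - tl (A k)) * \1_(I k) x)%:E else 0%E.
have f0 k x : (0 <= f k x)%E.
  by rewrite /f; case: ifP => // _; rewrite lee_fin mulr_ge0.
pose mu : {measure set (measurableTypeR R) -> \bar R} := @lebesgue_measure R.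
pose D : set (R) := `[a 0 ord0, b 0 ord0]%classic.
have mD : measurable D by exact: measurable_itv.
have mf k : measurable_fun D (f k).
  rewrite /f; case: (P k); last exact: measurable_cst.
  apply/measurable_EFinP; apply: measurable_funM; first exact: measurable_cst.
  by apply: measurable_indic; exact: measurable_itv.
have slice x : D x -> ((vol (tl b - tl a))%:E <= \sum_(0 <= k <oo) f k x)%E.
  rewrite /D /= in_itv/= => /andP[ax xb].
  (* Only the boxes whose first side contains [x] meet the slice; the predicate in the statement
     exists so that the induction hypothesis applies to this subfamily. *)
  pose Q k := P k && (x \in I k).
  apply: le_trans (IH (tl a) (tl b) (tl \o A) (tl \o B) Q _ _ _) _.
  - by move=> i; rewrite !mxE.
  - by move=> k i; rewrite !mxE.
  - move=> y yab.
    pose z : 'rV[R]_n.+1 :=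
      \row_i (if unlift ord0 i is Some j then y 0 j else x).
    have z0 : z 0 ord0 = x by rewrite mxE unlift_none.
    have zS j : z 0 (lift ord0 j) = y 0 j by rewrite mxE liftK.
    have [|k Pk zk] := cov z.
      move=> i; case: (unliftP ord0 i) => [j ->|->]; last by rewrite z0 ax xb.
      by rewrite zS; have := yab j; rewrite !mxE.
    exists k.
      by rewrite /= /Q [P k]Pk/= inE /I/= in_itv/= -z0; exact: zk.
    by move=> j; rewrite !mxE -zS; exact: zk.
  rewrite eseries_mkcond lee_nneseries// => [k _ _|k _].
    by case: ifP => // _; rewrite lee_fin tlge.
  rewrite /Q /f; case: (P k) => //=; case: (boolP (x \in I k)) => xI.
    by rewrite indicE xI mulr1.
  by rewrite lee_fin mulr_ge0.
have mu_itv (c d : R) : c <= d -> mu `[c, d]%classic = (d - c)%:E.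
  move=> cd; rewrite [LHS](lebesgue_measure_itv `[c, d]%R)/= lte_fin.
  case: ltP => // dc; rewrite (_ : d - c = 0)//.
  by apply/eqP; rewrite subr_eq0 eq_le dc cd.
have muD : mu D = (b 0 ord0 - a 0 ord0)%:E by rewrite mu_itv.
have -> : ((vol (b - a))%:E =
    \int[mu]_(x in D) (vol (tl b - tl a))%:E)%E.
  by rewrite integral_cst// [X in (_ * X)%E]muD volS mulrC EFinM.
apply: le_trans (@ge0_le_integral _ _ _ mu D mD (fun=> (vol (tl b - tl a))%:E)
  (fun x => \sum_(0 <= k <oo) f k x)%E _ _ _ slice) _.
- by move=> x _; rewrite lee_fin vol_sub_ge0// => j; rewrite !mxE.
- exact: measurable_cst.
- exact: (@ge0_emeasurable_sum _ _ _ D f xpredT (fun k x _ _ => f0 k x)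
    (fun k _ => mf k)).
rewrite integral_nneseries// [leRHS]eseries_mkcond.
apply: lee_nneseries => [k _ _|k _]; first by apply: integral_ge0.
rewrite /f; case: (P k); last by rewrite integral0.
under eq_integral do rewrite EFinM.
rewrite ge0_integralZl_EFin//; last first.
  by apply/measurable_EFinP; apply: measurable_indic; exact: measurable_itv.
rewrite integral_indic//; last exact: measurable_itv.
rewrite volS mulrC EFinM lee_wpmul2l ?lee_fin//.
apply: (@le_trans _ _ (mu (I k))).
  by apply: le_measure; rewrite ?inE//; [apply: measurableI; exact: measurable_itv|exact: measurable_itv].
by rewrite mu_itv.
Qed.

Lemma volume_rbox n (a b : 'rV[R]_n) : (0 < n)%N -> (forall i, a 0 i <= b 0 i) ->
  volume_n (rbox a b) = (vol (b - a))%:E.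
Proof.
move=> n0 ab; apply/eqP; rewrite eq_le volume_rbox_le//=.
apply: le_volume => A B AB cov; apply: box_cover_vol => // x /cov[k _ xk].
by exists k.
Qed.

End BoxVolume.

(** * Bisection of boxes, and linear maps acting on the outer volume *)

Section LinearImages.
Context {R : realType} {n : nat}.
Implicit Types (A B X : set 'rV[R]_n) (a b s t x y : 'rV[R]_n).
Local Notation V := (@volume_n R n).

Definition setc x (i : 'I_n) (c : R) : 'rV[R]_n :=
  \row_j (if j == i then c else x 0 j).

Lemma setcE x i c j : setc x i c 0 j = if j == i then c else x 0 j.
Proof. by rewrite mxE. Qed.

Lemma rbox_bisect a b i c : a 0 i <= c <= b 0 i ->
  rbox a b = rbox a (setc b i c) `|` rbox (setc a i c) b.
Proof.
move=> /andP[ac cb]; apply/seteqP; split => [x xab|x].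
  have [xc|cx] := leP (x 0 i) c; [left|right] => j; rewrite setcE;
    case: (eqVneq j i) => [->|_]; have /andP[h1 h2] := xab j; apply/andP; split => //.
  - by have /andP[] := xab i.
  - exact: ltW.
  - by have /andP[] := xab i.
case=> xab j; have := xab j; rewrite setcE; case: eqVneq => // -> /andP[h1 h2].
  by rewrite h1 (le_trans h2).
by rewrite h2 (le_trans ac).
Qed.

Lemma vol_setc_sub a b i c :
  vol (b - a) = vol (setc b i c - a) + vol (b - setc a i c).
Proof.
have volE s : vol s = s 0 i * \prod_(j < n | j != i) s 0 j by exact: bigD1.
rewrite !volE.
have -> : \prod_(j < n | j != i) (setc b i c - a) 0 j =
    \prod_(j < n | j != i) (b - a) 0 j.
  by apply: eq_bigr => j /negPf ji; rewrite !mxE ji.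
have -> : \prod_(j < n | j != i) (b - setc a i c) 0 j =
    \prod_(j < n | j != i) (b - a) 0 j.
  by apply: eq_bigr => j /negPf ji; rewrite !mxE ji.
by rewrite -mulrDl !mxE eqxx; congr (_ * _); ring.
Qed.

Definition halved s (m : 'I_n -> nat) : 'rV[R]_n := \row_i (s 0 i / 2 ^+ m i).

Lemma half_pow (c : R) m : c / 2 ^+ m = 2 * (c / 2 ^+ m.+1).
Proof.
have p0 : (2 : R) ^+ m != 0 by rewrite expf_neq0// pnatr_eq0.
by rewrite exprS; field.
Qed.

(** A claim that passes from the two halves of a box to the whole need only be checked on small
    pieces, in every position. The number of halvings is free for each axis, so the pieces can be
    made tiny, nearly cubical, or thin along one axis. The induction is on the total number of
    halvings. *)
Lemma halving_ind (P : 'rV[R]_n -> 'rV[R]_n -> Prop) s m :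
  (forall i, 0 <= s 0 i) ->
  (forall a b i c, (forall j, a 0 j <= b 0 j) -> a 0 i <= c <= b 0 i ->
    P a (setc b i c) -> P (setc a i c) b -> P a b) ->
  (forall a, P a (a + halved s m)) -> forall a, P a (a + s).
Proof.
move=> s0 bisect; have [N leN] := ubnP (\sum_i m i)%N.
elim: N m leN => // N IH m; rewrite ltnS => leN Pm.
have [/existsP[i mi]|/existsPn m0] := boolP [exists i, m i != 0%N]; last first.
  suff <- : halved s m = s by [].
  apply/rowP => i; rewrite mxE; have := m0 i; rewrite negbK => /eqP ->.
  by rewrite expr0 divr1.
pose m' := [eta m with i |-> (m i).-1].
have h0 k j : 0 <= halved s k 0 j by rewrite mxE divr_ge0 ?exprn_ge0.
have hi : halved s m' 0 i = 2 * halved s m 0 i.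
  by rewrite !mxE /= eqxx half_pow prednK ?lt0n.
have hj j : j != i -> halved s m' 0 j = halved s m 0 j.
  by move=> /negPf ji; rewrite !mxE /= ji.
apply: (IH m').
  rewrite (leq_trans _ leN)// [ltnLHS](bigD1 i)//= [ltnRHS](bigD1 i)//= eqxx.
  rewrite (eq_bigr m); last by move=> j /negPf /= ->.
  by rewrite ltn_add2r prednK ?lt0n.
move=> a.
pose c := a 0 i + halved s m 0 i.
apply: (bisect _ _ i c).
- by move=> j; rewrite !mxE lerDl; have := h0 m' j; rewrite mxE.
- have -> : (a + halved s m') 0 i = a 0 i + 2 * halved s m 0 i by rewrite -hi mxE.
  by rewrite /c lerDl h0 lerD2l mulr2n mulrDl mul1r lerDl h0.
- suff -> : setc (a + halved s m') i c = a + halved s m by [].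
  apply/rowP => j; rewrite setcE; case: eqVneq => [->|ji]; first by rewrite [RHS]mxE.
  by rewrite [LHS]mxE hj// [RHS]mxE.
- suff -> : a + halved s m' = setc a i c + halved s m by [].
  apply/rowP => j; rewrite [LHS]mxE [RHS]mxE setcE.
  by case: eqVneq => [->|ji]; [rewrite hi /c; ring|rewrite hj].
Qed.

Lemma exists_halving_lt (c d : R) : 0 < d -> exists m : nat, c / 2 ^+ m < d.
Proof.
move=> d0; have [m cm] : exists m : nat, c / d < m%:R.
  exists (Num.bound `|c / d|).
  exact: le_lt_trans (ler_norm _) (archi_boundP (normr_ge0 _)).
exists m; rewrite ltr_pdivrMr ?exprn_gt0// mulrC -ltr_pdivrMr//.
by rewrite (lt_trans cm)// -natrX ltr_nat ltn_expl.
Qed.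

Lemma exists_halvings_lt s (d : R) : 0 < d ->
  exists m : 'I_n -> nat, forall i, halved s m 0 i < d.
Proof.
move=> d0; have /choice[m mP] i := exists_halving_lt (s 0 i) d0.
by exists m => i; rewrite mxE.
Qed.

(** With [h] below every edge, this makes all edges of a piece agree up to a factor 2; minimality of
    [m] gives the lower bound. *)
Lemma exists_halving_itv (c h : R) : 0 < h -> h <= c ->
  exists m : nat, h <= c / 2 ^+ m < 2 * h.
Proof.
move=> h0 hc; have ex : exists m : nat, c / 2 ^+ m < 2 * h.
  by apply: exists_halving_lt; lra.
case: (ex_minnP ex) => -[|m] mh mmin.
  by exists 0%N; rewrite mh expr0 divr1 hc.
exists m.+1; rewrite mh andbT leNgt; apply/negP => hm.
have /mmin : c / 2 ^+ m < 2 * h.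
  rewrite half_pow.
  by lra.
by rewrite ltnn.
Qed.

(** Continuity of the volume in the edges: boxes of a cover can be fattened, in particular made
    nondegenerate, at arbitrarily small cost. *)
Lemma vol_enlarge s (e : R) : 0 < e ->
  exists2 d, 0 < d & vol (s + const_mx d) < vol s + e.
Proof.
move=> e0.
have cv : (fun d : R => vol (s + const_mx d)) @ (0 : R) --> vol (s + const_mx 0).
  apply: (continuous_big (@mul_continuous R)) => i _ d.
  rewrite (_ : (fun _ => _) = (fun d : R => s 0 i + d)).
    by apply: (@continuousD _ _ _ (fun=> s 0 i) id); [exact: cst_continuous|].
  by apply/funext => z; rewrite !mxE.
have s0 : s + const_mx 0 = s by apply/rowP => i; rewrite !mxE addr0.
rewrite s0 in cv.
have /cvgrPdist_lt /(_ e e0) /nbhs_ballP[d /= d0 dP] := cv.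
exists (d / 2); first by rewrite divr_gt0.
have : ball 0 d (d / 2).
  rewrite /ball/= sub0r normrN gtr0_norm ?divr_gt0//; lra.
move=> /dP /=; rewrite ltr_norml => /andP[+ _]; lra.
Qed.

Hypothesis n_gt0 : (0 < n)%N.

Lemma volume_image_le (f : 'rV[R]_n -> 'rV[R]_n) (C : R) : 0 < C ->
  (forall a b, (forall i, a 0 i < b 0 i) ->
    (V (f @` rbox a b) <= (C * vol (b - a))%:E)%E) ->
  forall X, (V (f @` X) <= C%:E * V X)%E.
Proof.
move=> C0 fbox X; have [->|VX] := eqVneq (V X) +oo%E.
  by rewrite gt0_muley ?lte_fin// leey.
rewrite -lee_pdivrMl//; apply/lee_addgt0Pr => e e0.
have e20 : 0 < e / 2 by lra.
have [|a [b [ab Xab sab]]] := @volume_cover _ _ X _ e20; first by rewrite ltey.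
have /choice[d dP] k : exists d, 0 < d /\
    vol (b k - a k + const_mx d) < vol (b k - a k) + (e / 2) / (2 ^ k.+1)%:R.
  have ek : 0 < e / 2 / (2 ^ k.+1)%:R by rewrite divr_gt0// ltr0n expn_gt0.
  by have [d d0 dP] := vol_enlarge (b k - a k) ek; exists d.
rewrite lee_pdivrMl//.
have fX : f @` X `<=` \bigcup_k (f @` rbox (a k) (b k + const_mx (d k))).
  move=> _ [x /Xab[k _ xk] <-]; exists k => //; exists x => // i.
  have /andP[-> xb] := xk i; rewrite !mxE (le_trans xb)// lerDl.
  by have [/ltW] := dP k.
apply: le_trans (volume_mono fX) _; apply: le_trans (volume_bigcup _) _.
apply: (@le_trans _ _ (\sum_(0 <= k <oo) C%:E *
    ((vol (b k - a k))%:E + (e / 2 / (2 ^ k.+1)%:R)%:E))%E).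
  apply: lee_nneseries => [k _ _|k _]; first exact: volume_ge0.
  apply: le_trans (fbox _ _ _) _ => [i|].
    by rewrite !mxE ltr_pwDr//; have [] := dP k.
  rewrite -EFinD -EFinM lee_fin ler_pM2l// addrAC ltW//.
  by have [] := dP k.
rewrite nneseriesZl => [|k _]; last first.
  by rewrite adde_ge0// lee_fin ?vol_sub_ge0// !divr_ge0// ltW.
rewrite lee_wpmul2l ?lee_fin ?(ltW C0)//.
apply: le_trans (epsilon_trick _ _ (ltW e20)) _ => [k|].
  by rewrite lee_fin vol_sub_ge0.
apply: le_trans (leeD2r _ sab) _.
by rewrite -addeA leeD2l// -EFinD lee_fin; lra.
Qed.

(** A nearly cubical piece with edges in [h, 2h) is mapped into a cube with edges [4 * M * h],
    whence the constant [(4 * M) ^+ n]. It is far from the determinant, but for a fixed matrix any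
    constant will do. *)
Lemma volume_linear_le (A : 'M[R]_n) :
  exists2 C : R, 0 < C & forall X, (V [set x *m A | x in X] <= C%:E * V X)%E.
Proof.
pose M : R := 1 + \sum_i \sum_j `|A i j|.
have M0 : 0 < M by rewrite ltr_pwDl// sumr_ge0// => i _; apply: sumr_ge0.
exists ((4 * M) ^+ n); first by rewrite exprn_gt0// mulr_gt0.
apply: volume_image_le; first by rewrite exprn_gt0// mulr_gt0.
move=> a b ab.
have s0 i : 0 < (b - a) 0 i by rewrite !mxE subr_gt0.
have [h h0 hs] : exists2 h : R, 0 < h & forall i, h <= (b - a) 0 i.
  exists (\big[Num.min/1]_i (b - a) 0 i).
    by apply: lt_bigmin.
  by move=> i; exact: bigmin_le_cond.
have /choice[m mP] i := exists_halving_itv h0 (hs i).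
pose P a b := (V [set x *m A | x in rbox a b] <= ((4 * M) ^+ n * vol (b - a))%:E)%E.
suff H : forall a', P a' (a' + (b - a)) by have := H a; rewrite addrC subrK.
apply: (halving_ind (P := P) (m := m)) => [i|a' b' i c ab' cab P1 P2|a'].
- exact: ltW.
- rewrite /P (rbox_bisect cab) image_setU (vol_setc_sub _ _ i c) mulrDr EFinD.
  by apply: le_trans (volume_setU n_gt0 _ _) _; exact: leeD.
rewrite /P; set r : 'rV[R]_n := const_mx (2 * h * M).
have rb j : (a' *m A - r) 0 j <= (a' *m A + r) 0 j.
  have : 0 < 2 * h * M by rewrite !mulr_gt0.
  by rewrite !mxE; set X1 := \sum_i _; lra.
apply: le_trans (volume_mono _) _; last first.
  apply: le_trans (volume_rbox_le n_gt0 rb) _.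
  rewrite lee_fin.
  have -> : a' *m A + r - (a' *m A - r) = const_mx (4 * M * h).
    by apply/rowP => j; rewrite !mxE; ring.
  rewrite [a' + _]addrC addrK /vol.
  rewrite (eq_bigr (fun=> 4 * M * h)); last by move=> i _; rewrite mxE.
  have <- : \prod_(i < n) (4 * M) = (4 * M) ^+ n by rewrite prodr_const card_ord.
  rewrite -big_split/=; apply: ler_prod => i _.
  rewrite !mulr_ge0 ?(ltW M0) ?(ltW h0)//= ler_pM2l ?mulr_gt0//.
  by have := mP i; rewrite !mxE => /andP[].
move=> _ [x xa <-] j.
suff : `|(x *m A) 0 j - (a' *m A) 0 j| <= 2 * h * M.
  by rewrite !mxE ler_norml; set X1 := \sum_i _; set X2 := \sum_i _ => /andP[]; lra.
rewrite !mxE -sumrB; apply: le_trans (ler_norm_sum _ _ _) _.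
rewrite mulrDr mulr1 mulr_sumr ler_wpDl//; first by rewrite mulr_ge0// ltW.
apply: ler_sum => i _; rewrite -mulrBl normrM.
apply: ler_pM => //.
  have := xa i; have := mP i; rewrite !mxE => /andP[_ m2] /andP[x1 x2].
  rewrite ler_norml; apply/andP; split; lra.
by rewrite (bigD1 j)//= lerDl sumr_ge0.
Qed.

End LinearImages.

(** * Exact volume estimates for elementary maps, and spans inside symmetric convex sets *)

Section SymmetricBodies.
Context {R : realType} {n : nat}.
Implicit Types (A B X K : set 'rV[R]_n) (a b s t x y u w : 'rV[R]_n).
Local Notation V := (@volume_n R n).
Hypothesis n_gt0 : (0 < n)%N.

Lemma vol_setc s i c : s 0 i != 0 -> vol (setc s i c) = c / s 0 i * vol s.
Proof.
move=> s0; rewrite /vol (bigD1 i)//= [in RHS](bigD1 i)//= setcE eqxx.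
rewrite mulrA divfK//; congr (_ * _).
by apply: eq_bigr => j /negPf ji; rewrite setcE ji.
Qed.

Lemma volume_scale_le X i (c : R) : c != 0 ->
  (V [set setc x i (c * x 0 i)%R | x in X] <= `|c|%:E * V X)%E.
Proof.
move=> c0; apply: volume_image_le => // [|a b ab]; first by rewrite normr_gt0.
pose a' := setc a i (Num.min (c * a 0 i) (c * b 0 i)).
pose b' := setc b i (Num.max (c * a 0 i) (c * b 0 i)).
have ab' j : a' 0 j <= b' 0 j.
  rewrite !setcE; case: eqVneq => _; last exact: ltW.
  by rewrite ge_min le_max lexx.
apply: (@le_trans _ _ (V (rbox a' b'))).
  apply: volume_mono => _ [x xab <-] j.
  rewrite !setcE; case: eqVneq => [_|_]; last exact: xab.
  have /andP[ax xb] := xab i; rewrite ge_min le_max.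
  have [c_gt0|c_le0] := ltP 0 c; first by rewrite !ler_pM2l ?ax ?xb ?orbT.
  have c_lt0 : c < 0 by rewrite lt_def eq_sym c0.
  by rewrite !ler_nM2l ?ax ?xb ?orbT.
apply: le_trans (volume_rbox_le n_gt0 ab') _; rewrite lee_fin.
have -> : b' - a' = setc (b - a) i (`|c| * (b 0 i - a 0 i)).
  apply/rowP => j; rewrite !mxE; case: eqVneq => // _.
  have [c_gt0|c_le0] := ltP 0 c.
    rewrite gtr0_norm// min_l ?max_r ?ler_pM2l ?ltW//; ring.
  have c_lt0 : c < 0 by rewrite lt_def eq_sym c0.
  rewrite ltr0_norm// min_r ?max_l ?ler_nM2l ?(ltW (ab i))//; ring.
have bai : b 0 i - a 0 i != 0 by rewrite subr_eq0 gt_eqF.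
by rewrite vol_setc !mxE// mulfK.
Qed.

(** The bound must be independent of [y], which [volume_linear_le] does not offer. On a slab that is
    thin along axis [i] the shear is nearly a translation, so each slab fits into a box whose edges
    grow by a factor of at most 1 + d. *)
Lemma volume_shear_le X i y : y 0 i = 0 ->
  (V [set (x + x 0 i *: y)%R | x in X] <= V X)%E.
Proof.
move=> yi; rewrite -[leRHS]mul1e; apply: volume_image_le => // a b ab.
rewrite mul1r; have [s sE] : exists s, s = b - a by exists (b - a).
have s0 j : 0 < s 0 j by rewrite sE !mxE subr_gt0.
rewrite -sE.
have vs0 : 0 < vol s by apply: prodr_gt0.
apply/lee_addgt0Pr => e e0.
(* Chosen so that (1 + d)^n < 1 + e / vol s: enlarging every edge by the factor 1 + d then costs at
   most [e] in total. *)
have [d d0 dP] := vol_enlarge (const_mx 1 : 'rV[R]_n) (divr_gt0 e0 vs0).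
have [m mP] : exists m : nat, forall j, 2 * (s 0 i / 2 ^+ m * `|y 0 j|) <= d * s 0 j.
  have [g g0 gP] : exists2 g, 0 < g &
      forall j, g * (2 * `|y 0 j|) <= d * s 0 j.
    exists (\big[Num.min/1]_j (d * s 0 j / (2 * `|y 0 j| + 1))).
      by apply: lt_bigmin => // j _; rewrite divr_gt0 ?mulr_gt0// ltr_wpDl.
    move=> j; set g := \big[_/_]_i _.
    have g0 : 0 <= g.
      by apply: le_bigmin => // k _; rewrite divr_ge0 ?mulr_ge0 ?ltW// ltr_wpDl.
    have : g <= d * s 0 j / (2 * `|y 0 j| + 1) by exact: bigmin_le_cond.
    by rewrite ler_pdivlMr ?ltr_wpDl// => /(le_trans _); apply; rewrite ler_wpM2l// lerDl.
  have [m mP] := exists_halving_lt (s 0 i) g0.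
  exists m => j; rewrite mulrCA.
  by apply: le_trans (gP j); rewrite ler_wpM2r ?mulr_ge0// ltW.
pose M j : nat := if j == i then m else 0%N.
pose P a b := (V [set (x + x 0 i *: y)%R | x in rbox a b] <=
  (vol (const_mx 1 + const_mx d : 'rV[R]_n) * vol (b - a))%:E)%E.
suff H : forall a', P a' (a' + s).
  have := H a; rewrite /P [in rbox _ _]sE (addrC a) subrK => /le_trans; apply.
  rewrite [a + s]addrC addrK.
  rewrite -EFinD lee_fin; apply: le_trans (ler_wpM2r (ltW vs0) (ltW dP)) _.
  rewrite mulrDl mulfVK ?gt_eqF// lerD2r ler_piMl ?(ltW vs0)//.
  by rewrite /vol big1// => j _; rewrite mxE.
apply: (halving_ind (P := P) (m := M)) => [j|a' b' j c ab' cab P1 P2|a'].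
- exact: ltW.
- rewrite /P (rbox_bisect cab) image_setU (vol_setc_sub _ _ j c) mulrDr EFinD.
  by apply: le_trans (volume_setU n_gt0 _ _) _; exact: leeD.
rewrite /P (_ : a' + halved s M - a' = halved s M); last by rewrite addrC addKr.
set si := s 0 i / 2 ^+ m in mP.
have si0 : 0 <= si by rewrite divr_ge0 ?exprn_ge0// ltW.
pose yy : 'rV[R]_n := \row_j (si * `|y 0 j|).
pose lo := a' + a' 0 i *: y - yy; pose hi := a' + a' 0 i *: y + halved s M + yy.
have h0 j : 0 <= halved s M 0 j by rewrite mxE divr_ge0 ?exprn_ge0// ltW.
have lohi j : lo 0 j <= hi 0 j.
  have := h0 j; have : 0 <= si * `|y 0 j| by rewrite mulr_ge0.
  by rewrite /lo /hi !mxE; lra.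
apply: (@le_trans _ _ (V (rbox lo hi))).
  apply: volume_mono => _ [x xa <-] j.
  have /andP[] := xa i; have /andP[] := xa j.
  rewrite /lo /hi !mxE /M eqxx -/si => xj1 xj2 xi1 xi2.
  have : `|(x 0 i - a' 0 i) * y 0 j| <= si * `|y 0 j|.
    rewrite normrM ler_wpM2r// ler_norml; apply/andP; split; lra.
  rewrite mulrBl ler_norml => /andP[q1 q2].
  by apply/andP; split; lra.
apply: le_trans (volume_rbox_le n_gt0 lohi) _; rewrite lee_fin.
rewrite /vol -big_split/=; apply: ler_prod => j _.
have -> : (hi - lo) 0 j = halved s M 0 j + 2 * (si * `|y 0 j|).
  by rewrite /hi /lo !mxE; ring.
have sy0 : 0 <= 2 * (si * `|y 0 j|) by apply: mulr_ge0 => //; exact: mulr_ge0.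
apply/andP; split; first exact: addr_ge0 (h0 j) sy0.
rewrite !mxE [(1 + d) * _]mulrDl mul1r lerD2l.
rewrite /M; case: eqVneq => [->|_]; last by rewrite expr0 divr1.
by rewrite yi normr0 !mulr0 mulr_ge0 ?(ltW d0)// -/si.
Qed.

(** The map sends the basis vector [delta_mx 0 i] to [y] and fixes the others. Upper bounds on
    volumes of images become a lower bound by passing to the inverse: a shear along [y'], which
    removes the other coordinates of [y], and then division of coordinate [i] by [y 0 i]. *)
Lemma volume_replace_ge X i y : y 0 i != 0 ->
  (`|y 0 i|%:E * V X <=
    V [set (x + x 0 i *: (y - delta_mx 0 i))%R | x in X])%E.
Proof.
move=> y0; set Y := [set _ | _ in X].
pose y' := - (y 0 i)^-1 *: (y - y 0 i *: delta_mx 0 i).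
have y'i : y' 0 i = 0 by rewrite !mxE !eqxx mulr1 subrr mulr0.
pose Z := [set x + x 0 i *: y' | x in Y].
pose T x := x + x 0 i *: (y - delta_mx 0 i).
have TE x j : T x 0 j = if j == i then x 0 i * y 0 i else x 0 j + x 0 i * y 0 j.
  by rewrite !mxE eqxx/=; case: eqVneq => [->|_] /=; ring.
have y'E j : y' 0 j = if j == i then 0 else - (y 0 i)^-1 * y 0 j.
  by rewrite !mxE eqxx/=; case: eqVneq => [->|_] /=; ring.
have K x : setc (T x + T x 0 i *: y') i
    ((y 0 i)^-1 * (T x + T x 0 i *: y') 0 i) = x.
  have SE j : (T x + T x 0 i *: y') 0 j = T x 0 j + T x 0 i * y' 0 j.
    by rewrite mxE [X in _ + X]mxE.
  apply/rowP => j; rewrite setcE !SE !TE !y'E !eqxx.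
  by case: eqVneq => [->|_]; field.
have XZ : X = [set setc x i ((y 0 i)^-1 * x 0 i) | x in Z].
  apply/seteqP; split => [x Xx|_ [_ [_ [x Xx <-] <-] <-]]; last by rewrite K.
  by exists (T x + T x 0 i *: y'); [exists (T x) => //; exists x|exact: K].
rewrite {1}XZ; have yi0 : (y 0 i)^-1 != 0 by rewrite invr_eq0.
apply: (@le_trans _ _ (`|y 0 i|%:E * (`|(y 0 i)^-1|%:E * V Z))%E).
  by rewrite lee_wpmul2l ?lee_fin// volume_scale_le.
rewrite muleA -EFinM -normrM mulfV// normr1 mul1e.
exact: volume_shear_le.
Qed.

Lemma convex_mean K x (r : seq 'rV[R]_n) : convexK K ->
  (forall y, y \in x :: r -> K y) ->
  K ((size r).+1%:R^-1 *: \sum_(y <- x :: r) y).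
Proof.
move=> cK; elim: r x => [|z r IH] x Kr.
  by rewrite big_seq1 invr1 scale1r; apply: Kr; rewrite mem_head.
have k0 : (size r).+1%:R != 0 :> R by rewrite pnatr_eq0.
have k1 : (size r).+1%:R + 1 != 0 :> R by rewrite natr1 pnatr_eq0.
have Kz : K ((size r).+1%:R^-1 *: \sum_(y <- z :: r) y).
  by apply: IH => y yr; apply: Kr; rewrite in_cons yr orbT.
have := cK _ _ ((size r).+2%:R^-1) Kz (Kr x (mem_head _ _)).
have E (c : R) : c != 0 -> c + 1 != 0 -> (1 - (c + 1)^-1) / c = (c + 1)^-1.
  by move=> c0 c1; field; rewrite c0 c1.
rewrite scalerA -natr1 E//.
rewrite -scalerDr [X in _ *: X]addrC (big_cons _ _ x); apply.
by rewrite invr_ge0 addr_ge0//= invf_le1 ?ltr_wpDl// lerDr.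
Qed.

(** The sum is the mean of the n points [(n%:R * s 0 i) *: p i], each on the segment from [- p i] to
    [p i]. The coefficients thus range over a cube, whose volume is known. *)
Lemma sym_convex_span K (p : 'I_n -> 'rV[R]_n) s : convexK K ->
  origin_symmetric K -> (forall i, K (p i)) ->
  (forall i, `|s 0 i| <= n%:R^-1) -> K (\sum_i s 0 i *: p i).
Proof.
move=> cK sK Kp sn.
have nR : n%:R != 0 :> R by rewrite pnatr_eq0 -lt0n.
have Kc i c : `|c| <= 1 -> K (c *: p i).
  move=> /[!ler_norml] /andP[c1 c2].
  have := cK _ _ ((1 - c) / 2) (Kp i) (sK _ (Kp i)).
  rewrite scalerN -scalerBl (_ : 1 - _ - _ = c); last by lra.
  by apply; lra.
have -> : \sum_i s 0 i *: p i = n%:R^-1 *: \sum_i (n%:R * s 0 i) *: p i.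
  by rewrite scaler_sumr; apply: eq_bigr => i _; rewrite scalerA mulKf.
have Kq i : K ((n%:R * s 0 i) *: p i).
  apply: Kc; rewrite normrM ger0_norm ?ler0n// mulrC.
  by rewrite -ler_pdivlMr ?ltr0n// mul1r.
have : enum 'I_n != [::] by rewrite -size_eq0 size_enum_ord -lt0n.
case E : (enum 'I_n) => [//|i0 r] _.
have := @convex_mean K ((n%:R * s 0 i0) *: p i0)
  [seq (n%:R * s 0 i) *: p i | i <- r] cK.
rewrite -[_ :: map _ _]/[seq (n%:R * s 0 i) *: p i | i <- i0 :: r] -E.
rewrite big_map big_enum/= size_map.
have -> : (size r).+1 = n by rewrite -[RHS]size_enum_ord E.
by apply=> _ /mapP[i _ ->].
Qed.

End SymmetricBodies.

(** * Volume near a compact set, and the determinant lower bound *)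

Section VolumeLowerBound.
Context {R : realType} {n : nat}.
Implicit Types (B X K : set 'rV[R]_n) (a b s t x y u w : 'rV[R]_n).
Local Notation V := (@volume_n R n).

Lemma coord_le_norm x i : `|x 0 i| <= `|x|.
Proof.
rewrite [leRHS]/Num.norm/= mx_normrE.
exact: (le_bigmax _ (fun ij : 'I_1 * 'I_n => `|x ij.1 ij.2|) (0, i)).
Qed.

Lemma norm_le_coord x (c : R) :
  0 <= c -> (forall i, `|x 0 i| <= c) -> `|x| <= c.
Proof.
move=> c0 xc; rewrite [leLHS]/Num.norm/= mx_normrE.
by apply: bigmax_le => // -[i j] _; rewrite (ord1 i)/=; exact: xc.
Qed.

Hypothesis n_gt0 : (0 < n)%N.

(** Upper semicontinuity of the volume. Pushing each side of the k-th box of a near-optimal cover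
    out by [d k] lengthens its edges by [2 * d k], and compactness yields one radius that works at
    every point of [K]. *)
Lemma volume_thicken K (e : R) : compact K -> 0 < e -> (V K < +oo)%E ->
  exists2 d : R, 0 < d & forall X,
    (forall x, X x -> exists2 y, K y & `|x - y| <= d) -> (V X <= V K + e%:E)%E.
Proof.
move=> cK e0 VK; have e20 : 0 < e / 2 by lra.
have [a [b [ab Kab sab]]] := volume_cover e20 VK.
have /choice[d dP] k : exists d, 0 < d /\
    vol (b k - a k + const_mx (2 * d)) < vol (b k - a k) + (e / 2) / (2 ^ k.+1)%:R.
  have ek : 0 < e / 2 / (2 ^ k.+1)%:R by rewrite divr_gt0// ltr0n expn_gt0.
  have [d d0 dP] := vol_enlarge (b k - a k) ek; exists (d / 2).
  by rewrite divr_gt0// mulrC divfK.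
pose Q k := rbox (a k - const_mx (d k)) (b k + const_mx (d k)).
pose P (r : R) (x : 'rV[R]_n) := forall z, `|z - x| <= r -> exists k, Q k z.
have /compact_near_coveringP/(_ R (0 : R)^'+ P _)[] := cK.
  move=> x Kx; have [k _ xk] := Kab x Kx; have [d0 _] := dP k.
  exists (ball x (d k / 2), [set r | r < d k / 2]) => /=.
    split; first by apply: nbhsx_ballx; rewrite divr_gt0.
    by apply: nbhs_right_lt; rewrite divr_gt0.
  move=> [x' r]/= [xx' rd] z zx'; exists k => i.
  have /andP[x1 x2] := xk i.
  have h1 := le_trans (coord_le_norm (z - x') i) zx'.
  have h2 : `|x 0 i - x' 0 i| < d k / 2.
    move: xx'; rewrite -ball_normE/=; apply: le_lt_trans.
    by have := coord_le_norm (x - x') i; rewrite !mxE.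
  move: h1 h2; rewrite !mxE ler_norml ltr_norml => /andP[? ?] /andP[? ?].
  by apply/andP; split; lra.
move=> r /= r0 rP.
have r20 : 0 < r / 2 by lra.
exists (r / 2) => // X XK.
have KP : K `<=` P (r / 2).
  by apply: rP => //; rewrite /ball/= sub0r normrN gtr0_norm//; lra.
apply: (@le_trans _ _ (\sum_(0 <= k <oo)
   (vol (b k + const_mx (d k) - (a k - const_mx (d k))))%:E)%E).
  apply: volume_le_cover => [k i|x Xx].
    by have [dk _] := dP k; have := ab k i; rewrite !mxE; lra.
  by have [y Ky xy] := XK x Xx; have [k Qk] := KP y Ky x xy; exists k.
apply: (@le_trans _ _ (V K + (e / 2)%:E + (e / 2)%:E)%E); last first.
  by rewrite -addeA leeD2l// -EFinD lee_fin; lra.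
apply: le_trans (leeD2r _ sab).
apply: le_trans (epsilon_trick _ _ (ltW e20)) => [|k]; last first.
  by rewrite lee_fin vol_sub_ge0.
apply: lee_nneseries => [k _ _|k _].
  rewrite lee_fin vol_sub_ge0// => i; rewrite !mxE.
  by have [dk _] := dP k; have := ab k i; lra.
rewrite -EFinD lee_fin ltW//; have [_] := dP k.
suff -> : b k + const_mx (d k) - (a k - const_mx (d k)) =
          b k - a k + const_mx (2 * d k) by [].
by apply/rowP => i; rewrite !mxE; ring.
Qed.

Lemma mem_row_span (A : 'M[R]_n) x : A \in unitmx ->
  x = \sum_i (x *m invmx A) 0 i *: row i A.
Proof.
by move=> uA; rewrite -mulmx_sum_row mulmxKV.
Qed.

(* In the coordinates given by the rows of A, the points x, y and the rows other
   than i0 and a well-chosen j span a parallelepiped inside B, whose volume is a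
   product of two replacement factors. *)
Lemma volume_lower_bound (A : 'M[R]_n) (i0 : 'I_n) u w :
  A \in unitmx -> (forall i, i != i0 -> dot (row i A) w = 0) ->
  exists2 c : R, 0 < c & forall B x y,
    convexK B -> origin_symmetric B -> (forall i, i != i0 -> B (row i A)) ->
    B x -> B y -> dot x w != 0 ->
    ((c * `|dot x w * dot y u - dot y w * dot x u|)%:E <= V B)%E.
Proof.
move=> uA Aw.
have [C C0 CP] := volume_linear_le n_gt0 (invmx A).
pose f := dot (row i0 A) w.
pose M : R := 1 + \sum_i `|dot (row i A) u|.
have M0 : 0 < M by rewrite ltr_pwDl// sumr_ge0.
pose q : 'rV[R]_n := const_mx n%:R^-1.
have nR : 0 < n%:R :> R by rewrite ltr0n.
have VQ : V (rbox (- q) q) = ((2 / n%:R) ^+ n)%:E.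
  rewrite volume_rbox// => [|i]; last by rewrite !mxE ge0_cp ?invr_ge0// ltW.
  congr (_%:E); rewrite /vol (eq_bigr (fun=> 2 / n%:R)) ?prodr_const ?card_ord//.
  by move=> i _; rewrite !mxE opprK -mulr2n mulr_natl.
pose c : R := (2 / n%:R) ^+ n / (C * (`|f| + 1) * M).
have f1 : 0 < `|f| + 1 by rewrite ltr_wpDl.
have c0 : 0 < c by rewrite !(divr_gt0, mulr_gt0, exprn_gt0).
exists c => // B x y cB sB BA Bx By xw0.
have dotw z : dot z w = (z *m invmx A) 0 i0 * f.
  rewrite {1}(mem_row_span z uA) dot_suml (bigD1 i0)//= dotZl.
  by rewrite big1 ?addr0// => i ii0; rewrite dotZl Aw// mulr0.
have f0 : f != 0 by apply: contra_neq xw0; rewrite dotw => ->; rewrite mulr0.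
(* Subtracting a multiple of [x] leaves the determinant unchanged and makes it the product of
   [dot x w] and [dot z u]. *)
pose rho := dot y w / dot x w; pose z := y - rho *: x.
have zw : dot z w = 0 by rewrite /z dotBl dotZl divfK// subrr.
have -> : dot x w * dot y u - dot y w * dot x u = dot x w * dot z u.
  by rewrite /z dotBl dotZl /rho; field.
pose x' := x *m invmx A; pose y' := y *m invmx A; pose z' := z *m invmx A.
have z'i0 : z' 0 i0 = 0 by apply: (mulIf f0); rewrite -dotw zw mul0r.
have y'E : y' = z' + rho *: x'.
  by rewrite /y' /z' /x' /z mulmxBl -scalemxAl subrK.
(* Pigeonhole on the expansion of [dot z u] in the rows of [A]; the summand 1 in [M] makes the
   contradiction strict. *)
have [j jP] : exists j, `|dot z u| <= `|z' 0 j| * M.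
  apply/not_existsP => H.
  have zM j : `|z' 0 j| * M <= `|dot z u| by rewrite leNgt; apply/negP => /ltW /H.
  suff : `|dot z u| * M <= `|dot z u| * \sum_i `|dot (row i A) u|.
    have zu0 : 0 < `|dot z u|.
      by have := H i0; rewrite z'i0 normr0 mul0r => /negP; rewrite -ltNge.
    by rewrite ler_pM2l// /M; lra.
  rewrite {1}(mem_row_span z uA) dot_suml.
  apply: le_trans (ler_wpM2r (ltW M0) (ler_norm_sum _ _ _)) _.
  rewrite mulr_suml mulr_sumr; apply: ler_sum => i _.
  by rewrite dotZl normrM mulrAC ler_wpM2r.
have [z'j0|z'j0] := eqVneq (z' 0 j) 0.
  move: jP; rewrite z'j0 normr0 mul0r normr_le0 => /eqP ->.
  by rewrite mulr0 normr0 mulr0 volume_ge0.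
have ji0 : j != i0 by apply: contra_neq z'j0 => ->.
have x'0 : x' 0 i0 != 0.
  by apply: contra_neq xw0; rewrite dotw -/x' => ->; rewrite mul0r.
pose T i (v t : 'rV[R]_n) := t + t 0 i *: (v - delta_mx 0 i).
(* Axis [j] is replaced first, by [v1], and axis [i0] next, by [x']. The second map turns [v1] into
   [z' + rho *: x'], which is [y'], so the factors are exactly [z' 0 j] and [x' 0 i0]. *)
pose v1 := z' + rho *: delta_mx 0 i0.
have v1j : v1 0 j = z' 0 j by rewrite !mxE (negPf ji0) andbF mulr0 addr0.
have vge : ((`|x' 0 i0| * `|z' 0 j| * (2 / n%:R) ^+ n)%:E <=
    V [set T i0 x' (T j v1 t) | t in rbox (- q) q])%E.
  have := volume_replace_ge n_gt0 (rbox (- q) q) (i := j) (y := v1).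
  rewrite v1j VQ => /(_ z'j0) h1.
  have h2 := volume_replace_ge n_gt0 (T j v1 @` rbox (- q) q) x'0.
  rewrite image_comp in h2.
  apply: le_trans h2; rewrite -mulrA EFinM lee_wpmul2l ?lee_fin//.
have key (z0 x0 t : 'rV[R]_n) : z0 0 i0 = 0 ->
    t + t 0 j *: (z0 + rho *: x0 - delta_mx 0 j) + t 0 i0 *: (x0 - delta_mx 0 i0) =
    T i0 x0 (T j (z0 + rho *: delta_mx 0 i0) t).
  move=> z00; rewrite /T; apply/rowP => k.
  by rewrite !mxE !eqxx (eq_sym i0 j) (negPf ji0) z00 /=; ring.
have sub : [set T i0 x' (T j v1 t) | t in rbox (- q) q] `<=`
    [set b *m invmx A | b in B].
  move=> _ [t tq <-].
  pose p i := if i == j then y else if i == i0 then x else row i A.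
  exists (\sum_i t 0 i *: p i).
    apply: sym_convex_span => // i; first by rewrite /p; case: eqVneq => // ?; case: eqVneq => // ?; exact: BA.
    by have := tq i; rewrite !mxE ler_norml.
  have -> : \sum_i t 0 i *: p i = t *m A + t 0 j *: (y - row j A) + t 0 i0 *: (x - row i0 A).
    rewrite mulmx_sum_row (bigD1 j)//= [in RHS](bigD1 j)//=.
    rewrite (bigD1 i0) 1?eq_sym//= [in RHS](bigD1 i0) 1?eq_sym//=.
    rewrite (eq_bigr (fun i => t 0 i *: row i A)); last first.
      by move=> i /andP[/negPf ij /negPf ii0]; rewrite /p ij ii0.
    rewrite /p eqxx eq_sym (negPf ji0) eqxx !scalerBr.
    by apply/rowP => k; rewrite !mxE; ring.
  rewrite !mulmxDl -!scalemxAl !mulmxBl mulmxK// -!row_mul mulmxV// !row1.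
  by rewrite -/x' -/y' y'E -key.
have := le_trans vge (le_trans (volume_mono sub) (CP B)).
rewrite -lee_pdivrMl// -EFinM; apply: le_trans; rewrite lee_fin.
have xf : `|dot x w| <= `|x' 0 i0| * (`|f| + 1).
  by rewrite dotw normrM -/x' ler_wpM2l// lerDl.
rewrite normrM mulrA (mulrC C^-1).
rewrite ler_pdivlMr//.
have -> : c * `|dot x w| * `|dot z u| * C =
    (2 / n%:R) ^+ n * ((`|dot x w| / (`|f| + 1)) * (`|dot z u| / M)).
  by rewrite /c; field; rewrite !gt_eqF.
rewrite mulrC ler_wpM2r// ?exprn_ge0 ?divr_ge0 ?ler0n//.
by apply: ler_pM; rewrite ?divr_ge0 ?(ltW f1) ?(ltW M0)// ler_pdivrMr.
Qed.

End VolumeLowerBound.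

(** * Polytopes as finite intersections of half-spaces *)

Section HPolytopes.
Context {R : realType}.

(** With constraints kept in a list, a cut is a cons, induction runs over constraints, and bounds
    can depend on their number. The set may be empty or unbounded, so [bnd (hp s)] is carried
    separately. *)
Definition hp {k} (s : seq ('rV[R]_k * R)) : set 'rV[R]_k :=
  [set x | all (fun p => dot x p.1 <= p.2) s].

Definition bnd {k} (K : set 'rV[R]_k) : Prop :=
  exists r : R, forall x, K x -> `|x| <= r.

Lemma bnd_sub k (A B : set 'rV[R]_k) : A `<=` B -> bnd B -> bnd A.
Proof. by move=> AB [r rB]; exists r => x /AB /rB. Qed.

Lemma hp_cat k (s1 s2 : seq ('rV[R]_k * R)) :
  hp (s1 ++ s2) = hp s1 `&` hp s2.
Proof.
by apply/seteqP; split=> x; rewrite /hp/= all_cat => /andP.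
Qed.

Lemma hp_nil k : hp [::] = [set: 'rV[R]_k].
Proof. by apply/seteqP; split. Qed.

Lemma hp_cons k (p : 'rV[R]_k * R) s :
  hp (p :: s) = [set x | dot x p.1 <= p.2] `&` hp s.
Proof. by apply/seteqP; split=> x /= /andP. Qed.

Lemma hp_cons_sub k (p : 'rV[R]_k * R) s : hp (p :: s) `<=` hp s.
Proof. by move=> x /= /andP[]. Qed.

Lemma bnd_hp_cons k (p : 'rV[R]_k * R) s : bnd (hp s) -> bnd (hp (p :: s)).
Proof. exact/bnd_sub/hp_cons_sub. Qed.

Lemma bnd_dot k (K : set 'rV[R]_k) u : bnd K ->
  exists r, forall x, K x -> `|dot x u| <= r.
Proof.
move=> [r rK]; exists (r * \sum_i `|u 0 i|) => x Kx.
rewrite dotE mulr_sumr; apply: le_trans (ler_norm_sum _ _ _) _.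
apply: ler_sum => i _; rewrite normrM ler_wpM2r//.
exact: le_trans (coord_le_norm x i) (rK x Kx).
Qed.

Definition boxc {k} (a b : 'rV[R]_k) : seq ('rV[R]_k * R) :=
  [seq (delta_mx 0 i, b 0 i) | i <- enum 'I_k] ++
  [seq (- delta_mx 0 i, - a 0 i) | i <- enum 'I_k].

Lemma hp_boxc k (a b : 'rV[R]_k) : hp (boxc a b) = rbox a b.
Proof.
have ei (i : 'I_k) : i \in Finite.enum 'I_k by rewrite -enumT mem_enum.
apply/seteqP; split=> x; rewrite /boxc hp_cat /hp/= !all_map.
  move=> [/allP h1 /allP h2] i; apply/andP; split.
    have := h2 i (ei i); rewrite /= dotNr dot_delta lerN2; exact.
  by have := h1 i (ei i); rewrite /= dot_delta; exact.
move=> xab; split; apply/allP => i _ /=; have /andP[h1 h2] := xab i.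
  by rewrite dot_delta.
by rewrite dotNr dot_delta lerN2.
Qed.

Lemma rbox_norm k (r : R) (x : 'rV[R]_k) : 0 <= r ->
  rbox (const_mx (- r)) (const_mx r) x <-> `|x| <= r.
Proof.
move=> r0; split=> [xr|xr i].
  by apply: norm_le_coord => // i; have := xr i; rewrite !mxE ler_norml.
rewrite !mxE -ler_norml; exact: le_trans (coord_le_norm x i) xr.
Qed.

Lemma bnd_rbox k (a b : 'rV[R]_k) : bnd (rbox a b).
Proof.
exists (`|a| + `|b|) => x xab; apply: norm_le_coord => [|i].
  by rewrite addr_ge0.
have := coord_le_norm a i; have := coord_le_norm b i.
have /andP[] := xab i; rewrite !ler_norml => h1 h2 /andP[h3 h4] /andP[h5 h6].
by have := normr_ge0 a; have := normr_ge0 b => *; apply/andP; split; lra.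
Qed.

(** Lets inductions over the constraints start from a box instead of the whole space, so that all
    intermediate sets are bounded. *)
Lemma hp_pad k (s : seq ('rV[R]_k * R)) : bnd (hp s) ->
  exists2 r, 0 <= r & hp s = hp (s ++ boxc (const_mx (- r)) (const_mx r)).
Proof.
move=> [r rs]; exists `|r| => //; rewrite hp_cat hp_boxc.
apply/seteqP; split=> [x sx|x []//]; split=> //.
by apply/rbox_norm => //; exact: le_trans (rs x sx) (ler_norm r).
Qed.

Definition hptr {k} (s : seq ('rV[R]_k * R)) t :=
  [seq (p.1, p.2 + dot t p.1) | p <- s].

Lemma hp_stransl k (s : seq ('rV[R]_k * R)) t :
  stransl (hp s) t = hp (hptr s t).
Proof.
apply/seteqP; split=> [_ [x sx <-]|x].
  rewrite /hp/= all_map; apply: sub_all sx => p /=.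
  by rewrite dotDl lerD2r.
rewrite /hp/= all_map => sx; exists (x - t); last by rewrite subrK.
by apply: sub_all sx => p /=; rewrite dotBl lerBlDr.
Qed.

Lemma bnd_stransl k (K : set 'rV[R]_k) t : bnd K -> bnd (stransl K t).
Proof.
move=> [r rK]; exists (r + `|t|) => _ [x Kx <-].
by rewrite (le_trans (ler_normD _ _))// lerD2r rK.
Qed.

Definition hppre {k m} (s : seq ('rV[R]_m * R)) (B : 'M[R]_(k, m)) x0 :=
  [seq (p.1 *m B^T, p.2 - dot x0 p.1) | p <- s].

Lemma dot_mulmx k m (B : 'M[R]_(k, m)) x u : dot (x *m B) u = dot x (u *m B^T).
Proof. by rewrite /dot trmx_mul trmxK mulmxA. Qed.

Lemma hp_preE k m (s : seq ('rV[R]_m * R)) (B : 'M[R]_(k, m)) x0 :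
  hp (hppre s B x0) = [set z | hp s (z *m B + x0)].
Proof.
apply/seteqP; split=> z; rewrite /hp/= all_map; apply: sub_all => p /=;
  by rewrite dotDl dot_mulmx lerBrDr.
Qed.

Lemma bounded_body k (K : set 'rV[R]_k) : convex_body K -> bnd K.
Proof.
move=> [_ [cK _]]; have /compact_bounded[M [_ MK]] := cK.
exists (M + 1) => x Kx; apply: MK => //; lra.
Qed.

Lemma closed_halfspace k (u : 'rV[R]_k) c : closed [set x | dot x u <= c].
Proof.
have -> : [set x | dot x u <= c] = dot ^~ u @^-1` [set r | r <= c] by [].
apply: closed_comp => [x _|]; first exact: continuous_dot.
exact: closed_le.
Qed.

Lemma closed_hp k (s : seq ('rV[R]_k * R)) : closed (hp s).
Proof.
elim: s => [|p s IH]; first by rewrite hp_nil; exact: closedT.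
by rewrite hp_cons; apply: closedI => //; exact: closed_halfspace.
Qed.

Lemma convex_halfspace k (u : 'rV[R]_k) c : convexK [set x | dot x u <= c].
Proof.
move=> x y t /= xc yc /andP[t0 t1]; rewrite dotDl !dotZl.
have : (1 - t) * dot x u <= (1 - t) * c by rewrite ler_wpM2l// subr_ge0.
have : t * dot y u <= t * c by rewrite ler_wpM2l.
lra.
Qed.

Lemma convexKI k (A B : set 'rV[R]_k) :
  convexK A -> convexK B -> convexK (A `&` B).
Proof.
by move=> cA cB x y t [Ax Bx] [Ay By] t01; split; [exact: cA|exact: cB].
Qed.

Lemma convex_hp k (s : seq ('rV[R]_k * R)) : convexK (hp s).
Proof.
elim: s => [|p s IH]; first by rewrite hp_nil.
by rewrite hp_cons; apply: convexKI => //; exact: convex_halfspace.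
Qed.

Lemma closed_bnd_compact k (K : set 'rV[R]_k) : closed K -> bnd K -> compact K.
Proof.
move=> cK [r rK]; apply: bounded_closed_compact => //.
exists r; split; first exact: num_real.
by move=> M rM x /rK /le_trans; apply; exact: ltW.
Qed.

Lemma hp_body k (s : seq ('rV[R]_k * R)) :
  bnd (hp s) -> hp s !=set0 -> convex_body (hp s).
Proof.
move=> bs s0; split=> //; split; last exact: convex_hp.
by apply: closed_bnd_compact => //; exact: closed_hp.
Qed.

Lemma body_hpI k (K : set 'rV[R]_k) s : convex_body K -> (K `&` hp s) !=set0 ->
  convex_body (K `&` hp s).
Proof.
move=> [_ [cK xK]] K0; split=> //; split.
  by apply: compact_closedI => //; exact: closed_hp.
by apply: convexKI => //; exact: convex_hp.
Qed.

(** The matrix is rectangular because bodies in a k-dimensional flat are parametrised by k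
    coordinates; induction on dimension is induction on [k]. *)
Definition aff {k n} (A : 'M[R]_(k, n)) t (X : set 'rV[R]_k) : set 'rV[R]_n :=
  [set x *m A + t | x in X].

Lemma continuous_aff k n (A : 'M[R]_(k, n)) (t : 'rV[R]_n) :
  continuous (fun x : 'rV[R]_k => x *m A + t).
Proof.
move=> x; apply: (iffRL (@cvgrPdist_lt _ _ _ (nbhs x) (nbhs_filter x) _ _)) => e e0.
pose M : R := 1 + \sum_i \sum_j `|A i j|.
have M0 : 0 < M by rewrite ltr_pwDl// sumr_ge0// => i _; apply: sumr_ge0.
apply/nbhs_ballP; exists (e / 2 / M) => /=; first by rewrite !divr_gt0.
move=> y; rewrite -ball_normE/= opprD addrACA subrr addr0 -mulmxBl => xy.
apply: (@le_lt_trans _ _ (e / 2)); last lra.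
apply: norm_le_coord => [|j]; first by rewrite divr_ge0// ltW.
rewrite mxE; apply: le_trans (ler_norm_sum _ _ _) _.
apply: (@le_trans _ _ (\sum_i (e / 2 / M) * `|A i j|)).
  apply: ler_sum => i _; rewrite normrM ler_wpM2r//.
  exact: le_trans (coord_le_norm _ i) (ltW xy).
rewrite -mulr_sumr mulrAC ler_pdivrMr//.
apply: ler_wpM2l; first by rewrite divr_ge0// ltW.
apply: (@le_trans _ _ (\sum_i \sum_j `|A i j|)); last by rewrite /M; lra.
by apply: ler_sum => i _; rewrite (bigD1 j)//= lerDl sumr_ge0.
Qed.

Lemma body_aff k n (A : 'M[R]_(k, n)) t X :
  convex_body X -> convex_body (aff A t X).
Proof.
move=> [X0 [cX xX]]; split; first exact: image_nonempty.
split.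
  apply: continuous_compact => //.
  exact/continuous_subspaceT/continuous_aff.
move=> _ _ c [x Xx <-] [y Xy <-] c01.
exists ((1 - c) *: x + c *: y); first exact: xX.
rewrite mulmxDl -!scalemxAl !scalerDr addrACA -scalerDl subrK scale1r.
by [].
Qed.

Lemma aff_comp k m n (A : 'M[R]_(k, n)) (B : 'M[R]_(m, k)) t x0 X :
  aff A t (aff B x0 X) = aff (B *m A) (x0 *m A + t) X.
Proof.
have E x : (x *m B + x0) *m A + t = x *m (B *m A) + (x0 *m A + t).
  by rewrite mulmxDl mulmxA addrA.
apply/seteqP; split=> [_ [_ [x Xx <-] <-]|_ [x Xx <-]].
  by exists x; rewrite ?E.
by exists (x *m B + x0); [exists x|rewrite E].
Qed.

Lemma aff_inj k n (A : 'M[R]_(k, n)) t : row_free A ->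
  injective (fun x : 'rV[R]_k => x *m A + t).
Proof. by move=> fA x y /addIr /(row_free_inj fA). Qed.

End HPolytopes.

(** * Bounded cut-additive functions vanish *)

Section Vanishing.
Context {R : realType}.

(** Both pieces contain the hyperplane section and nothing is subtracted for it: this is additivity
    of a simple valuation. *)
Definition cut_additive {k} (f : set 'rV[R]_k -> R) : Prop :=
  forall s l c, bnd (hp s) -> l != 0 ->
    f (hp s) = f (hp ((l, c) :: s)) + f (hp ((- l, - c) :: s)).

(** The bound sees the number of constraints but not the size of the polytope, hence stays the same
    when a shape is stretched. *)
Definition cut_class {k} (f : set 'rV[R]_k -> R) : Prop :=
  [/\ f set0 = 0,
      forall s t, bnd (hp s) -> f (stransl (hp s) t) = f (hp s),
      cut_additive f &
      exists C : nat -> R, forall s, bnd (hp s) -> `|f (hp s)| <= C (size s)].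

Lemma additive_bounded0 (p : R -> R) (C : R) :
  (forall x y, 0 <= x -> 0 <= y -> p (x + y) = p x + p y) ->
  (forall x, 0 <= x -> `|p x| <= C) -> forall x, 0 <= x -> p x = 0.
Proof.
move=> pD pC x x0.
have pM (m : nat) : p (m%:R * x) = m%:R * p x.
  elim: m => [|m IH].
    by rewrite !mul0r; have := pD 0 0 (lexx _) (lexx _); rewrite addr0; lra.
  by rewrite -natr1 !mulrDl !mul1r pD ?IH// mulr_ge0.
apply/eqP; apply/negPn/negP => px0.
have px : 0 < `|p x| by rewrite normr_gt0.
have := pC ((Num.bound (C / `|p x|))%:R * x) (mulr_ge0 (ler0n _ _) x0).
rewrite pM normrM ger0_norm ?ler0n// -ler_pdivlMr//; apply/negP; rewrite -ltNge.
apply: archi_boundP; rewrite divr_ge0//.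
exact: le_trans (normr_ge0 _) (pC x x0).
Qed.

Section Graphs.
Context {k : nat}.
Implicit Types (y l : 'rV[R]_k) (s : seq ('rV[R]_k * R)) (x : 'rV[R]_(1 + k)).

Definition cns (h : R) y : 'rV[R]_(1 + k) := row_mx h%:M y.

Lemma dot_cns h y h' y' : dot (cns h y) (cns h' y') = h * h' + dot y y'.
Proof.
rewrite /dot /cns tr_row_mx mul_row_col [LHS]mxE; congr (_ + _).
by rewrite tr_scalar_mx -scalar_mxM mxE mulr1n.
Qed.

Lemma cns_surj x : exists h y, x = cns h y.
Proof.
exists (x 0 (lshift k 0)), (rsubmx x).
rewrite -[LHS]hsubmxK [lsubmx x]mx11_scalar; congr (row_mx _%:M _).
by rewrite mxE.
Qed.

Lemma cnsD h y h' y' : cns h y + cns h' y' = cns (h + h') (y + y').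
Proof. by rewrite /cns add_row_mx raddfD. Qed.

Lemma cns_eq0 h y : (cns h y == 0) = (h == 0) && (y == 0).
Proof.
rewrite /cns -[0 in LHS]row_mx0; apply/eqP/andP => [/eq_row_mx[h0 ->]|[/eqP-> /eqP->]].
  by split=> //; have /rowP/(_ 0) := h0; rewrite !mxE eqxx mulr1n => ->.
by rewrite raddf0.
Qed.

Definition vert s := [seq (cns 0 p.1, p.2) | p <- s].
Definition upper s := [seq (cns 1 (- p.1), p.2) | p <- s].
Definition lower s := [seq (cns (- 1) p.1, - p.2) | p <- s].

(* The region over [hp s] below the graphs of the affine functions
   [y |-> dot y p.1 + p.2] for [p] in [A] and above those for [p] in [B]. *)
Definition between s A B : set 'rV[R]_(1 + k) := hp (vert s ++ upper A ++ lower B).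

Lemma betweenE s A B h y : between s A B (cns h y) <->
  [/\ hp s y, all (fun p => h <= dot y p.1 + p.2) A &
              all (fun p => dot y p.1 + p.2 <= h) B].
Proof.
have E1 : all (fun p => dot (cns h y) p.1 <= p.2) (vert s) =
    all (fun p => dot y p.1 <= p.2) s.
  by rewrite all_map; apply: eq_all => p /=; rewrite dot_cns mulr0 add0r.
have E2 : all (fun p => dot (cns h y) p.1 <= p.2) (upper A) =
    all (fun p => h <= dot y p.1 + p.2) A.
  by rewrite all_map; apply: eq_all => p /=; rewrite dot_cns mulr1 dotNr lerBlDl.
have E3 : all (fun p => dot (cns h y) p.1 <= p.2) (lower B) =
    all (fun p => dot y p.1 + p.2 <= h) B.
  rewrite all_map; apply: eq_all => p /=; rewrite dot_cns mulrN1.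
  by apply/idP/idP; lra.
rewrite /between /hp/= !all_cat E1 E2 E3.
by split=> [/and3P[]|[-> -> ->]].
Qed.

Lemma between_eq s A B s' A' B' :
  (forall h y,
    [/\ hp s y, all (fun p => h <= dot y p.1 + p.2) A &
              all (fun p => dot y p.1 + p.2 <= h) B] <->
    [/\ hp s' y, all (fun p => h <= dot y p.1 + p.2) A' &
              all (fun p => dot y p.1 + p.2 <= h) B']) ->
  between s A B = between s' A' B'.
Proof.
move=> H; apply/seteqP; split=> x; have [h [y ->]] := cns_surj x;
  by move/betweenE/H/betweenE.
Qed.

Lemma norm_cns h y : `|cns h y| <= `|h| + `|y|.
Proof.
apply: norm_le_coord => [|i]; first exact: addr_ge0.
rewrite /cns; case: (splitP i) => j ij.
  rewrite (_ : i = lshift k j); last exact: val_inj.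
  by rewrite row_mxEl (ord1 j) mxE eqxx mulr1n lerDl.
rewrite (_ : i = rshift 1 j); last exact: val_inj.
by rewrite row_mxEr (le_trans (coord_le_norm y j))// lerDr.
Qed.

Lemma bnd_between s a b A B : bnd (hp s) -> bnd (between s (a :: A) (b :: B)).
Proof.
move=> bs; have [ra raP] := bnd_dot a.1 bs; have [rb rbP] := bnd_dot b.1 bs.
have [r rP] := bs.
exists (ra + rb + `|a.2| + `|b.2| + r) => x; have [h [y ->]] := cns_surj x.
move=> /betweenE[sy /= /andP[ha _] /andP[hb _]].
apply: le_trans (norm_cns h y) _; apply: lerD; last exact: rP.
have := raP y sy; have := rbP y sy; have := ler_norm a.2; have := ler_norm (- b.2).
rewrite normrN !ler_norml => *; have := normr_ge0 a.2; have := normr_ge0 b.2.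
by move=> *; apply/andP; split; lra.
Qed.

Variable f : set 'rV[R]_(1 + k) -> R.
Hypothesis cf : cut_class f.

Let f0 : f set0 = 0. Proof. by case: cf. Qed.
Let ft (r : seq ('rV[R]_(1 + k) * R)) t :
  bnd (hp r) -> f (stransl (hp r) t) = f (hp r).
Proof. by case: cf => _ h _ _; exact: h. Qed.
Let fc : cut_additive f. Proof. by case: cf. Qed.

Lemma between_cut s A B h l c : bnd (between s A B) -> cns h l != 0 ->
  f (between s A B) = f ([set x | dot x (cns h l) <= c] `&` between s A B) +
    f ([set x | c <= dot x (cns h l)] `&` between s A B).
Proof.
move=> bs l0; rewrite /between (fc c bs l0) !hp_cons; congr (f _ + f (_ `&` _)).
by apply/seteqP; split=> x /=; rewrite dotNr lerN2.
Qed.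

Lemma between_transl s A B h : bnd (between s A B) ->
  f (between s [seq (p.1, p.2 + h) | p <- A] [seq (p.1, p.2 + h) | p <- B]) =
  f (between s A B).
Proof.
move=> bs; rewrite -(ft (cns h 0) bs); congr f.
apply/seteqP; split=> [x|_ [x + <-]].
  have [g [y ->]] := cns_surj x; move=> /betweenE[sy]; rewrite !all_map => hA hB.
  exists (cns (g - h) y); last by rewrite cnsD subrK addr0.
  apply/betweenE; split=> //.
  - by apply: sub_all hA => p /=; lra.
  - by apply: sub_all hB => p /=; lra.
have [g [y ->]] := cns_surj x; move=> /betweenE[sy hA hB].
rewrite cnsD addr0; apply/betweenE; split=> //; rewrite all_map.
- by apply: sub_all hA => p /=; lra.
- by apply: sub_all hB => p /=; lra.
Qed.

(** Stacking prisms over the same base makes [f] additive in the height, while the number of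
    constraints, and so the bound, does not depend on the height. *)
Lemma prism_vanish s c d : bnd (hp s) -> f (between s [:: (0, d)] [:: (0, c)]) = 0.
Proof.
move=> bs; have [dc|cd] := ltP d c.
  rewrite -[RHS]f0; congr f; apply/seteqP; split=> // x.
  have [h [y ->]] := cns_surj x; move=> /betweenE[_].
  by rewrite /= dot0r !andbT !add0r => hd ch; move: (le_trans ch hd); lra.
pose p h := f (between s [:: (0, h)] [:: (0, 0)]).
have tr a b : f (between s [:: (0, a + b)] [:: (0, b)]) = p a.
  have := between_transl b (bnd_between (0, a) (0, 0) [::] [::] bs).
  by rewrite /= add0r.
have [_ _ _ [C CP]] := cf.
rewrite -(subrK c d) tr.
apply: (@additive_bounded0 p (C (size s + 2)%N)); last by rewrite subr_ge0.
  move=> a b a0 b0; rewrite -(tr b a) [b + a]addrC {1}/p.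
  have l0 : cns 1 (0 : 'rV[R]_k) != 0 by rewrite cns_eq0 oner_eq0.
  rewrite (between_cut a (bnd_between _ _ _ _ bs) l0).
  congr (f _ + f _); apply/seteqP; split=> x; have [h [y ->]] := cns_surj x;
    rewrite /= dot_cns mulr1 dot0r addr0.
  - case=> ha /betweenE[sy /=]; rewrite ?dot0r !andbT ?addr0 ?add0r => h1 h2.
    by apply/betweenE; split=> //=; rewrite dot0r !andbT add0r.
  - move=> /betweenE[sy /=]; rewrite ?dot0r !andbT ?addr0 ?add0r => h1 h2.
    by split=> //; apply/betweenE; split=> //=; rewrite dot0r !andbT add0r//; lra.
  - case=> ha /betweenE[sy /=]; rewrite ?dot0r !andbT ?addr0 ?add0r => h1 h2.
    by apply/betweenE; split=> //=; rewrite dot0r !andbT add0r//; lra.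
  - move=> /betweenE[sy /=]; rewrite ?dot0r !andbT ?addr0 ?add0r => h1 h2.
    by split=> //; apply/betweenE; split=> //=; rewrite dot0r !andbT add0r//; lra.
move=> a a0; have := CP _ (bnd_between (0, a) (0, 0) [::] [::] bs).
by rewrite !size_cat !size_map addnA.
Qed.

(* The graph of [dot y a] over [hp s] gives a function of [hp s] in the same class,
   one dimension lower. *)
Definition wedge a (X : set 'rV[R]_k) : R :=
  f [set x | exists h y, [/\ x = cns h y, X y,
    inf [set dot y' a | y' in X] <= h & h <= dot y a]].

(** Two floors below the graph differ by a prism, on which [f] vanishes. The infimum in [wedge] is
    thus just a canonical floor, depending on the set and not on its constraints, and any convenient
    [c] may be used. *)
Lemma wedge_hp a s c : bnd (hp s) -> (forall y, hp s y -> c <= dot y a) ->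
  f (between s [:: (a, 0)] [:: (0, c)]) = wedge a (hp s).
Proof.
move=> bs; set m := inf [set dot y' a | y' in hp s].
have step c1 c2 : c1 <= c2 -> (forall y, hp s y -> c2 <= dot y a) ->
    f (between s [:: (a, 0)] [:: (0, c1)]) = f (between s [:: (a, 0)] [:: (0, c2)]).
  move=> c12 c2P.
  have l0 : cns 1 (0 : 'rV[R]_k) != 0 by rewrite cns_eq0 oner_eq0.
  rewrite (between_cut c2 (bnd_between _ _ _ _ bs) l0).
  transitivity (f (between s [:: (0, c2)] [:: (0, c1)]) +
      f (between s [:: (a, 0)] [:: (0, c2)])); last by rewrite prism_vanish// add0r.
  congr (f _ + f _); apply/seteqP; split=> x; have [h [y ->]] := cns_surj x;
    rewrite /= dot_cns mulr1 dot0r addr0.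
  - case=> ha /betweenE[sy /=]; rewrite ?dot0r !andbT ?addr0 ?add0r => h1 h2.
    by apply/betweenE; split=> //=; rewrite dot0r !andbT add0r.
  - move=> /betweenE[sy /=]; rewrite ?dot0r !andbT ?addr0 ?add0r => h1 h2.
    have := c2P y sy => h3.
    by split; [lra|apply/betweenE; split=> //=;
      rewrite ?dot0r !andbT ?add0r ?addr0//; lra].
  - case=> ha /betweenE[sy /=]; rewrite ?dot0r !andbT ?addr0 ?add0r => h1 h2.
    by apply/betweenE; split=> //=; rewrite ?dot0r !andbT ?add0r ?addr0.
  - move=> /betweenE[sy /=]; rewrite ?dot0r !andbT ?addr0 ?add0r => h1 h2.
    by split=> //; apply/betweenE; split=> //=;
      rewrite ?dot0r !andbT ?add0r ?addr0//; lra.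
have indep c1 c2 : (forall y, hp s y -> c1 <= dot y a) ->
    (forall y, hp s y -> c2 <= dot y a) ->
    f (between s [:: (a, 0)] [:: (0, c1)]) = f (between s [:: (a, 0)] [:: (0, c2)]).
  by move=> h1 h2; have [c12|/ltW c21] := leP c1 c2; [exact: step|exact/esym/step].
have mP y : hp s y -> m <= dot y a.
  move=> sy; apply: ge_inf; last by exists y.
  have [r rP] := bnd_dot a bs; exists (- r) => _ [z sz <-].
  by have := rP z sz; rewrite ler_norml => /andP[].
move=> cP; rewrite (indep c m)// /wedge; congr f.
apply/seteqP; split=> x.
  have [h [y ->]] := cns_surj x; move=> /betweenE[sy /=].
  by rewrite dot0r !andbT addr0 add0r => h1 h2; exists h, y.
move=> [h [y [-> sy h1 h2]]]; apply/betweenE; split=> //=.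
  by rewrite addr0 andbT.
by rewrite dot0r add0r andbT.
Qed.

Lemma bnd_dot_lower a s : bnd (hp s) -> exists c, forall y, hp s y -> c <= dot y a.
Proof.
move=> bs; have [r rP] := bnd_dot a bs; exists (- r) => y /rP.
by rewrite ler_norml => /andP[].
Qed.

(** A translation of the base by [t] lifts to the translation by [cns (dot t a) t], a cut of the
    base lifts to a vertical cut over a common floor, and a wedge has two constraints more than its
    base. *)
Lemma wedge_class a : cut_class (wedge a).
Proof.
split.
- rewrite /wedge -[RHS]f0; congr f; apply/seteqP; split=> // x.
  by move=> [h [y []]].
- move=> s t bs; have [c cP] := bnd_dot_lower a bs.
  rewrite -(wedge_hp bs cP) hp_stransl.
  have bst : bnd (hp (hptr s t)) by rewrite -hp_stransl; exact: bnd_stransl.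
  rewrite -(@wedge_hp a _ (c + dot t a)) //; last first.
    rewrite -hp_stransl => _ [y sy <-]; rewrite dotDl lerD2r; exact: cP.
  rewrite -[RHS](ft (cns (dot t a) t) (bnd_between _ _ _ _ bs)); congr f.
  apply/seteqP; split=> [x|_ [x + <-]].
    have [h [y ->]] := cns_surj x; move=> /betweenE[].
    rewrite -hp_stransl => -[z sz <-] /=.
    rewrite !andbT dot0r dotDl addr0 add0r => h1 h2.
    exists (cns (h - dot t a) z); last by rewrite cnsD subrK.
    apply: (iffRL (betweenE s [:: (a, 0)] [:: (0, c)] _ _)).
    by split=> //=; rewrite ?dot0r !andbT ?addr0 ?add0r; lra.
  have [h [y ->]] := cns_surj x; move=> /betweenE[sy /=].
  rewrite !andbT dot0r addr0 add0r => h1 h2.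
  rewrite cnsD; apply/betweenE; split=> /=.
  + by rewrite -hp_stransl; exists y.
  + by rewrite andbT addr0 dotDl lerD2r.
  + by rewrite andbT dot0r add0r lerD2r.
- move=> s l c bs l0; have [d dP] := bnd_dot_lower a bs.
  have sub p y : hp (p :: s) y -> d <= dot y a by move=> /hp_cons_sub /dP.
  rewrite -(wedge_hp bs dP) -(wedge_hp (bnd_hp_cons _ bs) (sub _)).
  rewrite -(wedge_hp (bnd_hp_cons _ bs) (sub _)).
  have cl0 : cns 0 l != 0 by rewrite cns_eq0 eqxx.
  rewrite (between_cut c (bnd_between _ _ _ _ bs) cl0).
  congr (f _ + f _); apply/seteqP; split=> x; have [h [y ->]] := cns_surj x;
    rewrite /= dot_cns mulr0 add0r.
  + case=> lc /betweenE[sy h1 h2]; apply/betweenE; split=> //.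
    by rewrite hp_cons.
  + by move=> /betweenE[]; rewrite hp_cons => -[lc sy] h1 h2; split=> //; apply/betweenE.
  + case=> lc /betweenE[sy h1 h2]; apply/betweenE; split=> //.
    by rewrite hp_cons; split=> //=; rewrite dotNr lerN2.
  + move=> /betweenE[]; rewrite hp_cons => -[/= lc sy] h1 h2.
    by split; [rewrite dotNr lerN2 in lc|apply/betweenE].
have [_ _ _ [C CP]] := cf; exists (fun m => C (m + 2)%N) => s bs.
have [d dP] := bnd_dot_lower a bs; rewrite -(wedge_hp bs dP).
have := CP _ (bnd_between (a, 0) (0, d) [::] [::] bs).
by rewrite !size_cat !size_map addnA.
Qed.

Hypothesis wedge0 : forall a s, bnd (hp s) -> wedge a (hp s) = 0.

Lemma wedge_vanish a s c : bnd (hp s) -> (forall y, hp s y -> c <= dot y a.1 + a.2) ->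
  f (between s [:: a] [:: (0, c)]) = 0.
Proof.
move=> bs cP.
have := between_transl a.2 (bnd_between (a.1, 0) (0, c - a.2) [::] [::] bs).
rewrite /= add0r subrK -surjective_pairing => ->.
by rewrite wedge_hp ?wedge0// => y /cP; rewrite lerBlDr.
Qed.

(** Over the part [s'] of the base where the graph of [b] lies below that of [a], the region is the
    difference of two wedges standing on a common floor; elsewhere its fibres are empty. *)
Lemma between1_vanish s a b : bnd (hp s) -> f (between s [:: a] [:: b]) = 0.
Proof.
move=> bs; pose s' := (b.1 - a.1, a.2 - b.2) :: s.
have s'E y : hp s' y <-> (dot y b.1 + b.2 <= dot y a.1 + a.2) /\ hp s y.
  rewrite hp_cons /= dotBr; split=> -[h ?]; split=> //; lra.
have bs' : bnd (hp s') by exact: bnd_hp_cons.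
have -> : between s [:: a] [:: b] = between s' [:: a] [:: b].
  apply: between_eq => h y; rewrite /= !andbT; split=> -[sy h1 h2]; split=> //.
    by apply/s'E; split=> //; exact: le_trans h1.
  by have /s'E[] := sy.
have [c0 c0P] := bnd_dot_lower b.1 bs'; pose c := c0 + b.2.
have cb y : hp s' y -> c <= dot y b.1 + b.2 by move=> /c0P; rewrite lerD2r.
have ca y : hp s' y -> c <= dot y a.1 + a.2.
  by move=> sy; rewrite (le_trans (cb _ sy))//; have /s'E[] := sy.
have l0 : cns 1 (- b.1) != 0 by rewrite cns_eq0 oner_eq0.
have := between_cut b.2 (bnd_between a (0, c) [::] [::] bs') l0.
rewrite wedge_vanish// => /esym.
have -> : [set x | dot x (cns 1 (- b.1)) <= b.2] `&` between s' [:: a] [:: (0, c)] =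
    between s' [:: b] [:: (0, c)].
  apply/seteqP; split=> x; have [h [y ->]] := cns_surj x;
    rewrite /= dot_cns mulr1 dotNr.
    case=> hb /betweenE[sy /= h1 h2]; apply/betweenE; split=> //=.
    by rewrite andbT; lra.
  move=> /betweenE[sy /=]; rewrite !andbT => h1 h2; split; first lra.
  apply/betweenE; split=> //=; rewrite andbT// (le_trans h1)//.
  by have /s'E[] := sy.
rewrite wedge_vanish// add0r.
suff -> : [set x | b.2 <= dot x (cns 1 (- b.1))] `&` between s' [:: a] [:: (0, c)] =
    between s' [:: a] [:: b] by [].
apply/seteqP; split=> x; have [h [y ->]] := cns_surj x;
  rewrite /= dot_cns mulr1 dotNr.
  case=> hb /betweenE[sy /=]; rewrite !andbT => h1 h2.
  by apply/betweenE; split=> //=; rewrite andbT//; lra.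
move=> /betweenE[sy /=]; rewrite !andbT => h1 h2; split; first lra.
apply/betweenE; split=> //=; rewrite andbT// dot0r add0r.
by rewrite (le_trans (cb _ sy)).
Qed.

(** A vertical cut where the graphs of [a] and [a'] cross leaves one of the two redundant on each
    side. With equal slopes one of them is redundant from the start. *)
Lemma between_up_vanish s a A b : bnd (hp s) -> f (between s (a :: A) [:: b]) = 0.
Proof.
elim: A s a => [|a' A IH] s a bs; first exact: between1_vanish.
have red s' p q : (forall y, hp s' y -> dot y p.1 + p.2 <= dot y q.1 + q.2) ->
    between s' [:: p, q & A] [:: b] = between s' (p :: A) [:: b].
  move=> pq; apply: between_eq => h y /=; split=> -[sy].
    by move=> /and3P[h1 h2 h3] h4; split=> //; rewrite h1.
  move=> /andP[h1 h2] h4; split=> //; rewrite h1 h2 andbT.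
  exact: le_trans (pq y sy).
have swp s' p q : between s' [:: p, q & A] [:: b] = between s' [:: q, p & A] [:: b].
  by apply: between_eq => h y /=; rewrite andbCA.
have [aa'|aa'] := eqVneq a.1 a'.1.
  have [le_aa'|/ltW le_a'a] := leP a.2 a'.2.
    by rewrite red ?IH// => y _; rewrite aa' lerD2l.
  by rewrite swp red ?IH// => y _; rewrite aa' lerD2l.
have l0 : cns 0 (a.1 - a'.1) != 0 by rewrite cns_eq0 eqxx subr_eq0.
rewrite (between_cut (a'.2 - a.2) (bnd_between _ _ _ _ bs) l0).
have E1 : [set x | dot x (cns 0 (a.1 - a'.1)) <= a'.2 - a.2] `&`
      between s [:: a, a' & A] [:: b] =
    between ((a.1 - a'.1, a'.2 - a.2) :: s) [:: a, a' & A] [:: b].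
  apply/seteqP; split=> x; have [h [y ->]] := cns_surj x;
    rewrite /= dot_cns mulr0 add0r.
    by case=> lc /betweenE[sy h1 h2]; apply/betweenE; split=> //; rewrite hp_cons.
  by move=> /betweenE[]; rewrite hp_cons => -[lc sy] h1 h2; split=> //; apply/betweenE.
have E2 : [set x | a'.2 - a.2 <= dot x (cns 0 (a.1 - a'.1))] `&`
      between s [:: a, a' & A] [:: b] =
    between ((- (a.1 - a'.1), - (a'.2 - a.2)) :: s) [:: a, a' & A] [:: b].
  apply/seteqP; split=> x; have [h [y ->]] := cns_surj x;
    rewrite /= dot_cns mulr0 add0r.
    case=> lc /betweenE[sy h1 h2]; apply/betweenE; split=> //.
    by rewrite hp_cons; split=> //=; rewrite dotNr lerN2.
  move=> /betweenE[]; rewrite hp_cons => -[/= lc sy] h1 h2.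
  by split; [rewrite dotNr lerN2 in lc|apply/betweenE].
rewrite E1 E2 red; last by move=> y; rewrite hp_cons /= dotBr => -[h _]; lra.
rewrite swp red; last by move=> y; rewrite hp_cons /= dotNr dotBr => -[h _]; lra.
by rewrite !IH ?addr0//; exact: bnd_hp_cons.
Qed.

Lemma between_vanish s a A b B : bnd (hp s) -> f (between s (a :: A) (b :: B)) = 0.
Proof.
elim: B s b => [|b' B IH] s b bs; first exact: between_up_vanish.
have red s' p q : (forall y, hp s' y -> dot y q.1 + q.2 <= dot y p.1 + p.2) ->
    between s' (a :: A) [:: p, q & B] = between s' (a :: A) (p :: B).
  move=> pq; apply: between_eq => h y /=; split=> -[sy h1].
    by move=> /and3P[h2 h3 h4]; split=> //; rewrite h2.
  move=> /andP[h2 h3]; split=> //; rewrite h2 h3 andbT.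
  exact: le_trans (pq y sy) h2.
have swp s' p q :
    between s' (a :: A) [:: p, q & B] = between s' (a :: A) [:: q, p & B].
  apply: between_eq => h y /=.
  by split=> -[? ? /and3P[? ? ?]]; split=> //; apply/and3P.
have [bb'|bb'] := eqVneq b.1 b'.1.
  have [le_bb'|/ltW le_b'b] := leP b.2 b'.2.
    by rewrite swp red ?IH// => y _; rewrite bb' lerD2l.
  by rewrite red ?IH// => y _; rewrite bb' lerD2l.
have l0 : cns 0 (b.1 - b'.1) != 0 by rewrite cns_eq0 eqxx subr_eq0.
rewrite (between_cut (b'.2 - b.2) (bnd_between _ _ _ _ bs) l0).
have E1 : [set x | dot x (cns 0 (b.1 - b'.1)) <= b'.2 - b.2] `&`
      between s (a :: A) [:: b, b' & B] =
    between ((b.1 - b'.1, b'.2 - b.2) :: s) (a :: A) [:: b, b' & B].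
  apply/seteqP; split=> x; have [h [y ->]] := cns_surj x;
    rewrite /= dot_cns mulr0 add0r.
    by case=> lc /betweenE[sy h1 h2]; apply/betweenE; split=> //; rewrite hp_cons.
  by move=> /betweenE[]; rewrite hp_cons => -[lc sy] h1 h2; split=> //; apply/betweenE.
have E2 : [set x | b'.2 - b.2 <= dot x (cns 0 (b.1 - b'.1))] `&`
      between s (a :: A) [:: b, b' & B] =
    between ((- (b.1 - b'.1), - (b'.2 - b.2)) :: s) (a :: A) [:: b, b' & B].
  apply/seteqP; split=> x; have [h [y ->]] := cns_surj x;
    rewrite /= dot_cns mulr0 add0r.
    case=> lc /betweenE[sy h1 h2]; apply/betweenE; split=> //.
    by rewrite hp_cons; split=> //=; rewrite dotNr lerN2.
  move=> /betweenE[]; rewrite hp_cons => -[/= lc sy] h1 h2.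
  by split; [rewrite dotNr lerN2 in lc|apply/betweenE].
rewrite E1 E2 [X in _ + f X]red; last first.
  by move=> y; rewrite hp_cons /= dotNr dotBr => -[h _]; lra.
rewrite swp red; last by move=> y; rewrite hp_cons /= dotBr => -[h _]; lra.
by rewrite !IH ?addr0//; exact: bnd_hp_cons.
Qed.

Lemma hp_between (r : seq ('rV[R]_(1 + k) * R)) :
  exists s A B, hp r = between s A B.
Proof.
elim: r => [|[l c] r [s [A [B E]]]]; first by exists [::], [::], [::].
have [h [y lE]] := cns_surj l.
have [h0|h0|h0] := ltgtP h 0.
- exists s, A, ((- h^-1 *: y, c / h) :: B).
  rewrite hp_cons E; apply/seteqP; split=> x; have [g [z ->]] := cns_surj x;
    rewrite /= lE dot_cns.
    case=> gc /betweenE[sz h1 h2]; apply/betweenE; split=> //=; rewrite h2 andbT.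
    by rewrite dotZr -(ler_nM2l h0) mulrDr mulrA mulrN mulfV ?lt_eqF// mulrCA mulfV ?lt_eqF//; lra.
  move=> /betweenE[sz h1 /= /andP[h2 h3]]; split; last exact/betweenE.
  move: h2; rewrite dotZr -(ler_nM2l h0) mulrDr mulrA mulrN mulfV ?lt_eqF// mulrCA mulfV ?lt_eqF//; lra.
- exists s, ((- h^-1 *: y, c / h) :: A), B.
  rewrite hp_cons E; apply/seteqP; split=> x; have [g [z ->]] := cns_surj x;
    rewrite /= lE dot_cns.
    case=> gc /betweenE[sz h1 h2]; apply/betweenE; split=> //=; rewrite h1 andbT.
    by rewrite dotZr -(ler_pM2l h0) mulrDr mulrA mulrN mulfV ?gt_eqF// mulrCA mulfV ?gt_eqF//; lra.
  move=> /betweenE[sz /= /andP[h1 h2] h3]; split; last exact/betweenE.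
  move: h1; rewrite dotZr -(ler_pM2l h0) mulrDr mulrA mulrN mulfV ?gt_eqF// mulrCA mulfV ?gt_eqF//; lra.
exists ((y, c) :: s), A, B.
rewrite hp_cons E; apply/seteqP; split=> x; have [g [z ->]] := cns_surj x;
  rewrite /= lE h0 dot_cns mulr0 add0r.
  by case=> gc /betweenE[sz h1 h2]; apply/betweenE; split=> //; rewrite hp_cons.
by move=> /betweenE[]; rewrite hp_cons => -[gc sz] h1 h2; split=> //; apply/betweenE.
Qed.

Lemma norm_cns_ge h y : `|h| <= `|cns h y| /\ `|y| <= `|cns h y|.
Proof.
split.
  have := coord_le_norm (cns h y) (lshift k 0).
  by rewrite row_mxEl mxE eqxx mulr1n.
apply: norm_le_coord => // j; have := coord_le_norm (cns h y) (rshift 1 j).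
by rewrite row_mxEr.
Qed.

(** The given constraints need not bound the base nor include a ceiling and a floor. A norm bound on
    the polytope supplies all three as redundant constraints, as [between_vanish] requires. *)
Lemma vanish_step (r : seq ('rV[R]_(1 + k) * R)) : bnd (hp r) -> f (hp r) = 0.
Proof.
have [s [A [B ->]]] := hp_between r => -[m mP].
pose t := boxc (const_mx (- `|m|)) (const_mx `|m|) : seq ('rV[R]_k * R).
have -> : between s A B = between (t ++ s) ((0, `|m|) :: A) ((0, - `|m|) :: B).
  apply: between_eq => h y; rewrite /= !dot0r !add0r hp_cat hp_boxc.
  split=> [[sy hA hB]|[[_ sy] /andP[_ hA] /andP[_ hB]]//].
  have := mP (cns h y) (iffRL (betweenE _ _ _ _ _) (And3 sy hA hB)).
  have [h1 h2] := norm_cns_ge h y => le_m.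
  have mm : m <= `|m| by exact: ler_norm.
  have : `|h| <= `|m| by rewrite (le_trans h1)// (le_trans le_m).
  rewrite ler_norml => /andP[h3 h4]; rewrite h3 h4; split=> //; split=> //.
  by apply/rbox_norm => //; rewrite (le_trans h2)// (le_trans le_m).
apply: between_vanish; apply: (@bnd_sub _ _ _ (hp t)).
  by move=> y; rewrite hp_cat => -[].
by rewrite hp_boxc; exact: bnd_rbox.
Qed.

End Graphs.

(* The boundedness assumption rules out both the volume and the odd valuations of
   degree k - 1, the two families of simple translation invariant valuations. *)
Theorem cut_class_vanish k (f : set 'rV[R]_k -> R) : (0 < k)%N -> cut_class f ->
  forall s, bnd (hp s) -> f (hp s) = 0.
Proof.
elim: k f => // k IH f _ cf; apply: (@vanish_step k f cf) => a s bs.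
(* Over a zero-dimensional base the only slope is 0, so the wedge is a prism. *)
case: k => [|k] in f cf a s bs IH *; last first.
  by apply: IH => //; exact: wedge_class.
have a0 : a = 0 by apply/rowP => -[].
rewrite -(@wedge_hp _ f cf a s 0) => [|//|y _].
  by rewrite a0; exact: prism_vanish.
by rewrite a0 dot0r.
Qed.

End Vanishing.

(** * Multiaffine functions *)

Section Multiaffine.
Context {R : realType}.

(** A negative value would be multiplied below any bound, so [p] is nonnegative, hence monotone,
    hence linear. *)
Lemma lower_bounded_additive (p : R -> R) (C : R) :
  (forall x y, 0 <= x -> 0 <= y -> p (x + y) = p x + p y) ->
  (forall x, 0 <= x -> C <= p x) ->
  0 <= p 1 /\ forall x, 0 <= x -> p x = x * p 1.
Proof.
move=> pD pC.
have pM (m : nat) x : 0 <= x -> p (m%:R * x) = m%:R * p x.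
  move=> x0; elim: m => [|m IH].
    by rewrite !mul0r; have := pD 0 0 (lexx _) (lexx _); rewrite addr0; lra.
  by rewrite -natr1 !mulrDl !mul1r pD ?IH// mulr_ge0.
have p_ge0 x : 0 <= x -> 0 <= p x.
  move=> x0; rewrite leNgt; apply/negP => px.
  have := pC ((Num.bound (`|C| / - p x))%:R * x) (mulr_ge0 (ler0n _ _) x0).
  have px' : 0 < - p x by rewrite oppr_gt0.
  rewrite pM//; apply/negP; rewrite -ltNge.
  have := archi_boundP (divr_ge0 (normr_ge0 C) (ltW px')).
  rewrite ltr_pdivrMr// mulrN => h.
  by have := ler_norm (- C); rewrite normrN; lra.
have p_mono x y : 0 <= x -> x <= y -> p x <= p y.
  move=> x0 xy; rewrite -(subrK x y) addrC pD ?subr_ge0// lerDl.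
  by rewrite p_ge0// subr_ge0.
split=> [|x x0]; first exact: p_ge0.
have p1 : 0 <= p 1 by exact: p_ge0.
(* By monotonicity [p (m%:R * x)] lies between the values at two consecutive integers, which are
   known multiples of [p 1]. *)
have close (m : nat) : m%:R * `|p x - x * p 1| <= p 1.
  have mx0 : 0 <= m%:R * x by rewrite mulr_ge0.
  have /andP[h1 h2] := truncn_itv mx0; set q := Num.truncn _ in h1 h2.
  have E (j : nat) : p j%:R = j%:R * p 1 by rewrite -{1}(mulr1 j%:R) pM.
  have h3 := p_mono _ _ (ler0n _ q) h1; have h4 := p_mono _ _ mx0 (ltW h2).
  rewrite E pM// in h3; rewrite E pM// -natr1 mulrDl mul1r in h4.
  have h5 : q%:R * p 1 <= m%:R * x * p 1 by rewrite ler_wpM2r.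
  have h6 : m%:R * x * p 1 <= q%:R * p 1 + p 1.
    by rewrite -[X in _ + X]mul1r -mulrDl natr1 ler_wpM2r// ltW.
  rewrite -[m%:R](ger0_norm (ler0n R m)) -normrM mulrBr mulrA ler_norml.
  by apply/andP; split; lra.
apply/eqP; rewrite -subr_eq0 -normr_le0 leNgt; apply/negP => d0.
have := close (Num.bound (p 1 / `|p x - x * p 1|)); apply/negP; rewrite -ltNge.
by rewrite -ltr_pdivrMr// archi_boundP// divr_ge0// ltW.
Qed.

Context {k : nat}.
Implicit Types (t s : 'rV[R]_k) (g : 'rV[R]_k -> R).

Definition nneg t : Prop := forall i, 0 <= t 0 i.

Definition multiaffine g : Prop := forall t i, nneg t ->
  (forall a, 0 <= a ->
    g (setc t i a) = g (setc t i 0) + a * (g (setc t i 1) - g (setc t i 0))).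

Definition monotone_axes g : Prop := forall t i, nneg t ->
  g (setc t i 0) <= g (setc t i 1).

Lemma setc_id t i : setc t i (t 0 i) = t.
Proof. by apply/rowP => j; rewrite setcE; case: eqVneq => [->|]. Qed.

Lemma nneg_setc t i a : nneg t -> 0 <= a -> nneg (setc t i a).
Proof. by move=> t0 a0 j; rewrite setcE; case: eqVneq. Qed.

Lemma setc_ind (P : 'rV[R]_k -> Prop) t s : nneg t -> nneg s -> P t ->
  (forall r i, nneg r -> (r 0 i = t 0 i) ->
    (forall j, r 0 j = t 0 j \/ r 0 j = s 0 j) ->
    P r -> P (setc r i (s 0 i))) -> P s.
Proof.
move=> t0 s0 Pt H.
pose mix (e : seq 'I_k) := \row_j (if j \in e then s 0 j else t 0 j).
have mixE e j : mix e 0 j = if j \in e then s 0 j else t 0 j by rewrite mxE.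
suff Pm e : uniq e -> P (mix e).
  have := Pm (enum 'I_k) (enum_uniq _).
  by rewrite (_ : mix _ = s)//; apply/rowP => j; rewrite mixE mem_enum.
elim: e => [|i e IH] /=; first by rewrite (_ : mix [::] = t)//; apply/rowP => j; rewrite mixE.
move=> /andP[ie ue].
have -> : mix (i :: e) = setc (mix e) i (s 0 i).
  apply/rowP => j; rewrite setcE !mixE in_cons; case: eqVneq => [->|]//=.
apply: H; last exact: IH.
- by move=> j; rewrite mixE; case: ifP.
- by rewrite mixE (negPf ie).
- by move=> j; rewrite mixE; case: ifP; [right|left].
Qed.

Lemma multiaffine_mono g t s : multiaffine g -> monotone_axes g ->
  nneg t -> (forall i, t 0 i <= s 0 i) -> g t <= g s.
Proof.
move=> mg ag t0 ts; have s0 : nneg s by move=> i; exact: le_trans (ts i).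
apply: (setc_ind (P := fun r => g t <= g r) t0 s0) => // r i r0 ri _ /le_trans; apply.
rewrite -{1}(setc_id r i) mg// [leRHS]mg// lerD2l ler_wpM2r//.
  by rewrite subr_ge0; exact: ag.
by rewrite ri.
Qed.

Lemma multiaffine_vol g t : multiaffine g -> nneg t ->
  (forall s i, nneg s -> s 0 i = 0 -> g s = 0) -> g t = vol t * g (const_mx 1).
Proof.
move=> mg t0 g0.
have o0 : nneg (const_mx 1) by move=> i; rewrite mxE.
apply: (setc_ind (P := fun r => g r = vol r * g (const_mx 1)) o0 t0).
  by rewrite /vol big1 ?mul1r// => i _; rewrite mxE.
move=> r i r0 ri _ gr; have ri1 : r 0 i = 1 by rewrite ri mxE.
have gz : g (setc r i 0) = 0.
  by apply: (g0 _ i); [exact: nneg_setc|rewrite setcE eqxx].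
rewrite mg// gz add0r subr0 -{1}ri1 setc_id gr mulrA; congr (_ * _).
by rewrite vol_setc ?ri1 ?divr1// oner_eq0.
Qed.

(** On the face where coordinate [i0] vanishes, every slope along another axis is nonnegative; a
    positive one would exceed [C] far out. So [g] stays constant as the coordinates are changed one
    at a time. *)
Lemma multiaffine_bounded g i0 C t : multiaffine g -> monotone_axes g ->
  (forall s, nneg s -> s 0 i0 = 0 -> g s <= C) -> nneg t -> t 0 i0 = 0 ->
  g t = g 0.
Proof.
move=> mg ag gC t0 ti0.
have z0 : nneg 0 by move=> i; rewrite mxE.
suff [] : t 0 i0 = 0 /\ g t = g 0 by [].
apply: (setc_ind (P := fun r => r 0 i0 = 0 /\ g r = g 0) z0 t0) => [|r i r0 ri _ [ri0 gr]].
  by rewrite mxE.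
have ri0' a : i != i0 -> setc r i a 0 i0 = 0.
  by move=> ii0; rewrite setcE eq_sym (negPf ii0).
have [ii0|ii0] := eqVneq i i0.
  have -> : setc r i (t 0 i) = r by rewrite ii0 ti0 -[RHS](setc_id r i0) ri0.
  by [].
split; first exact: ri0'.
suff sl : g (setc r i 1) - g (setc r i 0) = 0.
  have r0i : r 0 i = 0 by rewrite ri mxE.
  have E : setc r i 0 = r by rewrite -[RHS](setc_id r i) r0i.
  by rewrite mg// sl mulr0 addr0 E.
apply/eqP; rewrite eq_le subr_ge0 ag// andbT leNgt; apply/negP => d0.
set d := g (setc r i 1) - _ in d0.
pose a := (`|C - g (setc r i 0)| + 1) / d.
have a0 : 0 <= a by apply: divr_ge0; [exact: addr_ge0|exact: ltW].
have := gC _ (nneg_setc i r0 a0) (ri0' a ii0).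
have ad : a * d = `|C - g (setc r i 0)| + 1 by rewrite /a divfK ?gt_eqF.
rewrite mg// -/d ad; have := ler_norm (C - g (setc r i 0)).
by move=> h1 h2; lra.
Qed.

End Multiaffine.

(** * Minkowski valuations on boxes *)

Section Valuation.
Context {R : realType} {n : nat}.
Variable Phi : set 'rV[R]_n -> set 'rV[R]_n.
Hypothesis bodyPhi : maps_bodies Phi.
Hypothesis contPhi : hcontinuous Phi.
Hypothesis trPhi : transl_invariant Phi.
Hypothesis valPhi : minkowski_valuation Phi.
Hypothesis symPhi : symmetric_images Phi.

Lemma aff_stransl k (A : 'M[R]_(k, n)) X t :
  aff A 0 (stransl X t) = stransl (aff A 0 X) (t *m A).
Proof.
apply/seteqP; split=> [_ [_ [x Xx <-] <-]|_ [_ [x Xx <-] <-]].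
  by exists (x *m A + 0); [exists x|rewrite mulmxDl !addr0].
by exists (x + t); [exists x|rewrite mulmxDl !addr0].
Qed.

Lemma aff_translate k (A : 'M[R]_(k, n)) X t : aff A t X = stransl (aff A 0 X) t.
Proof.
apply/seteqP; split=> [_ [x Xx <-]|_ [_ [x Xx <-] <-]].
  by exists (x *m A + 0); [exists x|rewrite addr0].
by exists x; rewrite ?addr0.
Qed.

Lemma Phi_aff k (A : 'M[R]_(k, n)) X t : convex_body X ->
  Phi (aff A t X) = Phi (aff A 0 X).
Proof. by move=> bX; rewrite aff_translate trPhi//; exact: body_aff. Qed.

(** Injectivity of the parametrisation makes the image of the section the intersection of the two
    image pieces, and support functions turn Minkowski sums into sums. *)
Lemma valuation_cut k (A : 'M[R]_(k, n)) X l c u : row_free A -> convex_body X ->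
  ([set x | dot x l <= c] `&` X) !=set0 -> ([set x | c <= dot x l] `&` X) !=set0 ->
  hs (Phi (aff A 0 X)) u + hs (Phi (aff A 0 ([set x | dot x l = c] `&` X))) u =
  hs (Phi (aff A 0 ([set x | dot x l <= c] `&` X))) u +
  hs (Phi (aff A 0 ([set x | c <= dot x l] `&` X))) u.
Proof.
move=> fA bX le0 ge0; set X1 := _ `&` X in le0 *; set X2 := _ `&` X in ge0 *.
have [_ [_ cX]] := bX.
have geE : [set x | c <= dot x l] = [set x : 'rV[R]_k | dot x (- l) <= - c].
  by apply/seteqP; split=> x /=; rewrite dotNr lerN2.
have bI l' c' : ([set x | dot x l' <= c'] `&` X) !=set0 ->
    convex_body ([set x | dot x l' <= c'] `&` X).
  move=> ne; have -> : [set x | dot x l' <= c'] = hp [:: (l', c')].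
    by rewrite hp_cons hp_nil setIT.
  rewrite setIC; apply: body_hpI => //; rewrite setIC.
  by case: ne => x [xl Xx]; exists x; split; rewrite // /hp/= andbT.
have b1 : convex_body X1 by exact: bI.
have b2 : convex_body X2 by rewrite /X2 geE in ge0 *; exact: bI.
have XU : X = X1 `|` X2.
  apply/seteqP; split=> [x Xx|x [[]|[]]//].
  by have [xc|/ltW cx] := leP (dot x l) c; [left|right].
have XI : [set x | dot x l = c] `&` X = X1 `&` X2.
  apply/seteqP; split=> [x [/= xc Xx]|x [[/= xc Xx] [/= cx _]]].
    by split; split=> //=; rewrite xc.
  by split=> //=; apply/eqP; rewrite eq_le xc cx.
have I0 : ([set x | dot x l = c] `&` X) !=set0.
  have [x [/= xc Xx]] := le0; have [y [/= yc Xy]] := ge0.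
  have [xy|xy] := eqVneq (dot x l) (dot y l).
    by exists x; split=> //=; apply/eqP; rewrite eq_le xc xy yc.
  pose t := (c - dot x l) / (dot y l - dot x l).
  have d0 : 0 < dot y l - dot x l.
    by rewrite subr_gt0 lt_neqAle xy (le_trans xc).
  exists ((1 - t) *: x + t *: y); split.
    rewrite /= dotDl !dotZl /t; field; exact: lt0r_neq0.
  apply: cX => //; rewrite divr_ge0 ?subr_ge0//= ?(ltW d0) ?ler_pdivrMr//; lra.
have bX3 : convex_body ([set x | dot x l = c] `&` X).
  have E : [set x | dot x l = c] `&` X = X1 `&` hp [:: (- l, - c)].
    rewrite XI hp_cons hp_nil setIT; apply/seteqP; split=> x.
      by move=> [x1 [/= cx _]]; split=> //=; rewrite dotNr lerN2.
    move=> [x1 /=]; rewrite dotNr lerN2 => cx; split=> //; split=> //.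
    by case: x1.
  by rewrite E in I0 *; exact: body_hpI.
have bU : convex_body (aff A 0 X1 `|` aff A 0 X2).
  by rewrite /aff -image_setU -XU; exact: body_aff.
have affI : aff A 0 (X1 `&` X2) = aff A 0 X1 `&` aff A 0 X2.
  apply/seteqP; split=> [_ [x [x1 x2] <-]|_ [[x x1 <-] [y y2 /(aff_inj fA) yx]]].
    by split; exists x.
  by exists x => //; split=> //; rewrite -yx.
have := valPhi (body_aff A 0 b1) (body_aff A 0 b2) bU.
rewrite -affI -XI /aff -image_setU -XU -/(aff A 0 _) -/(aff A 0 X) => /(congr1 (hs ^~ u)).
by rewrite !hs_minksum//; do ?[exact: bodyPhi (body_aff A 0 _)].
Qed.

Lemma coord_le_enorm (x : 'rV[R]_n) i : `|x 0 i| <= enorm x.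
Proof.
rewrite -sqrtr_sqr ler_sqrt ?sumr_ge0 ?sqr_ge0// => [|j _]; last exact: sqr_ge0.
by rewrite (bigD1 i)//= lerDl sumr_ge0// => j _; exact: sqr_ge0.
Qed.

Lemma enorm_le (x : 'rV[R]_n) : enorm x <= n%:R * `|x|.
Proof.
have nx : 0 <= n%:R * `|x| by rewrite mulr_ge0.
rewrite -[leRHS](ger0_norm nx) -sqrtr_sqr ler_sqrt ?sqr_ge0//.
apply: (@le_trans _ _ (\sum_(i < n) `|x| ^+ 2)).
  by apply: ler_sum => i _; rewrite -[leLHS]real_normK ?num_real// lerXn2r ?nnegrE ?coord_le_norm.
rewrite sumr_const card_ord exprMn -[leLHS]mulr_natl ler_wpM2r ?sqr_ge0//.
by rewrite -natrX ler_nat; case: n => // m; rewrite leq_pmulr.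
Qed.

Definition near_sets (d : R) (K K' : set 'rV[R]_n) : Prop :=
  (forall x, K x -> exists2 y, K' y & `|x - y| <= d) /\
  (forall y, K' y -> exists2 x, K x & `|x - y| <= d).

Lemma hs_continuous K u (e : R) : convex_body K -> 0 < e ->
  exists2 d : R, 0 < d & forall K', convex_body K' -> near_sets d K K' ->
    `|hs (Phi K) u - hs (Phi K') u| < e.
Proof.
move=> bK e0; pose S : R := 1 + \sum_i `|u 0 i|.
have S0 : 0 < S by rewrite ltr_pwDl// sumr_ge0.
have [d d0 dP] := contPhi bK (divr_gt0 e0 S0).
have n1 : 0 < n%:R + 1 :> R by rewrite ltr_wpDl.
(* The divisor compares the Euclidean with the maximum norm, with 1 added to keep it positive; the
   half yields a strict inequality for [hdist]. *)
exists (d / 2 / (n%:R + 1)); first by rewrite !divr_gt0.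
move=> K' bK' [h1 h2].
have en (x : 'rV[R]_n) : `|x| <= d / 2 / (n%:R + 1) -> enorm x <= d / 2.
  move=> xd; apply: le_trans (enorm_le x) _.
  apply: (@le_trans _ _ ((n%:R + 1) * `|x|)); first by rewrite ler_wpM2r// lerDl.
  by rewrite mulrC -ler_pdivlMr.
have hd : hdist K K' < d.
  apply: (@le_lt_trans _ _ (d / 2)); last lra.
  apply: ge_inf; first by exists 0 => e' [].
  split; first by rewrite divr_ge0// ltW.
  split=> x /[dup] Kx; first by move=> /h1[y ? /en]; exists y.
  by move=> /h2[y ? /en]; exists y.
have := dP _ bK' hd; have bA := bodyPhi bK; have bB := bodyPhi bK'.
(* Extracting a radius from the infimum requires that some radius be admissible; boundedness of the
   two images provides it. *)
move=> /(inf_lt _)[|e' [e'0 [k1 k2]] e'e].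
  have [r1 r1P] := bounded_body bA; have [r2 r2P] := bounded_body bB.
  exists (n%:R * (`|r1| + `|r2|)); split; first by rewrite mulr_ge0// addr_ge0.
  have far x y : Phi K x -> Phi K' y -> enorm (x - y) <= n%:R * (`|r1| + `|r2|).
    move=> Ax By; apply: le_trans (enorm_le _) _; rewrite ler_wpM2l//.
    apply: le_trans (ler_normB _ _) _.
    by apply: lerD; [exact: le_trans (r1P _ Ax) (ler_norm _)|
                     exact: le_trans (r2P _ By) (ler_norm _)].
  have [[x Ax] _] := bA; have [[y By] _] := bB.
  by split=> z Hz; [exists y|exists x]; rewrite ?far.
have du x y : enorm (x - y) <= e' -> `|dot x u - dot y u| < e.
  move=> xy; rewrite -dotBl dotE; apply: le_lt_trans (ler_norm_sum _ _ _) _.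
  apply: (@le_lt_trans _ _ (e' * S)); last by rewrite -ltr_pdivlMr.
  apply: (@le_trans _ _ (\sum_i e' * `|u 0 i|)).
    apply: ler_sum => i _; rewrite normrM ler_wpM2r//.
    exact: le_trans (coord_le_enorm _ i) xy.
  by rewrite -mulr_sumr ler_wpM2l// /S; lra.
rewrite ltr_norml; apply/andP; split.
  have [y By <-] := hs_max u bB; have [x Ax /du] := k2 y By.
  by rewrite ltr_norml => /andP[]; have := hs_ge u bA Ax; lra.
have [x Ax <-] := hs_max u bA; have [y By /du] := k1 x Ax.
by rewrite ltr_norml => /andP[]; have := hs_ge u bB By; lra.
Qed.

End Valuation.

(** * Frames adapted to a hyperplane section and volumes of parallelotopes *)

Section HyperplaneFrame.
Context {R : realType}.

Lemma has_affindep_le n (K : set 'rV[R]_n) d : has_affindep K d ->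
  (d <= affdim K)%N.
Proof.
move=> Kd; have dn : (d < n.+1)%N.
  by have [x0 [M [_ _ <-]]] := Kd; rewrite ltnS rank_leq_col.
rewrite /affdim (bigD1 (Ordinal dn))/=; last exact/asboolP.
exact: leq_maxl.
Qed.

Lemma has_affindep_affdim n (K : set 'rV[R]_n) : K !=set0 -> has_affindep K (affdim K).
Proof.
move=> [x Kx]; have K0 : has_affindep K 0.
  by exists x, 0; split=> // [[]//|]; rewrite mxrank0.
have [|d /asboolP Kd] := @eq_bigmax_cond _
    [pred d : 'I_n.+1 | `[< has_affindep K d >]] (@nat_of_ord n.+1).
  apply/card_gt0P; exists (ord0 : 'I_n.+1); rewrite unfold_in/=.
  exact: asboolT.
by rewrite /affdim => ->.
Qed.

Lemma row_free_col_mx m k (x w : 'rV[R]_k) (B : 'M[R]_(m, k)) :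
  row_free B -> B *m w^T = 0 -> dot x w != 0 -> row_free (col_mx x B).
Proof.
move=> fB Bw xw; apply: inj_row_free => v.
rewrite -[v]hsubmxK mul_row_col; set a := lsubmx v; set b := rsubmx v => ab.
have a0 : a = 0.
  have : (a *m x + b *m B) *m w^T = 0 by rewrite ab mul0mx.
  rewrite mulmxDl -!mulmxA Bw mulmx0 addr0 {1}[a]mx11_scalar mul_scalar_mx.
  move=> /matrixP/(_ 0 0); rewrite mxE [RHS]mxE -/(dot x w) => /eqP.
  rewrite mulf_eq0 (negPf xw) orbF => /eqP a00.
  by rewrite [a]mx11_scalar a00 -scalemx1 scale0r.
have b0 : b = 0 by apply: (row_free_inj fB); rewrite mul0mx -ab a0 mul0mx add0r.
by rewrite a0 b0 row_mx0.
Qed.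

(** Symmetry turns affine independence into linear independence: half of [row i M] is the midpoint
    of [x0 + row i M] and [- x0]. A point of [K] off the hyperplane would raise the dimension. *)
Lemma hyperplane_frame m (K : set 'rV[R]_m.+1) :
  K !=set0 -> convexK K -> origin_symmetric K -> affdim K = m ->
  exists A : 'M[R]_m.+1, exists w : 'rV[R]_m.+1,
    [/\ A \in unitmx, forall i, i != 0 -> K (row i A) /\ dot (row i A) w = 0,
        row 0 A = w, w != 0 & forall x, K x -> dot x w = 0].
Proof.
move=> K0 cK sK dK; have [x0 [M [Kx0 KM rM]]] := has_affindep_affdim K0.
rewrite dK in M KM rM.
have fold_half x y : K x -> K y -> K (2^-1 *: (x + y)).
  move=> Kx Ky; have := cK x y 2^-1 Kx Ky.
  rewrite (_ : 1 - 2^-1 = 2^-1); last by lra.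
  by rewrite -scalerDr; apply; lra.
have Kz : K 0 by have := fold_half _ _ Kx0 (sK _ Kx0); rewrite subrr scaler0.
pose B := 2^-1 *: M.
have KB i : K (row i B).
  have := fold_half _ _ (KM i) (sK _ Kx0); rewrite addrAC subrr add0r.
  by rewrite /B linearZ.
have fB : row_free B.
  by apply/eqP; rewrite /B eqmx_scale ?rM// invr_eq0 pnatr_eq0.
pose w := nz_row (kermx B^T).
have w0 : w != 0.
  rewrite nz_row_eq0 -mxrank_eq0 mxrank_ker mxrank_tr.
  by move: fB; rewrite /row_free => /eqP ->; rewrite subSnn.
have wB : w *m B^T = 0 by apply/sub_kermxP; exact: nz_row_sub.
have Bw : B *m w^T = 0 by rewrite -[B]trmxK -trmx_mul wB trmx0.
have dB i : dot (row i B) w = 0 by rewrite /dot -row_mul Bw !mxE.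
have rD (x : 'rV[R]_m.+1) j : row (lift 0 j) (col_mx x B : 'M[R]_m.+1) = row j B.
  by rewrite -(rowKd j x B); congr (row _ _); exact: val_inj.
have rU (x : 'rV[R]_m.+1) : row 0 (col_mx x B : 'M[R]_m.+1) = x.
  by rewrite -[RHS](row_id 0) -(rowKu 0 x B); congr (row _ _); exact: val_inj.
exists (col_mx w B), w; split=> //.
- rewrite -row_free_unit; apply: row_free_col_mx fB Bw _.
  by rewrite gt_eqF// dot_gt0.
- move=> i; case: (unliftP 0 i) => [j ->|->]; last by rewrite eqxx.
  by rewrite rD.
move=> x Kx; apply/eqP/negPn/negP => xw.
suff : (m.+1 <= affdim K)%N by rewrite dK ltnn.
apply: has_affindep_le; exists 0, (col_mx x B); split=> //.
  move=> i; rewrite add0r; case: (unliftP 0 i) => [j ->|->].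
    by rewrite rD.
  by rewrite rU.
by apply/eqP; exact: row_free_col_mx fB Bw xw.
Qed.

Lemma volume_hyperplane n (A : 'M[R]_n) (i0 : 'I_n) w (K : set 'rV[R]_n) :
  A \in unitmx -> (forall i, i != i0 -> dot (row i A) w = 0) -> w != 0 ->
  bnd K -> (forall x, K x -> dot x w = 0) -> volume_n K = 0%E.
Proof.
move=> uA Aw w0 bK Kw; have n0 : (0 < n)%N by case: n i0 {A uA Aw w w0 bK Kw K} => // -[].
have dotw z : dot z w = (z *m invmx A) 0 i0 * dot (row i0 A) w.
  rewrite {1}(mem_row_span z uA) dot_suml (bigD1 i0)//= dotZl.
  by rewrite big1 ?addr0// => i ii0; rewrite dotZl Aw// mulr0.
have f0 : dot (row i0 A) w != 0.
  apply/eqP => f0; have := dot_gt0 w0; rewrite dotw f0 mulr0 ltxx.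
  by [].
have /choice[r rP] i : exists r, forall x, K x -> `|(x *m invmx A) 0 i| <= r.
  have [r rP] := bnd_dot (delta_mx 0 i *m (invmx A)^T) bK; exists r => x /rP.
  by rewrite -dot_mulmx dot_delta.
pose q : 'rV[R]_n := \row_i (if i == i0 then 0 else `|r i|).
have [C C0 CP] := volume_linear_le n0 A.
have q0 i : (- q) 0 i <= q 0 i.
  by rewrite !mxE; case: (i == i0); rewrite ?oppr0// ge0_cp.
have sub : K `<=` [set x *m A | x in rbox (- q) q].
  move=> x Kx; exists (x *m invmx A); last by rewrite mulmxKV.
  move=> i; rewrite [(- q) 0 i]mxE -ler_norml [X in _ <= X]mxE; case: (eqVneq i i0) => [->|_].
    have := Kw x Kx; rewrite dotw => /eqP; rewrite mulf_eq0 (negPf f0) orbF.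
    by move=> /eqP ->; rewrite normr0.
  exact: le_trans (rP i x Kx) (ler_norm _).
apply/eqP; rewrite eq_le volume_ge0 andbT.
apply: le_trans (volume_mono sub) _; apply: le_trans (CP _) _.
apply: (@le_trans _ _ (C%:E * (vol (q - - q))%:E)%E).
  by rewrite lee_wpmul2l ?lee_fin ?(ltW C0)// volume_rbox_le.
by rewrite /vol (bigD1 i0)//= !mxE eqxx opprK addr0 mul0r mule0.
Qed.

(** The equation [k = n] replaces a square type because frames get completed by stacking blocks,
    whose total number of rows equals n only propositionally. *)
Lemma volume_paral k n (A : 'M[R]_(k, n)) : (0 < n)%N -> k = n -> row_free A ->
  (exists2 C : R, 0 < C & forall t, nneg t ->
    (volume_n (aff A 0 (rbox 0 t))%R <= (C * vol t)%:E)%E) /\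
  (0 < volume_n (aff A 0 (rbox 0 (const_mx 1)))%R)%E.
Proof.
move=> n0 kn; case: n / kn A n0 => A n0; rewrite row_free_unit => uA.
have affE X : aff A 0 X = [set x *m A | x in X].
  by apply: eq_imagel => x _; rewrite addr0.
split.
  have [C C0 CP] := volume_linear_le n0 A; exists C => // t t0.
  rewrite affE; apply: le_trans (CP _) _; rewrite EFinM.
  rewrite lee_wpmul2l ?lee_fin ?(ltW C0)//.
  have := @volume_rbox_le _ _ n0 0 t; rewrite subr0; apply=> i.
  by rewrite mxE.
have [C C0 CP] := volume_linear_le n0 (invmx A).
have := CP (aff A 0 (rbox 0 (const_mx 1))).
have -> : [set x *m invmx A | x in aff A 0 (rbox 0 (const_mx 1))] =
    rbox 0 (const_mx 1).
  rewrite affE; apply/seteqP; split=> [_ [_ [x xr <-] <-]|x xr].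
    by rewrite mulmxK.
  by exists (x *m A); [exists x|rewrite mulmxK].
rewrite volume_rbox// => [|i]; last by rewrite !mxE.
rewrite subr0 /vol big1 => [|i _]; last by rewrite mxE.
rewrite lt0e volume_ge0 andbT => h; apply/eqP => V0.
by move: h; rewrite V0 mule0 lee_fin ler10.
Qed.

End HyperplaneFrame.

(** * Support functions of the images of parallelotopes *)

Section Parallelotopes.
Context {R : realType} {n : nat}.
Variable Phi : set 'rV[R]_n -> set 'rV[R]_n.
Hypothesis bodyPhi : maps_bodies Phi.
Hypothesis trPhi : transl_invariant Phi.
Hypothesis valPhi : minkowski_valuation Phi.
Hypothesis symPhi : symmetric_images Phi.

Lemma body_rbox k (a b : 'rV[R]_k) : (forall i, a 0 i <= b 0 i) ->
  convex_body (rbox a b).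
Proof.
move=> ab; rewrite -hp_boxc; apply: hp_body; rewrite hp_boxc; first exact: bnd_rbox.
by exists a => i; rewrite lexx ab.
Qed.

Lemma body_rbox0 k (t : 'rV[R]_k) : nneg t -> convex_body (rbox 0 t).
Proof. by move=> t0; apply: body_rbox => i; rewrite mxE. Qed.

Lemma body_point : convex_body [set 0 : 'rV[R]_n].
Proof.
split; first by exists 0.
by split=> [|x y t /= -> -> _]; [exact: compact_set1|rewrite !scaler0 addr0].
Qed.

Lemma Phi_stransl k (A : 'M[R]_(k, n)) X t : convex_body X ->
  Phi (aff A 0 (stransl X t)) = Phi (aff A 0 X).
Proof. by move=> bX; rewrite aff_stransl trPhi//; exact: body_aff. Qed.

Definition paral {k} (A : 'M[R]_(k, n)) u t : R := hs (Phi (aff A 0 (rbox 0 t))) u.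

Lemma body_paral k (A : 'M[R]_(k, n)) t : nneg t ->
  convex_body (Phi (aff A 0 (rbox 0 t))).
Proof. by move=> t0; apply/bodyPhi/body_aff/body_rbox0. Qed.

Lemma sym_paral k (A : 'M[R]_(k, n)) t : nneg t ->
  origin_symmetric (Phi (aff A 0 (rbox 0 t))).
Proof. by move=> t0; apply/symPhi/body_aff/body_rbox0. Qed.

(** Cutting a box across edge [i] and translating the pieces back makes the increment over edge
    length 0 additive. It is bounded below because symmetric bodies have nonnegative support
    functions. *)
Lemma paral_multiaffine k (A : 'M[R]_(k, n)) u : row_free A ->
  multiaffine (paral A u) /\ monotone_axes (paral A u).
Proof.
move=> fA.
suff H t i : nneg t -> paral A u (setc t i 0) <= paral A u (setc t i 1) /\
    forall a, 0 <= a -> paral A u (setc t i a) = paral A u (setc t i 0) +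
      a * (paral A u (setc t i 1) - paral A u (setc t i 0)).
  by split=> [t i t0 a a0|t i t0]; have [h1 h2] := H t i t0; [exact: h2|exact: h1].
move=> t0; pose p a := paral A u (setc t i a) - paral A u (setc t i 0).
have nn a : 0 <= a -> nneg (setc t i a) by exact: nneg_setc.
have pD a b : 0 <= a -> 0 <= b -> p (a + b) = p a + p b.
  move=> a0 b0; pose X := rbox 0 (setc t i (a + b)).
  pose d : 'rV[R]_k := a *: delta_mx 0 i.
  have ab0 : 0 <= a + b by exact: addr_ge0.
  have dE j : d 0 j = if j == i then a else 0.
    by rewrite !mxE eqxx /=; case: eqVneq => _; rewrite ?mulr1 ?mulr0.
  have stE e : 0 <= e -> stransl (rbox 0 (setc t i e)) d =
      [set x | forall j, (if j == i then a <= x 0 i <= a + e else 0 <= x 0 j <= t 0 j)].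
    have xdE x j : (x + d) 0 j = x 0 j + (if j == i then a else 0).
      by rewrite mxE dE.
    have xdE' x j : (x - d) 0 j = x 0 j - (if j == i then a else 0).
      by rewrite mxE [(- d) _ _]mxE dE.
    move=> e0; apply/seteqP; split=> [_ [x xt <-] j|x xP].
      have := xt j; rewrite setcE !xdE mxE eqxx; case: eqVneq => [->|_].
        by move=> /andP[h1 h2]; apply/andP; split; lra.
      by rewrite addr0.
    exists (x - d); last by rewrite subrK.
    move=> j; have := xP j; rewrite setcE xdE' mxE.
    case: eqVneq => [->|_]; last by rewrite subr0.
    by move=> /andP[h1 h2]; apply/andP; split; lra.
  have X1 : [set x | dot x (delta_mx 0 i) <= a] `&` X = rbox 0 (setc t i a).
    apply/seteqP; split=> [x [/= xa xX] j|x xP].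
      have := xX j; rewrite !setcE mxE; case: eqVneq => // ->.
      by rewrite -dot_delta xa => /andP[->].
    split=> [/=|j]; first by rewrite dot_delta; have := xP i; rewrite setcE eqxx => /andP[].
    have := xP j; rewrite !setcE; case: eqVneq => // _ /andP[-> h].
    by rewrite (le_trans h)// lerDl.
  have X2 : [set x | a <= dot x (delta_mx 0 i)] `&` X = stransl (rbox 0 (setc t i b)) d.
    rewrite stE//; apply/seteqP; split=> [x [/= xa xX] j|x xP].
      have := xX j; rewrite !setcE mxE; case: eqVneq => // ->.
      by move: xa; rewrite dot_delta => -> /andP[_ ->].
    split=> [/=|j]; first by rewrite dot_delta; have := xP i; rewrite eqxx => /andP[].
    have := xP j; rewrite !setcE mxE; case: eqVneq => // -> /andP[h1 ->].
    by rewrite (le_trans a0).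
  have X3 : [set x | dot x (delta_mx 0 i) = a] `&` X = stransl (rbox 0 (setc t i 0)) d.
    rewrite stE//; apply/seteqP; split=> [x [/= xa xX] j|x xP].
      have := xX j; rewrite !setcE mxE; case: eqVneq => // -> _.
      by rewrite -dot_delta xa addr0 lexx.
    split=> [/=|j].
      rewrite dot_delta; have := xP i; rewrite eqxx addr0 => /andP[h1 h2].
      by apply/eqP; rewrite eq_le h1 h2.
    have := xP j; rewrite !setcE mxE; case: eqVneq => // -> /andP[h1].
    by rewrite addr0 => h2; rewrite (le_trans a0)//= (le_trans h2)// lerDl.
  have := valuation_cut bodyPhi valPhi (l := delta_mx 0 i) (c := a) u fA (body_rbox0 (nn _ ab0)).
  rewrite -/X X1 X2 X3 !Phi_stransl; try by apply: body_rbox0; apply: nn.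
  rewrite /p /paral -/X => H.
  have {}H := H _ _; rewrite -addrA.
  suff : hs (Phi (aff A 0 X)) u + hs (Phi (aff A 0 (rbox 0 (setc t i 0)))) u =
    hs (Phi (aff A 0 (rbox 0 (setc t i a)))) u + hs (Phi (aff A 0 (rbox 0 (setc t i b)))) u by lra.
  apply: H; first by have [] := body_rbox0 (nn _ a0).
  have [[x xP] _] := body_rbox0 (nn _ b0); exists (x + d); exists x => //.
have pC a : 0 <= a -> - paral A u (setc t i 0) <= p a.
  move=> a0; rewrite /p lerBrDl subrr; apply: hs_sym_ge0; first exact/body_paral/nn.
  exact/sym_paral/nn.
have [p1 pL] := lower_bounded_additive pD pC.
split=> [|a a0]; first by rewrite -subr_ge0.
by rewrite -[a * _](pL a a0) /p; ring.
Qed.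

Lemma aff_point k (A : 'M[R]_(k, n)) : aff A 0 (rbox 0 0) = [set 0].
Proof.
apply/seteqP; split=> [_ [x xP <-]|_ ->].
  rewrite (_ : x = 0) ?mul0mx ?addr0//; apply/rowP => i; have := xP i.
  by rewrite !mxE => /andP[h1 h2]; apply/eqP; rewrite eq_le h1 h2.
by exists 0; [move=> i; rewrite !mxE lexx|rewrite mul0mx addr0].
Qed.

Lemma paral0 k (A : 'M[R]_(k, n)) u : paral A u 0 = hs (Phi [set 0]) u.
Proof. by rewrite /paral aff_point. Qed.

Lemma paral_mono k (A : 'M[R]_(k, n)) (t s : 'rV[R]_k) : row_free A -> nneg t ->
  (forall i, t 0 i <= s 0 i) ->
  Phi (aff A 0 (rbox 0 t)) `<=` Phi (aff A 0 (rbox 0 s)).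
Proof.
move=> fA t0 ts; apply: hs_subset => [||u].
- exact: body_paral.
- by apply: body_paral => i; exact: le_trans (ts i).
have [mA aA] := paral_multiaffine u fA; exact: (multiaffine_mono mA aA t0 ts).
Qed.

Lemma sub_paral k (A : 'M[R]_(k, n)) t : row_free A -> nneg t ->
  Phi [set 0] `<=` Phi (aff A 0 (rbox 0 t)).
Proof.
move=> fA t0; rewrite -(aff_point A); by apply: paral_mono => // i; rewrite mxE.
Qed.

Section VolumeCondition.
Variables (c C : R) (A0 : 'M[R]_n) (i0 i1 : 'I_n) (w : 'rV[R]_n).
Hypotheses (c_gt0 : 0 < c) (C_gt0 : 0 < C).
Hypothesis VCP : forall K, convex_body K ->
  (c%:E * volume_n K <= volume_n (Phi K) <= C%:E * volume_n K)%E.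
Hypothesis A0_unit : A0 \in unitmx.
Hypothesis A0_w : forall i, i != i0 -> dot (row i A0) w = 0.
Hypothesis A0_L : forall i, i != i0 -> Phi [set 0] (row i A0).
Hypothesis i1_neq : i1 != i0.
Hypothesis w_neq0 : w != 0.
Hypothesis L_w : forall x, Phi [set 0] x -> dot x w = 0.

Let n_gt0 : (0 < n)%N. Proof. by case: (n) i0 => // -[]. Qed.

Lemma hs_L_w : hs (Phi [set 0]) w = 0.
Proof.
have bL := bodyPhi body_point; have [x Lx <-] := hs_max w bL.
exact: L_w.
Qed.

(** The constant depends on [u] but not on [K], so the inequality can be used on boxes growing
    without bound. *)
Lemma volume_Phi_lower u : exists2 e : R, 0 < e & forall K x y, convex_body K ->
  Phi [set 0] `<=` Phi K -> Phi K x -> Phi K y -> dot x w != 0 ->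
  ((e * `|dot x w * dot y u - dot y w * dot x u|)%:E <= C%:E * volume_n K)%E.
Proof.
have [e e0 eP] := volume_lower_bound n_gt0 u A0_unit A0_w.
exists e => // K x y bK LK Kx Ky xw.
have [_ [_ cPK]] := bodyPhi bK.
apply: (@le_trans _ _ (volume_n (Phi K))); last by have /andP[] := VCP bK.
by apply: eP => //; [exact: symPhi|move=> i ii0; exact/LK/A0_L].
Qed.

Section Square.
Variables (k : nat) (A : 'M[R]_(k, n)).
Hypotheses (kn : k = n) (fA : row_free A).

Let F t := Phi (aff A 0 (rbox 0 t)).

Let bF t (t0 : nneg t) : convex_body (F t). Proof. exact: body_paral. Qed.
Let sF t (t0 : nneg t) : origin_symmetric (F t). Proof. exact: sym_paral. Qed.

Lemma paral_volume : exists2 D : R, 0 < D & forall t, nneg t ->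
  (C%:E * volume_n (aff A 0 (rbox 0 t))%R <= (D * vol t)%:E)%E.
Proof.
have [[D D0 DP] _] := volume_paral n_gt0 kn fA.
exists (C * D) => [|t t0]; first exact: mulr_gt0.
by rewrite -mulrA EFinM lee_wpmul2l ?lee_fin ?(ltW C_gt0)// DP.
Qed.

Lemma vol_eq0 (t : 'rV[R]_k) i : t 0 i = 0 -> vol t = 0.
Proof. by move=> ti; rewrite /vol (bigD1 i)//= ti mul0r. Qed.

Lemma paral_flat t i : nneg t -> t 0 i = 0 -> paral A w t = 0.
Proof.
move=> t0 ti.
suff H x : F t x -> dot x w = 0.
  have [x Fx xm] := hs_max w (bF t0).
  by rewrite /paral -[hs _ _]xm; exact: H.
(* The row [i1] of [A0] lies in the image of the flat box and is orthogonal to [w]. Taken both as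
   second point and as direction, it gives a positive determinant with [x], although the flat box
   has volume zero. *)
move=> Fx; apply/eqP/negPn/negP => xw.
have [e e0 eP] := volume_Phi_lower (row i1 A0).
have [D D0 DP] := paral_volume.
have sub := sub_paral fA t0.
have := eP _ x (row i1 A0) (body_aff A 0 (body_rbox0 t0)) sub Fx (sub _ (A0_L i1_neq)) xw.
move=> /le_trans/(_ (DP t t0)); rewrite (vol_eq0 ti) mulr0 A0_w// mul0r subr0.
rewrite lee_fin leNgt mulr_gt0// normr_gt0 mulf_neq0// dot_eq0.
apply/eqP => r0; have := A0_unit; rewrite -row_free_unit => /row_free_inj fA0.
have : delta_mx 0 i1 = 0 :> 'rV[R]_n by apply: fA0; rewrite -rowE r0 mul0mx.
by move=> /rowP/(_ i1); rewrite !mxE !eqxx => /eqP; rewrite oner_eq0.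
Qed.

Let beta := paral A w (const_mx 1).

Lemma nneg1 : nneg (const_mx 1 : 'rV[R]_k).
Proof. by move=> i; rewrite mxE. Qed.

Lemma paral_w t : nneg t -> paral A w t = vol t * beta.
Proof.
have [mA aA] := paral_multiaffine w fA.
move=> t0; apply: multiaffine_vol => // s i s0 si; exact: paral_flat si.
Qed.

(** Otherwise the image of a parallelotope of positive volume would lie in the hyperplane orthogonal
    to [w]. *)
Lemma beta_gt0 : 0 < beta.
Proof.
rewrite lt_def (hs_sym_ge0 w (bF nneg1) (sF nneg1)) andbT.
apply/eqP => b0.
have V0 : volume_n (F (const_mx 1)) = 0%E.
  apply: (volume_hyperplane A0_unit A0_w w_neq0); first exact/bounded_body/bF/nneg1.
  move=> x Fx; apply/eqP; rewrite -normr_le0 -b0.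
  exact: hs_sym_ge (bF nneg1) (sF nneg1) Fx.
have [_ V1] := volume_paral n_gt0 kn fA.
have /andP[+ _] := VCP (body_aff A 0 (body_rbox0 nneg1)).
rewrite -/(F _) V0 leNgt => /negP; apply.
by rewrite mule_gt0.
Qed.

(** A flat box [s] is compared with the thicker [q]. The point of [F q] extremal for [w] has height
    [vol q * beta], and the point of [F s] extremal for [u] has height 0. The factor [vol q] cancels
    from the determinant inequality, leaving the bound [D / (e * beta)] on the whole face. *)
Lemma paral_lower t i u : nneg t -> t 0 i = 0 -> paral A u t = hs (Phi [set 0]) u.
Proof.
move=> t0 ti.
have [mA aA] := paral_multiaffine u fA.
have [e e0 eP] := volume_Phi_lower u.
have [D D0 DP] := paral_volume.
rewrite -(paral0 A); apply: (multiaffine_bounded mA aA (C := D / (e * beta)) _ t0 ti).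
move=> s s0 si.
pose q := s + const_mx 1; have q0 j : 0 < q 0 j by rewrite !mxE ltr_wpDl.
have qn : nneg q by move=> j; exact: ltW.
have vq : 0 < vol q by apply: prodr_gt0.
have sq j : s 0 j <= q 0 j by rewrite !mxE lerDl.
have [x Fx xm] := hs_max w (bF qn); rewrite -/(paral A w q) paral_w// in xm.
have [y Fy ym] := hs_max u (bF s0).
have yw : dot y w = 0.
  apply/eqP; rewrite -normr_le0 -(paral_flat s0 si).
  exact: hs_sym_ge (bF s0) (sF s0) Fy.
have b0 := beta_gt0.
have xw : dot x w != 0 by rewrite xm gt_eqF// mulr_gt0.
have := eP _ x y (body_aff A 0 (body_rbox0 qn)) (sub_paral fA qn) Fx
  (paral_mono fA s0 sq Fy) xw.
move=> /le_trans/(_ (DP q qn)); rewrite yw mul0r subr0 ym xm lee_fin.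
rewrite -/(paral A u s) !normrM (gtr0_norm vq) (gtr0_norm b0) => h.
rewrite ler_pdivlMr ?mulr_gt0//; apply: le_trans (ler_norm _) _.
rewrite normrM (gtr0_norm (mulr_gt0 e0 b0)) -(ler_pM2r vq); move: h.
by rewrite !mulrA; apply: le_trans; rewrite le_eqVlt; apply/orP; left; apply/eqP; ring.
Qed.

Lemma paral_sigma t u : nneg t -> paral A u t =
  hs (Phi [set 0]) u + vol t * (paral A u (const_mx 1) - hs (Phi [set 0]) u).
Proof.
move=> t0; have [mA aA] := paral_multiaffine u fA.
have := @multiaffine_vol _ _ (fun t => paral A u t - hs (Phi [set 0]) u) t _ t0.
move=> H; have {}H := H _ _; rewrite -H; first ring.
- by move=> s i s0 b b0 /=; rewrite mA//; ring.
- by move=> s i s0 si; rewrite (paral_lower u s0 si) subrr.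
Qed.

Let sg u := paral A u (const_mx 1) - hs (Phi [set 0]) u.

(** On a box stretched to length N, let [y] be extremal for [u]. As [y] is no higher than [x] in
    direction [w], the determinant inequality forces [dot x u] to be within a constant of the
    maximum [l + N%:R * sg u] in absolute value; dividing by N gives the rate. *)
Lemma paral_segment_cvg (j0 : 'I_k) u : exists2 B : R, 0 < B &
  forall (N : nat) x, (0 < N)%N ->
   F (setc (const_mx 1) j0 N%:R) x -> dot x w = N%:R * beta ->
  `| sg u - `|dot x u| / N%:R | <= B / N%:R.
Proof.
have [e e0 eP] := volume_Phi_lower u.
have [D D0 DP] := paral_volume.
have b0 := beta_gt0.
pose l := hs (Phi [set 0]) u.
have l0 : 0 <= l by apply: hs_sym_ge0; [exact/bodyPhi/body_point|exact/symPhi/body_point].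
exists (D / (e * beta) + l); first by rewrite ltr_pwDl// divr_gt0// mulr_gt0.
move=> N x N0 Fx xw.
pose t : 'rV[R]_k := setc (const_mx 1) j0 N%:R.
have t0 : nneg t by apply: nneg_setc => //; exact: nneg1.
have NR : 0 < N%:R :> R by rewrite ltr0n.
have vt : vol t = N%:R.
  rewrite vol_setc !mxE ?oner_eq0// divr1 /vol big1 ?mulr1// => i _.
  by rewrite mxE.
have [y Fy ym] := hs_max u (bF t0).
have yE : dot y u = l + N%:R * sg u by rewrite ym -/(paral A u t) paral_sigma// vt.
have ywle : `|dot y w| <= N%:R * beta.
  apply: le_trans (hs_sym_ge w (bF t0) (sF t0) Fy) _.
  by rewrite -/(paral A w t) paral_w// vt.
have xule : `|dot x u| <= l + N%:R * sg u.
  apply: le_trans (hs_sym_ge u (bF t0) (sF t0) Fx) _.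
  by rewrite -/(paral A u t) paral_sigma// vt.
have xw0 : dot x w != 0 by rewrite xw gt_eqF// mulr_gt0.
have := eP _ x y (body_aff A 0 (body_rbox0 t0)) (sub_paral fA t0) Fx Fy xw0.
move=> /le_trans/(_ (DP t t0)); rewrite lee_fin vt xw => h.
have h1 : N%:R * beta * dot y u - dot y w * dot x u <= D * N%:R / e.
  by rewrite ler_pdivlMr// mulrC (le_trans _ h)// ler_pM2l// ler_norm.
have h2 : dot y w * dot x u <= N%:R * beta * `|dot x u|.
  apply: le_trans (ler_norm _) _; rewrite normrM ler_wpM2r//.
have h3 : N%:R * beta * (l + N%:R * sg u) <= N%:R * beta * (`|dot x u| + D / (e * beta)).
  rewrite -yE mulrDr.
  have -> : N%:R * beta * (D / (e * beta)) = D * N%:R / e by field; rewrite !gt_eqF.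
  lra.
rewrite ler_pM2l ?mulr_gt0// in h3.
have de0 : 0 < D / (e * beta) by rewrite divr_gt0 ?mulr_gt0.
have -> : sg u - `|dot x u| / N%:R = (N%:R * sg u - `|dot x u|) / N%:R.
  by field; rewrite gt_eqF.
rewrite normrM [X in _ * X]gtr0_norm ?invr_gt0// ler_pM2r ?invr_gt0//.
by rewrite ler_norml; apply/andP; split; lra.
Qed.

(* The vectors x_N / N, with x_N extremal in direction w, satisfy
   |dot (x_N / N) u| --> sg u; since dot (x_N / N) w = beta, polarization makes
   x_N / N itself converge. *)
Lemma paral_segment : exists v, forall u, sg u = `|dot v u|.
Proof.
have [j0 _] : exists j0 : 'I_k, True.
  by move: n_gt0; rewrite -kn; case: (k) => // m _; exists ord0.
have t0 N : nneg (setc (const_mx 1) j0 N%:R : 'rV[R]_k).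
  by apply: nneg_setc => //; exact: nneg1.
have /choice[x xP] N : exists x, F (setc (const_mx 1) j0 N%:R) x /\
    dot x w = N%:R * beta.
  have [x Fx xm] := hs_max w (bF (t0 N)); exists x; split=> //.
  rewrite xm -/(paral A w _) paral_w// vol_setc !mxE ?oner_eq0// divr1.
  by rewrite /vol big1 ?mulr1// => i _; rewrite mxE.
pose y N := (N.+1%:R : R)^-1 *: x N.+1.
have yw N : dot (y N) w = beta.
  by rewrite /y dotZl (xP _).2 mulKf// pnatr_eq0.
have cvn u : `|dot (y N) u| @[N --> \oo] --> sg u.
  have [B B0 BP] := paral_segment_cvg j0 u.
  apply/cvgrPdist_lt => e e0.
  have : harmonic N @[N --> \oo] --> (0 : R) by exact: cvg_harmonic.
  move=> /cvgrPdist_lt/(_ (e / B) (divr_gt0 e0 B0)); apply: filterS => N.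
  rewrite sub0r normrN gtr0_norm ?invr_gt0// => NB.
  rewrite /y dotZl normrM gtr0_norm ?invr_gt0// mulrC.
  apply: le_lt_trans (BP N.+1 (x N.+1) isT (xP _).1 (xP _).2) _.
  by rewrite mulrC -ltr_pdivlMr.
have b0 : 4 * beta != 0 by rewrite gt_eqF// mulr_gt0// beta_gt0.
pose l u := (sg (u + w) ^+ 2 - sg (u - w) ^+ 2) / (4 * beta).
have cvl u : dot (y N) u @[N --> \oo] --> l u.
  have -> : (fun N => dot (y N) u) = (fun N =>
      (`|dot (y N) (u + w)| ^+ 2 - `|dot (y N) (u - w)| ^+ 2) / (4 * beta)).
    apply/funext => N; rewrite !real_normK ?num_real// dotDr dotBr yw.
    by field; rewrite gt_eqF// beta_gt0.
  apply: cvgM; last exact: cvg_cst.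
  by apply: cvgB; rewrite ?expr2; apply: cvgM; exact: cvn.
pose v : 'rV[R]_n := \row_i l (delta_mx 0 i).
exists v => u.
have cvv : dot (y N) u @[N --> \oo] --> dot v u.
  rewrite dotE (_ : (fun N => _) = fun N => \sum_i dot (y N) (delta_mx 0 i) * u 0 i).
    apply: (cvg_big (@add_continuous _)) => // i _.
    by rewrite mxE; apply: cvgM; [exact: cvl|exact: cvg_cst].
  by apply/funext => N; rewrite dotE; apply: eq_bigr => i _; rewrite dot_delta.
apply: (cvg_unique _ (cvn u)) => //.
exact: cvg_norm.
Qed.

End Square.

End VolumeCondition.

End Parallelotopes.

(** * From boxes to polytopes *)

Section Polytopes.
Context {R : realType} {n : nat}.
Variable Phi : set 'rV[R]_n -> set 'rV[R]_n.
Hypothesis bodyPhi : maps_bodies Phi.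
Hypothesis trPhi : transl_invariant Phi.
Hypothesis valPhi : minkowski_valuation Phi.
Hypothesis symPhi : symmetric_images Phi.

Lemma hp_cut_le k (s : seq ('rV[R]_k * R)) l c :
  hp ((l, c) :: s) = [set x | dot x l <= c] `&` hp s.
Proof. exact: hp_cons. Qed.

Lemma hp_cut_ge k (s : seq ('rV[R]_k * R)) l c :
  hp ((- l, - c) :: s) = [set x | c <= dot x l] `&` hp s.
Proof.
rewrite hp_cons; congr (_ `&` _); apply/seteqP.
by split=> x /=; rewrite dotNr lerN2.
Qed.

Lemma hp_cut_setU k (s : seq ('rV[R]_k * R)) l c :
  hp s = hp ((l, c) :: s) `|` hp ((- l, - c) :: s).
Proof.
rewrite hp_cut_le hp_cut_ge; apply/seteqP; split=> [x sx|x [[]|[]]//].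
by have [xc|/ltW cx] := leP (dot x l) c; [left|right].
Qed.

Lemma hp_cons0 k (s : seq ('rV[R]_k * R)) c :
  hp ((0, c) :: s) = hp s \/ hp ((0, c) :: s) = set0.
Proof.
have [c0|c0] := leP 0 c; [left|right].
  by rewrite hp_cons; apply/seteqP; split=> [x []//|x sx]; split=> //=; rewrite dot0r.
by rewrite hp_cons; apply/seteqP; split=> // x [/=]; rewrite dot0r leNgt c0.
Qed.

Lemma hp_catA k (s t : seq ('rV[R]_k * R)) p : (p :: s) ++ t = p :: (s ++ t).
Proof. by []. Qed.

(** Nonnegativity makes [g] decrease under each cut, starting from 0 on an enclosing box. *)
Lemma cut_additive_ge0 k (g : set 'rV[R]_k -> R) : g set0 = 0 -> cut_additive g ->
  (forall s, bnd (hp s) -> 0 <= g (hp s)) ->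
  (forall a b : 'rV[R]_k, (forall i, a 0 i <= b 0 i) -> g (rbox a b) = 0) ->
  forall s, bnd (hp s) -> g (hp s) = 0.
Proof.
move=> g0 gc gp gb s /hp_pad[r r0 ->].
set t := boxc _ _.
have bt s' : bnd (hp (s' ++ t)).
  by apply: (@bnd_sub _ _ _ (hp t)); [rewrite hp_cat => x []|rewrite hp_boxc; exact: bnd_rbox].
elim: s => [|[l c] s IH].
  rewrite cat0s hp_boxc gb// => i; rewrite !mxE ge0_cp//.
rewrite hp_catA; have [->|l0] := eqVneq l 0.
  by have [->|->] := hp_cons0 (s ++ t) c.
apply/eqP; rewrite eq_le gp; last exact: bnd_hp_cons.
rewrite andbT -IH (gc _ l c (bt s) l0) lerDl gp//; exact: bnd_hp_cons.
Qed.

(* [Phi set0] is unconstrained, and a hyperplane may miss the polytope that it cuts. *)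
Definition rel k (A : 'M[R]_(k, n)) u (X : set 'rV[R]_k) : R :=
  if `[< X !=set0 >] then hs (Phi (aff A 0 X)) u - hs (Phi [set 0]) u else 0.

Lemma rel0 k (A : 'M[R]_(k, n)) u : rel A u set0 = 0.
Proof. by rewrite /rel; case: asboolP => // -[]. Qed.

Lemma relE k (A : 'M[R]_(k, n)) u X : X !=set0 ->
  rel A u X = hs (Phi (aff A 0 X)) u - hs (Phi [set 0]) u.
Proof. by rewrite /rel; case: asboolP. Qed.

Lemma bnd_preimage m k (B : 'M[R]_(m, k)) x0 (K : set 'rV[R]_k) :
  row_free B -> bnd K -> bnd [set z | K (z *m B + x0)].
Proof.
move=> /row_freeP[B' BB'] bK.
have /choice[r rP] i : exists r, forall x, K x -> `|(x *m B') 0 i| <= r.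
  have [r rP] := bnd_dot (delta_mx 0 i *m B'^T) bK; exists r => x /rP.
  by rewrite -dot_mulmx dot_delta.
exists (\sum_i `|r i| + `|x0 *m B'|) => z /= Kz.
have zE : z = (z *m B + x0) *m B' - x0 *m B'.
  by rewrite mulmxDl -mulmxA BB' mulmx1 addrK.
rewrite [in leLHS]zE; apply: le_trans (ler_normB _ _) _; rewrite lerD2r.
apply: norm_le_coord => [|i]; first exact: sumr_ge0.
apply: le_trans (rP i _ Kz) _; apply: le_trans (ler_norm _) _.
by rewrite (bigD1 i)//= lerDl sumr_ge0.
Qed.

Definition flat_below k u : Prop := forall r (B : 'M[R]_(r, n)),
  (r < k)%N -> row_free B -> forall s, bnd (hp s) -> hp s !=set0 ->
  hs (Phi (aff B 0 (hp s))) u = hs (Phi [set 0]) u.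

(** The section has smaller dimension, so by [flat_below] its image has the support value of [Phi
    [set 0]], and the correction term of the valuation cancels. A basis of the kernel of [l]
    parametrises the section. *)
Lemma rel_cut_additive k (A : 'M[R]_(k, n)) u :
  row_free A -> flat_below k u -> cut_additive (rel A u).
Proof.
move=> fA low s l c bs l0.
have [s0|s0] := pselect (hp s !=set0); last first.
  have se : hp s = set0 by apply/eqP/negPn/negP => /set0P.
  have E p : hp (p :: s) = set0.
    by rewrite -subset0 -se; exact: hp_cons_sub.
  by rewrite !E se rel0 addr0.
have [le0|le0] := pselect (hp ((l, c) :: s) !=set0); last first.
  have le_e : hp ((l, c) :: s) = set0 by apply/eqP/negPn/negP => /set0P.
  by rewrite [in LHS](hp_cut_setU s l c) le_e set0U rel0 add0r.
have [ge0|ge0] := pselect (hp ((- l, - c) :: s) !=set0); last first.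
  have ge_e : hp ((- l, - c) :: s) = set0 by apply/eqP/negPn/negP => /set0P.
  by rewrite [in LHS](hp_cut_setU s l c) ge_e setU0 rel0 addr0.
have bK := hp_body bs s0.
rewrite !relE// hp_cut_le hp_cut_ge.
rewrite hp_cut_le in le0; rewrite hp_cut_ge in ge0.
have := valuation_cut bodyPhi valPhi u fA bK le0 ge0.
have [x0 [/= x0c x0s]] : ([set x | dot x l = c] `&` hp s) !=set0.
  have [x [/= xc Xx]] := le0; have [y [/= yc Xy]] := ge0.
  have [xy|xy] := eqVneq (dot x l) (dot y l).
    by exists x; split=> //=; apply/eqP; rewrite eq_le xc xy yc.
  pose t := (c - dot x l) / (dot y l - dot x l).
  have d0 : 0 < dot y l - dot x l.
    by rewrite subr_gt0 lt_neqAle xy (le_trans xc).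
  exists ((1 - t) *: x + t *: y); split.
    rewrite /= dotDl !dotZl /t; field; exact: lt0r_neq0.
  have [_ [_ cX]] := bK.
  apply: cX => //; rewrite divr_ge0 ?subr_ge0//= ?(ltW d0) ?ler_pdivrMr//; lra.
pose B := row_base (kermx l^T).
have fB : row_free B by exact: row_base_free.
have Bl z : dot (z *m B) l = 0.
  rewrite /dot; suff -> : z *m B *m l^T = 0 by rewrite mxE.
  by apply/sub_kermxP; rewrite -(eq_row_base (kermx l^T)) submxMl.
have rk : (\rank (kermx l^T) < k)%N.
  rewrite mxrank_ker mxrank_tr rank_rV l0 ltn_subrL//=.
  apply: contraNT l0; rewrite -eqn0Ngt => /eqP k0.
  by apply/eqP/rowP => i; have := ltn_ord i; rewrite [in X in (_ < X)%N]k0.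
have XE : [set x | dot x l = c] `&` hp s = aff B x0 (hp (hppre s B x0)).
  apply/seteqP; split=> [x [/= xc sx]|_ [z zs <-]].
    have : (x - x0 <= B)%MS.
      rewrite eq_row_base; apply/sub_kermxP/matrixP => i j.
      by rewrite !ord1 -/(dot _ _) dotBl xc x0c subrr mxE.
    move=> /submxP[z zE]; exists z; last by rewrite -zE subrK.
    by rewrite hp_preE /= -zE subrK.
  by rewrite hp_preE in zs; split=> //=; rewrite dotDl Bl add0r.
have bpre : bnd (hp (hppre s B x0)) by rewrite hp_preE; exact: bnd_preimage.
have pre0 : hp (hppre s B x0) !=set0.
  have : ([set x | dot x l = c] `&` hp s) x0 by [].
  by rewrite XE => -[z zs _]; exists z.
rewrite XE aff_comp Phi_aff//; last exact: hp_body.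
rewrite (low _ (B *m A))//; first by move=> h; move: h; lra.
by rewrite /row_free mxrankMfree// -/(row_free B).
Qed.

(** Here [rel] is at least [- c], as support values of symmetric bodies are nonnegative. Hence
    discarding one side of a cut raises it by at most [c], and from the value 0 on a box m cuts
    reach at most m times [c]. This is the bound that [cut_class] asks for. *)
Lemma polytope_flat k (A : 'M[R]_(k, n)) u : (0 < k)%N -> row_free A ->
  flat_below k u ->
  (forall t, nneg t -> paral Phi A u t = hs (Phi [set 0]) u) ->
  forall s, bnd (hp s) -> hp s !=set0 ->
  hs (Phi (aff A 0 (hp s))) u = hs (Phi [set 0]) u.
Proof.
move=> k0 fA low box s bs s0; apply/eqP; rewrite -subr_eq0 -relE//; apply/eqP.
pose c := hs (Phi [set 0]) u.
have c0 : 0 <= c.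
  by apply: hs_sym_ge0; [exact/bodyPhi/body_point|exact/symPhi/body_point].
have gc := rel_cut_additive fA low.
have ge s' : bnd (hp s') -> - c <= rel A u (hp s').
  move=> bs'; rewrite /rel; case: asboolP => [s'0|_]; last by rewrite oppr_le0.
  rewrite lerBrDr addNr; have bK := hp_body bs' s'0.
  by apply: hs_sym_ge0; [exact/bodyPhi/body_aff|exact/symPhi/body_aff].
have relbox (a b : 'rV[R]_k) : (forall i, a 0 i <= b 0 i) -> rel A u (rbox a b) = 0.
  move=> ab; have bB := body_rbox ab; rewrite relE; last by case: bB.
  have tE : rbox a b = stransl (rbox 0 (b - a)) a.
    apply/seteqP; split=> [x xab|_ [x xba <-] i].
      exists (x - a); last by rewrite subrK.
      by move=> i; have := xab i; rewrite !mxE => /andP[h1 h2]; apply/andP; split; lra.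
    by have := xba i; rewrite !mxE => /andP[h1 h2]; apply/andP; split; lra.
  have nba : nneg (b - a) by move=> i; rewrite !mxE subr_ge0.
  rewrite tE Phi_stransl//; last exact: body_rbox0.
  by rewrite -/(paral Phi A u (b - a)) box// subrr.
apply: cut_class_vanish => //; split=> //.
- exact: rel0.
- move=> s' t bs'; rewrite /rel.
  have E : stransl (hp s') t !=set0 <-> hp s' !=set0.
    by split=> [[_ [x sx _]]|[x sx]]; [exists x|exists (x + t); exists x].
  case: asboolP => [/E h|h]; case: asboolP => [h'|h'] //.
    by rewrite Phi_stransl//; exact: hp_body.
  by move: h => /E.
exists (fun m => m%:R * c) => s'.
move=> bs'; have mc : 0 <= (size s')%:R * c by rewrite mulr_ge0.
have low_b : - ((size s')%:R * c) <= rel A u (hp s').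
  have [->|s'0] := eqVneq (hp s') set0; first by rewrite rel0 oppr_le0.
  case: s' bs' mc s'0 => [|p s'] bs' mc s'0; last first.
    apply: le_trans (ge _ bs'); rewrite lerN2 /= -natr1 mulrDl mul1r lerDr.
    by rewrite mulr_ge0.
  have [r r0 E] := hp_pad bs'; rewrite mul0r oppr0 E cat0s hp_boxc relbox//.
  by move=> i; rewrite !mxE ge0_cp.
rewrite ler_norml low_b /=.
have [r r0 ->] := hp_pad bs'; set t := boxc _ _.
have bt s'' : bnd (hp (s'' ++ t)).
  by apply: (@bnd_sub _ _ _ (hp t)); [rewrite hp_cat => x []|rewrite hp_boxc; exact: bnd_rbox].
elim: s' {bs' mc low_b} => [|[l e] s' IH].
  rewrite mul0r cat0s hp_boxc relbox// => i; rewrite !mxE ge0_cp//.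
have Sc : (size s')%:R * c <= (size ((l, e) :: s'))%:R * c.
  by rewrite ler_wpM2r// ler_nat /=.
rewrite hp_catA; have [->|l0] := eqVneq l 0.
  have [->|->] := hp_cons0 (s' ++ t) e; first exact: le_trans IH Sc.
  by rewrite rel0 mulr_ge0.
have := gc _ l e (bt s') l0; have := ge _ (bnd_hp_cons (- l, - e) (bt s')).
by rewrite /= -natr1 mulrDl mul1r; move: IH; lra.
Qed.

Lemma aff1 X : aff (1%:M : 'M[R]_n) 0 X = X.
Proof.
apply/seteqP; split=> [_ [x Xx <-]|x Xx]; first by rewrite mulmx1 addr0.
by exists x; rewrite ?mulmx1 ?addr0.
Qed.

Section VolumeCondition.
Variables (c C : R) (A0 : 'M[R]_n) (i0 i1 : 'I_n) (w : 'rV[R]_n).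
Hypotheses (c_gt0 : 0 < c) (C_gt0 : 0 < C).
Hypothesis VCP : forall K, convex_body K ->
  (c%:E * volume_n K <= volume_n (Phi K) <= C%:E * volume_n K)%E.
Hypothesis A0_unit : A0 \in unitmx.
Hypothesis A0_w : forall i, i != i0 -> dot (row i A0) w = 0.
Hypothesis A0_L : forall i, i != i0 -> Phi [set 0] (row i A0).
Hypothesis i1_neq : i1 != i0.
Hypothesis w_neq0 : w != 0.
Hypothesis L_w : forall x, Phi [set 0] x -> dot x w = 0.

(** Completing [A] by a complement turns the box into an n-dimensional one with zero edges, to which
    [paral_lower] applies. *)
Lemma paral_lowdim k (A : 'M[R]_(k, n)) u t : (k < n)%N -> row_free A -> nneg t ->
  paral Phi A u t = hs (Phi [set 0]) u.
Proof.
move=> kn fA t0; pose B := row_base (A^C)%MS.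
have rA : \rank A = k by apply/eqP.
have rC : \rank (A^C)%MS = (n - k)%N by rewrite mxrank_compl rA.
have knr : (k + \rank (A^C)%MS)%N = n by rewrite rC subnKC// ltnW.
have fM : row_free (col_mx A B).
  rewrite /row_free -addsmxE.
  have -> : \rank (A + B)%MS = n.
    have := addsmx_compl_full A; rewrite /row_full => /eqP; apply: etrans.
    by rewrite (adds_eqmx (eqmx_refl A) (eq_row_base _)).
  by rewrite eq_sym; apply/eqP.
have [j _] : exists j : 'I_(\rank (A^C)%MS), True.
  have : (0 < \rank (A^C)%MS)%N by rewrite rC subn_gt0.
  by case: (\rank _) => // m _; exists ord0.
have t0' : nneg (row_mx t (0 : 'rV[R]_(\rank (A^C)%MS))).
  by move=> i; case: (splitP i) => i' ii';
    [rewrite (_ : i = lshift _ i') ?row_mxEl|rewrite (_ : i = rshift _ i') ?row_mxEr ?mxE];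
    rewrite //; exact: val_inj.
have := paral_lower bodyPhi trPhi valPhi symPhi c_gt0 C_gt0 VCP A0_unit A0_w A0_L
  i1_neq w_neq0 knr fM (i := rshift k j) u t0'.
rewrite row_mxEr mxE => /(_ erefl) <-; rewrite /paral; congr (hs (Phi _) u).
apply/seteqP; split=> [_ [x xt <-]|_ [x xt <-]].
  exists (row_mx x 0); last by rewrite mul_row_col mul0mx addr0.
  move=> i; case: (splitP i) => i' ii'.
    rewrite (_ : i = lshift _ i'); last exact: val_inj.
    by rewrite !row_mxEl; have := xt i'; rewrite !mxE.
  rewrite (_ : i = rshift _ i'); last exact: val_inj.
  by rewrite !row_mxEr !mxE lexx.
exists (lsubmx x).
  by move=> i; have := xt (lshift _ i); rewrite row_mxEl !mxE.
rewrite -{2}(hsubmxK x) mul_row_col (_ : rsubmx x = 0) ?mul0mx ?addr0//.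
apply/rowP => i; have := xt (rshift _ i); rewrite row_mxEr !mxE => /andP[h1 h2].
by apply/eqP; rewrite eq_le h1 h2.
Qed.

Lemma polytope_lowdim k u : (k <= n)%N -> flat_below k u.
Proof.
elim/ltn_ind: k => k IH kn r B rk fB s bs s0.
have rn := leq_trans rk kn.
case: r => [|r] in B rk fB s bs s0 rn *; last first.
  apply: polytope_flat => //; first exact: IH rk (ltnW rn).
  by move=> t t0; exact: paral_lowdim.
congr (hs (Phi _) u); have [x sx] := s0; apply/seteqP; split=> [_ [y _ <-]|_ ->].
  by rewrite thinmx0 mul0mx addr0.
by exists x; rewrite // thinmx0 mul0mx addr0.
Qed.

Hypothesis n_gt0 : (0 < n)%N.

Let one_free : row_free (1%:M : 'M[R]_n).
Proof. by rewrite row_free_unit unitmx1. Qed.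

Lemma polytope_rel_cut u : cut_additive (rel (1%:M : 'M[R]_n) u).
Proof. exact/rel_cut_additive/polytope_lowdim. Qed.

Lemma rel1E u X : X !=set0 -> rel (1%:M : 'M[R]_n) u X = hs (Phi X) u - hs (Phi [set 0]) u.
Proof. by move=> X0; rewrite relE// aff1. Qed.

Lemma box_formula : exists v : 'rV[R]_n,
  dot v w != 0 /\ forall (u a b : 'rV[R]_n), (forall i, a 0 i <= b 0 i) ->
    rel (1%:M : 'M[R]_n) u (rbox a b) = vol (b - a) * `|dot v u|.
Proof.
have [v vP] := paral_segment bodyPhi trPhi valPhi symPhi c_gt0 C_gt0 VCP A0_unit
  A0_w A0_L i1_neq w_neq0 erefl one_free.
exists v; split.
  have := beta_gt0 bodyPhi symPhi c_gt0 VCP A0_unit A0_w w_neq0 erefl one_free.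
  have := vP w; rewrite (hs_L_w bodyPhi L_w) subr0 => ->.
  by rewrite normr_gt0.
move=> u a b ab; have bB := body_rbox ab; rewrite relE; last by case: bB.
have tE : rbox a b = stransl (rbox 0 (b - a)) a.
  apply/seteqP; split=> [x xab|_ [x xba <-] i].
    exists (x - a); last by rewrite subrK.
    by move=> i; have := xab i; rewrite !mxE => /andP[h1 h2]; apply/andP; split; lra.
  by have := xba i; rewrite !mxE => /andP[h1 h2]; apply/andP; split; lra.
have nba : nneg (b - a) by move=> i; rewrite !mxE subr_ge0.
rewrite tE Phi_stransl//; last exact: body_rbox0.
rewrite -/(paral Phi 1%:M u (b - a)).
rewrite (paral_sigma bodyPhi trPhi valPhi symPhi c_gt0 C_gt0 VCP A0_unit A0_w A0_L
  i1_neq w_neq0 erefl one_free)//.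
by rewrite vP addrAC subrr add0r.
Qed.

(** For [u] orthogonal to [v] even full-dimensional boxes have the support value of [Phi [set 0]],
    so [polytope_flat] applies in dimension n itself. *)
Lemma polytope_proj v u : (forall a b : 'rV[R]_n, (forall i, a 0 i <= b 0 i) ->
    rel (1%:M : 'M[R]_n) u (rbox a b) = vol (b - a) * `|dot v u|) ->
  dot v u = 0 -> forall s, bnd (hp s) -> rel (1%:M : 'M[R]_n) u (hp s) = 0.
Proof.
move=> vbox vu s bs.
have [->|/set0P s0] := eqVneq (hp s) set0; first exact: rel0.
rewrite relE//; apply/eqP; rewrite subr_eq0; apply/eqP.
apply: polytope_flat => // [|t t0]; first exact: polytope_lowdim.
have bB := body_rbox0 t0.
have := vbox 0 t; rewrite vu normr0 mulr0 relE; last by case: bB.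
move=> H; apply/eqP; rewrite -subr_eq0; apply/eqP/H => i.
by rewrite mxE.
Qed.

End VolumeCondition.

End Polytopes.

(** * From polytopes to convex bodies *)

Section Approximation.
Context {R : realType} {n : nat}.
Implicit Types (K : set 'rV[R]_n) (s : seq ('rV[R]_n * R)).

Lemma closed_far K (e : R) : closed [set x | forall y, K y -> e <= `|x - y|].
Proof.
have -> : [set x | forall y, K y -> e <= `|x - y|] =
    \bigcap_(y in K) [set x | e <= `|x - y|] by [].
apply: closed_bigI => y _.
have -> : [set x | e <= `|x - y|] = (fun x : 'rV[R]_n => `|x - y|) @^-1` [set r | e <= r] by [].
apply: closed_comp => [x _|]; last exact: closed_ge.
apply: (@continuous_comp _ _ _ (fun x : 'rV[R]_n => x - y) Num.norm).
  by apply: (@continuousB _ _ _ id (fun=> y)) => //; exact: cst_continuous.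
exact: norm_continuous.
Qed.

Lemma hp_margin K (s : seq ('rV[R]_n * R)) : convex_body K ->
  (forall p, p \in s -> hs K p.1 < p.2) ->
  exists2 d : R, 0 < d & forall x y, K y -> `|x - y| <= d -> hp s x.
Proof.
move=> bK; elim: s => [|p s IH] Ks; first by exists 1.
have [|d d0 dP] := IH; first by move=> q qs; apply: Ks; rewrite in_cons qs orbT.
have kp : hs K p.1 < p.2 by apply: Ks; exact: mem_head.
pose S : R := 1 + \sum_i `|p.1 0 i|.
have S0 : 0 < S by rewrite ltr_pwDl// sumr_ge0.
exists (Num.min d ((p.2 - hs K p.1) / S)).
  by rewrite lt_min d0 divr_gt0// subr_gt0.
move=> x y Ky; rewrite le_min => /andP[xd xp]; rewrite hp_cons; split; last exact: dP xd.
rewrite /= -(subrK y x) dotDl -lerBrDr.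
apply: (@le_trans _ _ (p.2 - hs K p.1)); last by rewrite lerD2l lerN2 hs_ge.
apply: le_trans (ler_norm _) _; rewrite dotE.
apply: le_trans (ler_norm_sum _ _ _) _.
apply: (@le_trans _ _ (\sum_i `|x - y| * `|p.1 0 i|)).
  by apply: ler_sum => i _; rewrite normrM ler_wpM2r// coord_le_norm.
rewrite -mulr_sumr; apply: (@le_trans _ _ (`|x - y| * S)).
  by rewrite ler_wpM2l// /S lerDr.
by rewrite -ler_pdivlMr.
Qed.

(** The points of a large box at distance at least [e] from [K] form a compact set, covered by
    finitely many open half-spaces whose closures miss [K]. Their complements cut out the polytope,
    and strict separation leaves a margin [d] around [K]. *)
Lemma polytope_approx K (e : R) : convex_body K -> 0 < e ->
  exists s, exists2 d : R, 0 < d &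
    [/\ bnd (hp s), forall x y, K y -> `|x - y| <= d -> hp s x &
        forall x, hp s x -> exists2 y, K y & `|x - y| <= e].
Proof.
move=> bK e0; have [r0 r0P] := bounded_body bK.
pose r := `|r0| + e; have r_ge0 : 0 <= r by rewrite addr_ge0// ltW.
pose Z := rbox (const_mx (- r)) (const_mx r) `&`
  [set x : 'rV[R]_n | forall y, K y -> e <= `|x - y|].
have cZ : compact Z.
  apply: closed_bnd_compact; last first.
    by apply: (@bnd_sub _ _ _ (rbox (const_mx (- r)) (const_mx r))) => [x []//|]; exact: bnd_rbox.
  by apply: closedI; [rewrite -hp_boxc; exact: closed_hp|exact: closed_far].
rewrite compact_cover in cZ.
have [||D' D'D ZD'] := cZ _ [set p : 'rV[R]_n * R | hs K p.1 < p.2]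
    (fun p => [set z | p.2 < dot z p.1]).
- move=> p _; have -> : [set z | p.2 < dot z p.1] = ~` [set z | dot z p.1 <= p.2].
    by apply/seteqP; split=> z /=; rewrite leNgt; [move=> ->|move/negP/negPn].
  exact/closed_openC/closed_halfspace.
- move=> z [_ zK]; have nKz : ~ K z.
    by move=> /zK; rewrite subrr normr0 leNgt e0.
  have [u uz] := body_separation bK nKz.
  (* The midpoint keeps the half-space strictly away from [K] while [z] stays strictly inside it. *)
  by exists (u, (hs K u + dot z u) / 2); rewrite /=; lra.
pose t := boxc (const_mx (- r)) (const_mx r) : seq ('rV[R]_n * R).
have [d d0 dP] : exists2 d : R, 0 < d &
    forall x y, K y -> `|x - y| <= d -> hp (finmap.enum_fset D') x.
  by apply: hp_margin => // p pD; have := D'D p pD; rewrite inE.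
exists (finmap.enum_fset D' ++ t), (Num.min d e); first by rewrite lt_min d0.
split.
- apply: (@bnd_sub _ _ _ (hp t)); first by rewrite hp_cat => x [].
  by rewrite hp_boxc; exact: bnd_rbox.
- move=> x y Ky; rewrite le_min => /andP[xd xe]; rewrite hp_cat; split; first exact: dP xd.
  rewrite hp_boxc; apply/rbox_norm => //; rewrite -(subrK y x).
  apply: le_trans (ler_normD _ _) _; rewrite /r addrC lerD//.
  exact: le_trans (r0P y Ky) (ler_norm _).
move=> x; rewrite hp_cat hp_boxc => -[xD xr]; apply: contrapT => nx.
have /ZD'[p /= pD px] : Z x.
  split=> //= y Ky; rewrite leNgt; apply/negP => /ltW xy; apply: nx.
  by exists y.
have := allP xD p pD; rewrite /= leNgt; apply/negP; rewrite negbK.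
exact: px.
Qed.

Lemma volume_fin (X : set 'rV[R]_n) : (0 < n)%N -> bnd X ->
  volume_n X \is a fin_num.
Proof.
move=> n0 [r rX]; rewrite ge0_fin_numE ?volume_ge0//.
have ab i : (const_mx (- `|r|) : 'rV[R]_n) 0 i <= (const_mx `|r| : 'rV[R]_n) 0 i.
  by rewrite !mxE ge0_cp.
apply: (@le_lt_trans _ _ (vol ((const_mx `|r| : 'rV[R]_n) - const_mx (- `|r|)))%:E).
  apply: le_trans (volume_mono _) (volume_rbox_le n0 ab) => x /rX xr.
  by apply/rbox_norm => //; exact: le_trans (ler_norm _).
exact: ltry.
Qed.

End Approximation.

(* Bisecting boxes bounds beta V by g from above on neighbourhoods, hence by continuity
   everywhere; additivity inside a large box, where both sides agree, gives equality. *)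
Section Content.
Context {R : realType} {n : nat}.
Variables (g : set 'rV[R]_n -> R) (beta : R).
Hypothesis n_gt0 : (0 < n)%N.
Hypothesis beta_gt0 : 0 < beta.
Hypothesis g0 : g set0 = 0.
Hypothesis g_cut : cut_additive g.
Hypothesis g_ge0 : forall s, bnd (hp s) -> 0 <= g (hp s).
Hypothesis g_box : forall a b : 'rV[R]_n, (forall i, a 0 i <= b 0 i) ->
  g (rbox a b) = vol (b - a) * beta.
Hypothesis g_cont : forall s (e : R), bnd (hp s) -> hp s !=set0 -> 0 < e ->
  exists2 d : R, 0 < d & forall s', bnd (hp s') -> near_sets d (hp s) (hp s') ->
    g (hp s') <= g (hp s) + e.

Lemma bnd_cat_boxc (s : seq ('rV[R]_n * R)) a b : bnd (hp (s ++ boxc a b)).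
Proof.
apply: (@bnd_sub _ _ _ (rbox a b)); last exact: bnd_rbox.
by rewrite hp_cat hp_boxc => x [].
Qed.

(** Once the cells have edges below [d], a cell meeting [K] lies inside [hp s], where [g] is known
    exactly; on any other cell [g] is nonnegative and [K] contributes nothing. *)
Lemma volume_le_content (K : set 'rV[R]_n) s (d : R) : 0 < d -> bnd (hp s) ->
  (forall x y, K y -> `|x - y| <= d -> hp s x) ->
  (beta%:E * volume_n K <= (g (hp s))%:E)%E.
Proof.
move=> d0 bs Ks.
have KS : K `<=` hp s by move=> x Kx; apply: (Ks x x Kx); rewrite subrr normr0 ltW.
have [r r0 sE] := hp_pad bs.
pose a0 : 'rV[R]_n := const_mx (- r); pose L : 'rV[R]_n := const_mx (2 * r).
have abE : const_mx r = a0 + L by apply/rowP => i; rewrite !mxE; ring.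
pose P a b := (beta%:E * volume_n (K `&` rbox a b) <= (g (hp (s ++ boxc a b)))%:E)%E.
suff H : forall a, P a (a + L).
  have := H a0; rewrite /P -abE -sE; congr (_ * volume_n _ <= _)%E.
  apply/setIidPl => x /KS; rewrite sE hp_cat hp_boxc => -[].
  by [].
have [m mP] := exists_halvings_lt L d0.
have hm0 i : 0 <= halved L m 0 i by rewrite !mxE divr_ge0 ?exprn_ge0// mulr_ge0.
apply: (halving_ind (P := P) (m := m)) => [i|a b i c ab acb P1 P2|a].
- by rewrite mxE mulr_ge0.
- rewrite /P (g_cut c (bnd_cat_boxc s a b) (l := delta_mx 0 i)); last first.
    apply/eqP => /rowP/(_ i); rewrite !mxE !eqxx => /eqP.
    by rewrite oner_eq0.
  have -> : hp ((delta_mx 0 i, c) :: s ++ boxc a b) = hp (s ++ boxc a (setc b i c)).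
    rewrite hp_cons [in LHS]hp_cat [in RHS]hp_cat !hp_boxc setICA; congr (_ `&` _).
    rewrite (rbox_bisect acb); apply/seteqP; split=> x.
      move=> [/= xc [//|xab]]; rewrite dot_delta in xc.
      move=> j; rewrite setcE; case: eqVneq => [->|ji].
        have := xab i; rewrite setcE eqxx => /andP[cx _].
        by rewrite xc andbT (le_trans _ cx)//; have /andP[] := acb.
      by have := xab j; rewrite setcE (negPf ji).
    move=> xab; split; last by left.
    by rewrite /= dot_delta; have := xab i; rewrite setcE eqxx => /andP[].
  have -> : hp ((- delta_mx 0 i, - c) :: s ++ boxc a b) = hp (s ++ boxc (setc a i c) b).
    rewrite hp_cons [in LHS]hp_cat [in RHS]hp_cat !hp_boxc setICA; congr (_ `&` _).
    rewrite (rbox_bisect acb); apply/seteqP; split=> x.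
      move=> [/= xc [xab|//]]; rewrite dotNr dot_delta lerN2 in xc.
      move=> j; rewrite setcE; case: eqVneq => [->|ji].
        have := xab i; rewrite setcE eqxx => /andP[_ cx].
        by rewrite xc (le_trans cx)//; have /andP[] := acb.
      by have := xab j; rewrite setcE (negPf ji).
    move=> xab; split; last by right.
    by rewrite /= dotNr dot_delta lerN2; have := xab i; rewrite setcE eqxx => /andP[].
  rewrite (rbox_bisect acb) setIUr EFinD.
  apply: le_trans (leeD P1 P2).
  rewrite -ge0_muleDr ?volume_ge0// lee_wpmul2l ?lee_fin ?(ltW beta_gt0)//.
  exact: volume_setU.
rewrite /P; set b := a + halved L m.
have ab i : a 0 i <= b 0 i by rewrite /b mxE lerDl.
have [K0|/set0P[y [Ky yab]]] := eqVneq (K `&` rbox a b) set0.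
  by rewrite K0 volume_set0// mule0 lee_fin g_ge0//; exact: bnd_cat_boxc.
have -> : hp (s ++ boxc a b) = rbox a b.
  rewrite hp_cat hp_boxc; apply/setIidPr => x xab; apply: (Ks x y Ky).
  apply: norm_le_coord => [|i]; first exact: ltW.
  have /andP[x1 x2] := xab i; have /andP[y1 y2] := yab i.
  have := mP i; rewrite !mxE => hd; rewrite !mxE in x2 y2.
  by rewrite ler_norml; apply/andP; split; lra.
rewrite g_box// mulrC EFinM lee_wpmul2l ?lee_fin ?(ltW beta_gt0)//.
apply: le_trans (volume_mono _) (volume_rbox_le n_gt0 ab).
by move=> x [].
Qed.

Lemma volume_le_content_self s : bnd (hp s) ->
  beta * fine (volume_n (hp s)) <= g (hp s).
Proof.
move=> bs; have [->|/set0P s0] := eqVneq (hp s) set0.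
  by rewrite volume_set0// g0 mulr0.
have bK := hp_body bs s0.
apply/ler_addgt0Pr => e e0; have [d d0 dP] := g_cont bs s0 e0.
have [s' [d' d'0 [bs' s'1 s'2]]] := polytope_approx bK d0.
have := volume_le_content d'0 bs' s'1.
rewrite -(fineK (volume_fin n_gt0 bs)) -EFinM lee_fin => /le_trans; apply.
apply: dP => //; split=> x; last by move=> /s'2[y Ky xy]; exists y => //; rewrite distrC.
move=> sx; exists x; last by rewrite subrr normr0 ltW.
by apply: (s'1 x x sx); rewrite subrr normr0 ltW.
Qed.

Lemma content_volume s : bnd (hp s) -> g (hp s) = beta * fine (volume_n (hp s)).
Proof.
move=> /hp_pad[r r0 ->]; set a := const_mx (- r); set b := const_mx r.
have ab i : a 0 i <= b 0 i by rewrite !mxE ge0_cp.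
elim: s => [|[l c] s IH].
  by rewrite cat0s hp_boxc g_box// volume_rbox//= mulrC.
rewrite hp_catA; have [->|l0] := eqVneq l 0.
  have [->//|->] := hp_cons0 (s ++ boxc a b) c.
  by rewrite g0 volume_set0// mulr0.
have bs := bnd_cat_boxc s a b.
have b1 := bnd_hp_cons (l, c) bs; have b2 := bnd_hp_cons (- l, - c) bs.
apply/eqP; rewrite eq_le volume_le_content_self// andbT.
have h2 := volume_le_content_self b2.
(* Subadditivity of the volume suffices: [g] is additive, dominates on both pieces and agrees on
   their union, so neither piece can be strict. *)
have := volume_setU n_gt0 (hp ((l, c) :: s ++ boxc a b)) (hp ((- l, - c) :: s ++ boxc a b)).
rewrite -hp_cut_setU -(fineK (volume_fin n_gt0 bs)) -(fineK (volume_fin n_gt0 b1)).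
rewrite -(fineK (volume_fin n_gt0 b2)) -EFinD lee_fin => h.
have := ler_wpM2l (ltW beta_gt0) h; rewrite -IH (g_cut c bs l0) mulrDr.
by move: h2; lra.
Qed.

End Content.

(** * The formula for support functions, on polytopes and then on bodies *)

Section Formula.
Context {R : realType} {n : nat}.
Variable Phi : set 'rV[R]_n -> set 'rV[R]_n.
Hypothesis bodyPhi : maps_bodies Phi.
Hypothesis contPhi : hcontinuous Phi.
Hypothesis trPhi : transl_invariant Phi.
Hypothesis valPhi : minkowski_valuation Phi.
Hypothesis symPhi : symmetric_images Phi.
Variables (c C : R) (A0 : 'M[R]_n) (i0 i1 : 'I_n) (w : 'rV[R]_n).
Hypotheses (c_gt0 : 0 < c) (C_gt0 : 0 < C).
Hypothesis VCP : forall K, convex_body K ->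
  (c%:E * volume_n K <= volume_n (Phi K) <= C%:E * volume_n K)%E.
Hypothesis A0_unit : A0 \in unitmx.
Hypothesis A0_w : forall i, i != i0 -> dot (row i A0) w = 0.
Hypothesis A0_L : forall i, i != i0 -> Phi [set 0] (row i A0).
Hypothesis i1_neq : i1 != i0.
Hypothesis w_neq0 : w != 0.
Hypothesis L_w : forall x, Phi [set 0] x -> dot x w = 0.
Hypothesis n_gt0 : (0 < n)%N.

Local Notation relP := (rel Phi (1%:M : 'M[R]_n)).

Let bL : convex_body (Phi [set 0]). Proof. exact/bodyPhi/body_point. Qed.
Let sL : origin_symmetric (Phi [set 0]). Proof. exact/symPhi/body_point. Qed.

Lemma hs_polytope_cont u s (e : R) : bnd (hp s) -> hp s !=set0 -> 0 < e ->
  exists2 d : R, 0 < d & forall s', bnd (hp s') -> near_sets d (hp s) (hp s') ->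
    relP u (hp s') <= relP u (hp s) + e.
Proof.
move=> bs s0 e0; have bK := hp_body bs s0.
have [d d0 dP] := hs_continuous bodyPhi contPhi u bK e0.
exists d => // s' bs' near; have s'0 : hp s' !=set0.
  by have [x sx] := s0; have [y s'y _] := near.1 x sx; exists y.
have := dP _ (hp_body bs' s'0) near.
by rewrite !rel1E// ltr_norml => /andP[]; lra.
Qed.

Lemma rel_w_ge0 s : bnd (hp s) -> 0 <= relP w (hp s).
Proof.
move=> bs; have [->|/set0P s0] := eqVneq (hp s) set0; first by rewrite rel0.
rewrite rel1E// (hs_L_w bodyPhi L_w) subr0.
by apply: hs_sym_ge0; [exact/bodyPhi/hp_body|exact/symPhi/hp_body].
Qed.

Lemma polytope_formula v : dot v w != 0 ->
  (forall (u a b : 'rV[R]_n), (forall i, a 0 i <= b 0 i) ->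
    relP u (rbox a b) = vol (b - a) * `|dot v u|) ->
  forall u s, bnd (hp s) -> relP u (hp s) = fine (volume_n (hp s)) * `|dot v u|.
Proof.
move=> vw vbox u s bs.
have cut u' : cut_additive (relP u').
  exact: (polytope_rel_cut bodyPhi trPhi valPhi symPhi c_gt0 C_gt0 VCP A0_unit A0_w
    A0_L i1_neq w_neq0).
have b0 : 0 < `|dot v w| by rewrite normr_gt0.
have lam := content_volume n_gt0 b0 (rel0 _ _ _) (cut w) rel_w_ge0 (vbox w)
  (hs_polytope_cont w) bs.
(* Both summands of [u1 + a *: w] are settled: the first is orthogonal to [v], the second a multiple
   of [w]. *)
pose a := dot v u / dot v w; pose u1 := u - a *: w.
have vu1 : dot v u1 = 0 by rewrite /u1 dotBr dotZr divfK// subrr.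
have uE : u = u1 + a *: w by rewrite subrK.
have r1 s' : bnd (hp s') -> relP u1 (hp s') = 0.
  exact: (polytope_proj bodyPhi trPhi valPhi symPhi c_gt0 C_gt0 VCP A0_unit A0_w
    A0_L i1_neq w_neq0 n_gt0 (vbox u1) vu1).
have raw X : convex_body X -> relP (a *: w) X = `|a| * relP w X.
  move=> bX; have [X0 _] := bX; rewrite !rel1E// !hsZ_sym//; first by ring.
  - exact: bodyPhi.
  - exact: symPhi.
have hsu : hs (Phi [set 0]) u = hs (Phi [set 0]) u1.
  apply: hs_eq => // [x Lx|].
    by rewrite uE dotDr dotZr L_w// mulr0 addr0 hs_ge.
  have [x Lx xm] := hs_max u1 bL; exists x => //.
  by rewrite uE dotDr dotZr L_w// mulr0 addr0.
have hsaw : hs (Phi [set 0]) (a *: w) = 0.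
  by rewrite hsZ_sym// (hs_L_w bodyPhi L_w) mulr0.
(* The terms coming from [Phi [set 0]] cancel because that body is orthogonal to [w]; what remains
   is the defect of subadditivity of a support function. *)
pose D X := relP u1 X + relP (a *: w) X - relP u X.
have D0 : D (hp s) = 0.
  apply: cut_additive_ge0 => // [|s' l e bs' l0|s' bs'|p q pq].
  - by rewrite /D !rel0 addr0 subrr.
  - by rewrite /D !(cut _ s' l e)//; ring.
  - have [->|/set0P s'0] := eqVneq (hp s') set0; first by rewrite /D !rel0 addr0 subrr.
    have bK := bodyPhi (hp_body bs' s'0).
    by rewrite /D !rel1E// hsu hsaw; have := hsD u1 (a *: w) bK; rewrite -uE; lra.
  have bB := body_rbox pq.
  rewrite /D !vbox// vu1 normr0 mulr0 add0r dotZr -mulrBr (_ : a * _ = dot v u).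
    by rewrite subrr mulr0.
  by rewrite divfK.
have [se|/set0P s0] := eqVneq (hp s) set0.
  by rewrite se rel0 volume_set0//= mul0r.
have bK := hp_body bs s0.
move: D0; rewrite /D r1// raw// lam add0r => /eqP; rewrite subr_eq0 => /eqP <-.
by rewrite mulrA -normrM divfK// mulrC.
Qed.

Lemma valuation_formula : exists v : 'rV[R]_n, dot v w != 0 /\
  forall K u, convex_body K ->
    hs (Phi K) u = hs (Phi [set 0]) u + fine (volume_n K) * `|dot v u|.
Proof.
have [v [vw vbox]] := box_formula bodyPhi trPhi valPhi symPhi c_gt0 C_gt0 VCP A0_unit
  A0_w A0_L i1_neq w_neq0 L_w.
exists v; split=> // K u bK; have pf := polytope_formula vw vbox u.
pose q : R := `|dot v u|; have q0 : 0 <= q by exact: normr_ge0.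
have q1 : 0 < 1 + q by rewrite ltr_pwDl.
have KV := volume_fin n_gt0 (bounded_body bK).
(* An outer polytope costs [e] in the support value and [e * q] in the volume term. Its volume is
   controlled by monotonicity from below and [volume_thicken] from above. *)
suff H e : 0 < e -> `|hs (Phi K) u - (hs (Phi [set 0]) u + fine (volume_n K) * q)| <= e * (1 + q).
  apply/eqP; rewrite -subr_eq0 -normr_le0; apply/ler_addgt0Pr => e e0.
  by have := H (e / (1 + q)) (divr_gt0 e0 q1); rewrite add0r divfK// gt_eqF.
move=> e0; have [d1 d10 d1P] := hs_continuous bodyPhi contPhi u bK e0.
have [_ [cK _]] := bK.
have [|d2 d20 d2P] := volume_thicken cK e0.
  by rewrite -ge0_fin_numE// volume_ge0.
have dd : 0 < Num.min d1 d2 by rewrite lt_min d10.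
have [s [d d0 [bs s1 s2]]] := polytope_approx bK dd.
have Ks : K `<=` hp s by move=> x Kx; apply: (s1 x x Kx); rewrite subrr normr0 ltW.
have s0 : hp s !=set0 by have [[x /Ks sx] _] := bK; exists x.
have near : near_sets d1 K (hp s).
  split=> x; first by move=> Kx; exists x; [exact: Ks|rewrite subrr normr0 ltW].
  by move=> /s2[y Ky]; rewrite le_min => /andP[xy _]; exists y; rewrite // distrC.
have := d1P _ (hp_body bs s0) near.
have := pf s bs; rewrite rel1E// => pfs.
have sV := volume_fin n_gt0 bs.
have V1 : fine (volume_n K) <= fine (volume_n (hp s)).
  by apply: fine_le => //; exact: volume_mono.
have V2 : fine (volume_n (hp s)) <= fine (volume_n K) + e.
  have := d2P (hp s); rewrite -(fineK KV) -(fineK sV) -EFinD lee_fin; apply=> x.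
  by move=> /s2[y Ky]; rewrite le_min => /andP[_ xy]; exists y.
have V1q := ler_wpM2r q0 V1; have V2q := ler_wpM2r q0 V2.
rewrite mulrDl -/q in V2q pfs *.
by rewrite mulrDr mulr1 ltr_norml ler_norml => /andP[h1 h2]; apply/andP; split; lra.
Qed.

End Formula.

(** * Cylinders over a hyperplane section *)

Section Cylinders.
Context {R : realType}.

Definition segment n (v : 'rV[R]_n) : set 'rV[R]_n :=
  [set t *: v | t in [set t : R | -1 <= t <= 1]].

Lemma body_segment n (v : 'rV[R]_n) : convex_body (segment v).
Proof.
suff -> : segment v = aff v 0 (rbox (- (1%:M)) 1%:M).
  by apply/body_aff/body_rbox => i; rewrite !mxE !ord1 !eqxx !mulr1n; lra.
apply/seteqP; split=> [_ [t t1 <-]|_ [x x1 <-]].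
  exists t%:M; last by rewrite mul_scalar_mx addr0.
  by move=> i; rewrite !mxE !ord1 !eqxx !mulr1n.
exists (x 0 0); last by rewrite [x in RHS]mx11_scalar mul_scalar_mx addr0.
by have := x1 0; rewrite !mxE eqxx !mulr1n.
Qed.

Lemma body_sdil n (K : set 'rV[R]_n) t : convex_body K -> convex_body (sdil t K).
Proof.
move=> bK; suff -> : sdil t K = aff (t%:M : 'M[R]_n) 0 K by exact: body_aff.
by apply: eq_imagel => x _; rewrite mul_mx_scalar addr0.
Qed.

Lemma body_minksum n (A B : set 'rV[R]_n) :
  convex_body A -> convex_body B -> convex_body (minksum A B).
Proof.
move=> [[a Aa] [cA xA]] [[b Bb] [cB xB]]; split; first by exists (a + b), a, b.
split; last first.
  move=> _ _ t [x [y [Ax [By ->]]]] [x' [y' [Ax' [By' ->]]]] t01.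
  exists ((1 - t) *: x + t *: x'), ((1 - t) *: y + t *: y').
  by rewrite !scalerDr addrACA; split; [exact: xA|split=> //; exact: xB].
have -> : minksum A B = (fun p => p.1 + p.2) @` (A `*` B).
  apply/seteqP; split=> [_ [x [y [Ax [By ->]]]]|_ [[x y] [/= Ax By] <-]].
    by exists (x, y).
  by exists x, y.
apply: continuous_compact; last exact: compact_setX.
apply: continuous_subspaceT; exact: add_continuous.
Qed.

Lemma hs_sdil_segment n (v u : 'rV[R]_n) t :
  hs (sdil t (segment v)) u = `|t| * `|dot v u|.
Proof.
apply: hs_eq; first exact/body_sdil/body_segment.
  move=> _ [_ [a /= a1 <-] <-]; rewrite !dotZl; apply: le_trans (ler_norm _) _.
  rewrite !normrM ler_wpM2l// ler_piMl// ler_norml.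
  exact: a1.
have [h|h] := leP 0 (t * dot v u).
  exists (t *: v); last by rewrite dotZl -normrM ger0_norm.
  by exists v => //; exists 1; rewrite ?scale1r//=; lra.
exists (t *: - v); last by rewrite dotZl dotNl -normrM ltr0_norm// mulrN.
by exists (- v) => //; exists (-1); rewrite ?scaleN1r//=; lra.
Qed.

Lemma sdil0 n (v : 'rV[R]_n) : sdil 0 (segment v) = [set 0].
Proof.
apply/seteqP; split=> [_ [x _ <-]|_ ->]; first by rewrite scale0r.
by exists 0; rewrite ?scale0r//; exists 0; rewrite ?scale0r//=; lra.
Qed.

Lemma volume_point n : (0 < n)%N -> volume_n [set 0 : 'rV[R]_n] = 0%E.
Proof.
move=> n0; apply/eqP; rewrite eq_le volume_ge0 andbT.
have h i : (0 : 'rV[R]_n) 0 i <= (0 : 'rV[R]_n) 0 i by [].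
apply: le_trans (volume_mono _) (le_trans (volume_rbox_le n0 h) _).
  by move=> _ -> i; rewrite !mxE lexx.
by rewrite subrr vol0.
Qed.

Lemma affdim_le n (K : set 'rV[R]_n) : (affdim K <= n)%N.
Proof. by apply/bigmax_leqP => i _; rewrite -ltnS. Qed.

Variables (m : nat) (L : set 'rV[R]_m.+1) (A : 'M[R]_m.+1) (v w : 'rV[R]_m.+1).
Hypotheses (bL : convex_body L) (sL : origin_symmetric L).
Hypothesis A_unit : A \in unitmx.
Hypothesis A_L : forall i, i != 0 -> L (row i A) /\ dot (row i A) w = 0.
Hypothesis w_neq0 : w != 0.
Hypothesis L_w : forall x, L x -> dot x w = 0.

(** For [v] transversal to the hyperplane these rows are coordinates in which coordinate 0 vanishes
    on [L] and the segment runs along axis 0. *)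
Definition slanted : 'M[R]_m.+1 := \matrix_i (if i == 0 then v else row i A).

Lemma slanted_unit : dot v w != 0 -> slanted \in unitmx.
Proof.
move=> vw; rewrite -row_free_unit; apply: inj_row_free => z zM.
have rowE0 i : row i slanted = if i == 0 then v else row i A by rewrite rowK.
have z0 : z 0 0 = 0.
  have : dot (z *m slanted) w = 0 by rewrite zM dot0l.
  rewrite mulmx_sum_row dot_suml (bigD1 0)//= big1 ?addr0; last first.
    by move=> i i0; rewrite rowE0 (negPf i0) dotZl (A_L i0).2 mulr0.
  by rewrite rowE0 eqxx dotZl => /eqP; rewrite mulf_eq0 (negPf vw) orbF => /eqP.
have : z *m A = 0.
  rewrite -zM !mulmx_sum_row (bigD1 0)//= [in RHS](bigD1 0)//= z0 !scale0r.
  by congr (_ + _); apply: eq_bigr => i i0; rewrite rowE0 (negPf i0).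
move: A_unit; rewrite -row_free_unit => fA zA.
by apply: (row_free_inj fA); rewrite mul0mx.
Qed.

Lemma slanted_mem i : minksum L (segment v) (row i slanted).
Proof.
have L0 := sym_body0 bL sL.
have rowE0 : row i slanted = if i == 0 then v else row i A by rewrite rowK.
rewrite rowE0; case: eqVneq => [_|i0].
  by exists 0, v; split=> //; split; [exists 1; rewrite ?scale1r//=; lra|rewrite add0r].
exists (row i A), 0; split; first by have [] := A_L i0.
by split; [exists 0; rewrite ?scale0r//=; lra|rewrite addr0].
Qed.

Lemma affdim_cylinder : dot v w != 0 -> affdim (minksum L (segment v)) = m.+1.
Proof.
move=> vw; apply/eqP; rewrite eqn_leq affdim_le.
apply: has_affindep_le; exists 0, slanted; split.
- have L0 := sym_body0 bL sL; exists 0, 0; split=> //.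
  by split; [exists 0; rewrite ?scale0r//=; lra|rewrite addr0].
- by move=> i; rewrite add0r; exact: slanted_mem.
by apply/eqP; have := slanted_unit vw; rewrite -row_free_unit.
Qed.

Lemma cylinder_transversal : affdim (minksum L (segment v)) = m.+1 -> dot v w != 0.
Proof.
move=> dimK; apply/eqP => vw.
have Kw x : minksum L (segment v) x -> dot x w = 0.
  by move=> [y [_ [Ly [[t _ <-] ->]]]]; rewrite dotDl dotZl vw mulr0 addr0 L_w.
have K0 : minksum L (segment v) !=set0 by exists (row 0 slanted); exact: slanted_mem.
have [x0 [M [Kx0 KM rM]]] := has_affindep_affdim K0.
rewrite dimK in M KM rM.
have uM : M \in unitmx by rewrite -row_free_unit /row_free rM.
have Mw : M *m w^T = 0.
  apply/matrixP => i j; rewrite !ord1 -[LHS]/((M *m w^T) i 0) [RHS]mxE.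
  have := Kw _ (KM i); rewrite dotDl Kw// add0r /dot -row_mul mxE.
  by [].
move: w_neq0; rewrite -trmx_eq0 -[w^T](mulKmx uM) Mw mulmx0 eqxx.
by [].
Qed.

(** In slanted coordinates stretching the segment by [t] is scaling coordinate 0 by [t]. The scaling
    contributes exactly [t], and the changes of coordinates contribute [C1] and [C2], independent of
    [t]. *)
Lemma cylinder_volume : dot v w != 0 -> exists c C : R, [/\ 0 < c, 0 < C &
  forall t, 0 <= t -> ((c * t)%:E <= volume_n (minksum L (sdil t (segment v))) <=
    (C * t)%:E)%E].
Proof.
move=> vw; have uM := slanted_unit vw; set M := slanted in uM.
pose T t := minksum L (sdil t (segment v)).
pose X1 : set 'rV[R]_m.+1 := [set x | T 1 (x *m M)].
pose D t (x : 'rV[R]_m.+1) : 'rV[R]_m.+1 := setc x 0 (t * x 0 0).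
have n0 : (0 < m.+1)%N by [].
have T1E : T 1 = minksum L (segment v).
  congr minksum; apply/seteqP; split=> [_ [x sx <-]|x sx]; first by rewrite scale1r.
  by exists x; rewrite ?scale1r.
have row0 : row 0 M = v by rewrite rowK.
have DM t x : D t x *m M = x *m M + ((t - 1) * x 0 0) *: v.
  have -> : D t x = x + ((t - 1) * x 0 0) *: delta_mx 0 0.
    apply/rowP => i; rewrite !mxE eqxx /=; case: eqVneq => [->|_] /=; ring.
  by rewrite mulmxDl -scalemxAl -rowE row0.
have coord0 (l : 'rV[R]_m.+1) s : dot l w = 0 -> ((l + s *: v) *m invmx M) 0 0 = s.
  move=> lw; apply: (mulIf vw).
  have : dot ((l + s *: v) *m invmx M *m M) w = s * dot v w.
    by rewrite mulmxKV// dotDl dotZl lw add0r.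
  rewrite mulmx_sum_row dot_suml (bigD1 0)//= big1 ?addr0; last first.
    by move=> i i0; rewrite rowK (negPf i0) dotZl (A_L i0).2 mulr0.
  by rewrite row0 dotZl.
have TE t : 0 <= t -> T t = [set x *m M | x in D t @` X1].
  move=> t0; apply/seteqP; split=> [x [l [_ [Ll [[_ [s s1 <-] <-] ->]]]]|].
    pose y := (l + s *: v) *m invmx M.
    exists (D t y).
      exists y => //; rewrite /X1/= mulmxKV// T1E.
      by exists l, (s *: v); split=> //; split=> //; exists s.
    rewrite DM mulmxKV// coord0 ?L_w// scalerA -addrA -scalerDl.
    by congr (_ + _ *: _); ring.
  move=> _ [_ [x X1x <-] <-]; rewrite DM.
  move: X1x; rewrite /X1/= T1E => -[l [_ [Ll [[s s1 <-] xM]]]].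
  have xs : x 0 0 = s by rewrite -(mulmxK uM x) xM coord0// L_w.
  rewrite xM xs; exists l, (t *: (s *: v)); split=> //; split.
    by exists (s *: v) => //; exists s.
  by rewrite -addrA scalerA -scalerDl; congr (_ + _ *: _); ring.
have [C1 C10 C1P] := volume_linear_le n0 M.
have [C2 C20 C2P] := volume_linear_le n0 (invmx M).
have invE X : [set x *m invmx M | x in [set x *m M | x in X]] = X.
  apply/seteqP; split=> [_ [_ [x Xx <-] <-]|x Xx]; first by rewrite mulmxK.
  by exists (x *m M); [exists x|rewrite mulmxK].
have bX1 : bnd X1.
  have := bounded_body (body_minksum bL (body_segment v)); rewrite -T1E => bT.
  have fM : row_free M by rewrite row_free_unit.
  by have := bnd_preimage 0 fM bT; apply: bnd_sub => x; rewrite /= addr0.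
have V1f := volume_fin n0 bX1; set V1 := fine (volume_n X1).
have VE : volume_n X1 = V1%:E by rewrite fineK.
have V1_gt0 : 0 < V1.
  pose q : 'rV[R]_m.+1 := const_mx m.+1%:R^-1.
  (* All rows of the frame lie in the cylinder, so a whole cube of coefficients does. *)
  have sub : rbox (- q) q `<=` X1.
    move=> x xq; rewrite /X1/= T1E.
    have [_ [_ cT]] := body_minksum bL (body_segment v).
    rewrite mulmx_sum_row; apply: sym_convex_span => //.
    - move=> _ [l [_ [Ll [[s s1 <-] ->]]]]; exists (- l), (- s *: v).
      split; [exact: sL|split]; last by rewrite opprD scaleNr.
      by exists (- s) => //=; move: s1 => /= /andP[h1 h2]; apply/andP; split; lra.
    - exact: slanted_mem.
    - by move=> i; have := xq i; rewrite !mxE ler_norml.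
  have := volume_mono sub; rewrite volume_rbox// => [|i]; last first.
    by rewrite !mxE ge0_cp// invr_ge0.
  rewrite VE lee_fin; apply: lt_le_trans; apply: prodr_gt0 => i _.
  have : 0 < m.+1%:R^-1 :> R by rewrite invr_gt0 ltr0n.
  by move=> h; rewrite !mxE opprK addr_gt0.
exists (V1 / C2), (C1 * V1); split; rewrite ?divr_gt0 ?mulr_gt0// => t.
(* At [t = 0] the scaling is not invertible; the cylinder is then [L], a null set in its
   hyperplane. *)
rewrite le_eqVlt => /orP[/eqP <-|t0].
  rewrite !mulr0; have -> : volume_n (T 0) = 0%E.
    apply: (volume_hyperplane A_unit (i0 := 0) (w := w)) => //.
    - by move=> i i0; have [] := A_L i0.
    - exact/bounded_body/body_minksum/body_sdil/body_segment.
    rewrite /T sdil0 => _ [x [_ [Lx [-> ->]]]].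
    by rewrite addr0 L_w.
  by rewrite lexx.
have tn0 : t != 0 by rewrite gt_eqF.
rewrite -/(T t) (TE t (ltW t0)); apply/andP; split.
  have h1 := C2P [set x *m M | x in D t @` X1]; rewrite invE in h1.
  have ti0 : t^-1 != 0 by rewrite invr_eq0.
  have h2 := volume_scale_le n0 (D t @` X1) 0 ti0.
  have E : [set setc x 0 (t^-1 * x 0 0) | x in D t @` X1] = X1.
    have DK x : setc (D t x) 0 (t^-1 * (D t x) 0 0) = x.
      apply/rowP => i; rewrite !setcE eqxx; case: eqVneq => [->|_] //.
      by rewrite mulKf.
    apply/seteqP; split=> [_ [_ [x Xx <-] <-]|x Xx]; first by rewrite DK.
    by exists (D t x); [exists x|rewrite DK].
  rewrite E VE gtr0_norm ?invr_gt0// in h2.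
  have h3 : (t%:E * V1%:E <= volume_n (D t @` X1))%E.
    by rewrite -lee_pdivlMl.
  have := le_trans h3 h1; rewrite -lee_pdivrMl// => /(le_trans _); apply.
  by rewrite -!EFinM lee_fin le_eqVlt; apply/orP; left; apply/eqP; ring.
apply: le_trans (C1P _) _.
have := volume_scale_le n0 X1 0 tn0; rewrite VE gtr0_norm// => h.
apply: le_trans (lee_wpmul2l _ h) _; first by rewrite lee_fin ltW.
by rewrite -!EFinM lee_fin le_eqVlt; apply/orP; left; apply/eqP; ring.
Qed.

End Cylinders.

Theorem theorem5p3 (R : realType) (n : nat) (Phi : set 'rV[R]_n -> set 'rV[R]_n) :
  (2 <= n)%N ->
  maps_bodies Phi -> hcontinuous Phi -> transl_invariant Phi ->
  minkowski_valuation Phi -> symmetric_images Phi ->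
  (VC Phi /\ affdim (Phi [set 0]) = n.-1) <->
  (exists L S : set 'rV[R]_n,
     [/\ convex_body L /\ origin_symmetric L, affdim L = n.-1,
         centered_segment S, affdim (minksum L S) = n &
         forall K, convex_body K -> Phi K = minksum L (sdil (fine (volume_n K)) S)]).
Proof.
case: n Phi => // m Phi m1 bodyPhi contPhi trPhi valPhi symPhi; rewrite -pred_Sn.
have n0 : (0 < m.+1)%N by [].
have bP := @body_point R m.+1.
split=> [[[c [C [c0 C0 VCP]]] dimL]|[L [_ [[bL sL] dimL [v ->] dimLS PhiE]]]].
  have bL := bodyPhi _ bP; have sL := symPhi _ bP.
  have [L0 [_ xL]] := bL.
  have [A [w [uA AL _ w0 Lw]]] := hyperplane_frame L0 xL sL dimL.
  (* The assumption [2 <= n] provides a second index, hence a nonzero vector in [Phi [set 0]]. *)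
  pose i1 : 'I_m.+1 := Ordinal m1; have i10 : i1 != 0 by [].
  have [v [vw vE]] := valuation_formula bodyPhi contPhi trPhi valPhi symPhi c0 C0 VCP uA
    (fun i i0 => (AL i i0).2) (fun i i0 => (AL i i0).1) i10 w0 Lw n0.
  exists (Phi [set 0]), (segment v); split=> //; first by exists v.
    exact: (affdim_cylinder bL sL uA AL).
  move=> K bK; have bS := body_sdil (fine (volume_n K)) (body_segment v).
  apply: hs_inj; [exact: bodyPhi|exact: body_minksum|move=> u].
  rewrite hs_minksum// hs_sdil_segment vE// (ger0_norm (x := fine _))//.
  by rewrite fine_ge0// volume_ge0.
have [L0 [_ xL]] := bL.
have [A [w [uA AL _ w0 Lw]]] := hyperplane_frame L0 xL sL dimL.
have vw := cylinder_transversal bL sL AL w0 Lw dimLS.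
have [c [C [c0 C0 VCP]]] := cylinder_volume bL sL uA AL w0 Lw vw.
split.
  exists c, C; split=> // K bK; have KV := volume_fin n0 (bounded_body bK).
  rewrite PhiE// -{1 4}(fineK KV) -!EFinM; apply: VCP.
  by rewrite fine_ge0// volume_ge0.
(* A point has volume zero, so its segment term collapses to the origin. *)
suff -> : Phi [set 0] = L by [].
rewrite PhiE// volume_point// -/(segment v) sdil0.
apply/seteqP; split=> [_ [x [_ [Lx [-> ->]]]]|x Lx]; first by rewrite addr0.
by exists x, 0; rewrite addr0.
Qed.
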